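(* Let $S$ be a generic $K3$ surface over $\mathbb{C}$, let $H$ be the generator of $\operatorname{Pic}(S)$, put $\gamma = H^2$, and let $d$ be a positive integer. If the linear system $\mathcal{L}^{\gamma}(d,\mu)$ on $S$ is non-special for all $\mu$, then for all positive integers $m$, $u$ and $w$ the linear system $\mathcal{L}^{\gamma}(d,m^{n})$ on $S$ with $n = 4^u 9^w$ is non-special.
   Context: A generic $K3$ surface is a smooth projective $K3$ surface $S$ over $\mathbb{C}$ with $\operatorname{Pic}(S)\cong\mathbb{Z}$; $H$ denotes the (ample) generator, and $H^2=\gamma=2g-2\geq 2$. For $n$ points $Q_1,\dots,Q_n$ in general position on $S$ and multiplicities $m_1,\dots,m_n$ (natural numbers), $\mathcal{L}^{\gamma}(d,m_1,\dots,m_n)$ is the linear system of curves in $|dH|$ having multiplicity (at least) $m_i$ at $Q_i$ for all $i$. The notation $\mathcal{L}^{\gamma}(d,m^{n})$ means $n$ general points, all with multiplicity $m$; $\mathcal{L}^{\gamma}(d,\mu)$ means one general point of multiplicity $\mu$. The virtual dimension is $v = \dim|dH| - \sum_i \frac{m_i(m_i+1)}{2} = \frac{\gamma d^2}{2}+1-\sum_i \frac{m_i(m_i+1)}{2}$, the expected dimension is $e=\max\{v,-1\}$, and $l$ denotes the actual (projective) dimension of the linear system, with $l=-1$ when it is empty. One always has $v\le e\le l$. The system is special if $e<l$ and non-special if $e=l$. *)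

(* Defs.v *)
From mathcomp Require Import all_boot all_order all_algebra.
From mathcomp Require Import complex mpoly reals.

Set Implicit Arguments.
Unset Strict Implicit.
Unset Printing Implicit Defensive.

Import Order.TTheory GRing.Theory Num.Theory.
Local Open Scope ring_scope.

(* Integral projective varieties over an algebraically closed field C of
   characteristic 0 are presented by their generic point: K is the function
   field, [iota] its C-algebra structure, and x = (x_0 : ... : x_N) a
   K-rational point of P^N such that K is generated by the ratios of the x_i.
   The variety X is the closure of x: its homogeneous ideal consists of the
   forms vanishing at x.  Local rings are subrings of K, and since X is
   integral so are the modules of sections of all its line bundles. *)

Section ProjectiveVarieties.
Variables (C : numClosedFieldType) (K : fieldType) (iota : {rmorphism C -> K}).

Definition generic_point N (x : 'I_N.+1 -> K) : Prop :=
  (exists i, x i != 0) /\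
  forall f : K, exists d (F G : {mpoly C[N.+1]}),
    [/\ F \is d.-homog, G \is d.-homog, mmap iota x G != 0 &
        f = mmap iota x F / mmap iota x G].

Definition alg_indep k (y : 'I_k -> K) : Prop :=
  forall p : {mpoly C[k]}, mmap iota y p = 0 -> p = 0.

Definition trdeg_eq k : Prop :=
  (exists y : 'I_k -> K, alg_indep y) /\
  (forall y : 'I_k.+1 -> K, ~ alg_indep y).

Definition dim_eq (V : K -> Prop) r : Prop :=
  exists b : 'I_r -> K,
    (forall f, V f <-> exists c : 'I_r -> C, f = \sum_(i < r) iota (c i) * b i)
    /\ (forall c : 'I_r -> C,
          \sum_(i < r) iota (c i) * b i = 0 -> forall i, c i = 0).

Definition derivation (delta : K -> K) : Prop :=
  [/\ forall f g, delta (f + g) = delta f + delta g,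
      forall f g, delta (f * g) = f * delta g + g * delta f &
      forall c, delta (iota c) = 0].

(* Rational 2-forms are viewed as alternating functions of two C-derivations
   of K; this is the form du /\ dv. *)
Definition wedge (u v : K) (delta eps : K -> K) : K :=
  delta u * eps v - delta v * eps u.

Section Model.
Variables (N : nat) (x : 'I_N.+1 -> K).
Implicit Types (P Q : 'rV[C]_N.+1) (D E H : 'rV[C]_N.+1 -> K) (f g h : K).

(* Closed points of X, each represented by its unique vector of homogeneous
   coordinates whose first nonzero entry is 1. *)
Definition point P : Prop :=
  (exists i, P 0 i = 1 /\ forall j : 'I_N.+1, (j < i)%N -> P 0 j = 0) /\
  forall d (F : {mpoly C[N.+1]}), F \is d.-homog ->
    mmap iota x F = 0 -> F.@[P 0] = 0.

Definition local_ring P f : Prop :=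
  exists d (F G : {mpoly C[N.+1]}),
    [/\ F \is d.-homog, G \is d.-homog, G.@[P 0] != 0 &
        f = mmap iota x F / mmap iota x G].

Definition max_ideal P f : Prop :=
  exists d (F G : {mpoly C[N.+1]}),
    [/\ F \is d.-homog, G \is d.-homog, F.@[P 0] = 0, G.@[P 0] != 0 &
        f = mmap iota x F / mmap iota x G].

Definition local_unit P f : Prop :=
  [/\ f != 0, local_ring P f & local_ring P f^-1].

Fixpoint max_ideal_pow P k f : Prop :=
  if k is k'.+1 then
    exists r (a b : 'I_r -> K),
      (forall i, max_ideal P (a i) /\ max_ideal_pow P k' (b i)) /\
      f = \sum_(i < r) a i * b i
  else local_ring P f.

Definition gen_max_ideal P u v : Prop :=
  [/\ max_ideal P u, max_ideal P v &
      forall f, max_ideal P f ->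
        exists a b, [/\ local_ring P a, local_ring P b & f = a * u + b * v]].

(* All local rings at closed points are regular of dimension 2. *)
Definition smooth_surface : Prop :=
  trdeg_eq 2 /\ forall P, point P -> exists u v, gen_max_ideal P u v.

(* A nowhere vanishing global section of the canonical bundle. *)
Definition trivial_canonical : Prop :=
  exists omega : (K -> K) -> (K -> K) -> K,
  forall P, point P ->
  exists u v e, [/\ gen_max_ideal P u v, local_unit P e &
    forall delta eps : K -> K, derivation delta -> derivation eps ->
      omega delta eps = e * wedge u v delta eps].

Definition chart_sections (i j : 'I_N.+1) f : Prop :=
  forall P, point P -> P 0 i != 0 -> P 0 j != 0 -> local_ring P f.

(* H^1(X, O_X) = 0, by Cech cohomology of the affine cover {x_i <> 0}.  The
   charts with x_i = 0 in K are empty and impose no actual condition. *)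
Definition h1_structure_sheaf_zero : Prop :=
  forall g : 'I_N.+1 -> 'I_N.+1 -> K,
    (forall i j, chart_sections i j (g i j)) ->
    (forall i j k, g i k = g i j + g j k) ->
    exists h : 'I_N.+1 -> K,
      (forall i, chart_sections i i (h i)) /\ forall i j, g i j = h j - h i.

Definition K3_surface : Prop :=
  [/\ generic_point x, smooth_surface, trivial_canonical &
      h1_structure_sheaf_zero].

(* A Cartier divisor is given by a local equation [D P] at each closed point P,
   which has to be a local equation on a Zariski neighbourhood of P. *)
Definition cartier D : Prop :=
  forall P, point P -> D P != 0 /\
    exists d (G : {mpoly C[N.+1]}),
      [/\ G \is d.-homog, G.@[P 0] != 0 &
          forall Q, point Q -> G.@[Q 0] != 0 -> local_unit Q (D Q / D P)].

Definition div_add D E : 'rV[C]_N.+1 -> K := fun P => D P * E P.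
Definition div_mul (k : int) D : 'rV[C]_N.+1 -> K := fun P => D P ^ k.

Definition lin_equiv D E : Prop :=
  exists g, g != 0 /\ forall P, point P -> local_unit P (D P / (g * E P)).

Definition effective D : Prop := forall P, point P -> local_ring P (D P).

Definition global_section D f : Prop :=
  forall P, point P -> local_ring P (f * D P).

Definition Pic_infinite_cyclic_generated_by H : Prop :=
  [/\ cartier H,
      forall D, cartier D -> exists k : int, lin_equiv D (div_mul k H) &
      forall k : int, lin_equiv (div_mul k H) (div_mul 0 H) -> k = 0].

(* dim_C (O_P / (f, g)) = k *)
Definition colength P f g k : Prop :=
  exists b : 'I_k -> K, (forall i, local_ring P (b i)) /\
    forall h, local_ring P h ->
    exists! c : 'rV[C]_k, exists a a', [/\ local_ring P a, local_ring P a' &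
      h = \sum_(i < k) iota (c 0 i) * b i + a * f + a' * g].

(* The intersection pairing on a smooth projective surface: the unique
   symmetric bilinear pairing compatible with linear equivalence which, on two
   effective divisors without common component (that is, meeting in finitely
   many points), is the sum of the local intersection multiplicities. *)
Definition intersection_pairing
    (B : ('rV[C]_N.+1 -> K) -> ('rV[C]_N.+1 -> K) -> int) : Prop :=
  [/\ forall D E, cartier D -> cartier E -> B D E = B E D,
      forall D D' E, cartier D -> cartier D' -> cartier E ->
        B (div_add D D') E = B D E + B D' E,
      forall D D' E, cartier D -> cartier D' -> cartier E ->
        lin_equiv D D' -> B D E = B D' E &
      forall D E (s : seq 'rV[C]_N.+1) (k : 'rV[C]_N.+1 -> nat),
        cartier D -> cartier E -> effective D -> effective E -> uniq s ->
        (forall P, P \in s <->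
           [/\ point P, max_ideal P (D P) & max_ideal P (E P)]) ->
        (forall P, P \in s -> colength P (D P) (E P) (k P)) ->
        B D E = (\sum_(P <- s) k P)%N%:Z].

Definition self_intersection D (gamma : int) : Prop :=
  exists B, intersection_pairing B /\ B D D = gamma.

(* L(D; m_1, ..., m_n) at the points given by the rows of Q, as the space of
   those sections of O(D) whose divisor has multiplicity at least m_i at Q_i. *)
Definition linear_system D n (Q : 'M[C]_(n, N.+1)) (m : 'I_n -> nat) f : Prop :=
  global_section D f /\
  forall i, max_ideal_pow (row i Q) (m i) (f * D (row i Q)).

Definition multihomogeneous n (G : {mpoly C[n * N.+1]}) : Prop :=
  exists e : 'I_n -> nat, forall (t : 'I_n -> C) (A : 'M[C]_(n, N.+1)),
    G.@[mxvec (\matrix_(i, j) (t i * A i j)) 0] =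
      (\prod_i t i ^+ e i) * G.@[mxvec A 0].

(* [prop] holds for n points in general position, i.e. on a nonempty (hence
   dense) Zariski open subset of X^n. *)
Definition in_general_position n (prop : 'M[C]_(n, N.+1) -> Prop) : Prop :=
  exists G : {mpoly C[n * N.+1]},
    [/\ multihomogeneous G,
        exists Q : 'M[C]_(n, N.+1),
          (forall i, point (row i Q)) /\ G.@[mxvec Q 0] != 0 &
        forall Q : 'M[C]_(n, N.+1), (forall i, point (row i Q)) ->
          G.@[mxvec Q 0] != 0 -> prop Q].

End Model.

(* Very ample: O(D) is the pullback of O(1) by a closed embedding of X in some
   P^M.  Such an embedding is another generic point y of a projective model
   of K having the same local rings as X; the y_i are then the sections of
   O(D) corresponding to the coordinates of P^M. *)
Definition very_ample N (x : 'I_N.+1 -> K) (D : 'rV[C]_N.+1 -> K) : Prop :=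
  exists M (y : 'I_M.+1 -> K),
    [/\ generic_point y,
        forall P, point x P -> exists Q, point y Q /\
          forall f, local_ring x P f <-> local_ring y Q f,
        forall Q, point y Q -> exists P, point x P /\
          forall f, local_ring x P f <-> local_ring y Q f &
        forall P, point x P ->
          (forall i, local_ring x P (y i * D P)) /\
          exists i, local_unit x P (y i * D P)].

Definition ample N (x : 'I_N.+1 -> K) (D : 'rV[C]_N.+1 -> K) : Prop :=
  exists k : nat, (0 < k)%N /\ very_ample x (div_mul k%:Z D).

Definition generic_K3 N (x : 'I_N.+1 -> K) (H : 'rV[C]_N.+1 -> K) : Prop :=
  [/\ K3_surface x, Pic_infinite_cyclic_generated_by x H & ample x H].

(* The division by 2 of gamma * d ^ 2 is exact: the intersection form of a K3
   surface is even. *)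
Definition virtual_dim (gamma : int) (d n : nat) (m : 'I_n -> nat) : int :=
  (gamma * d%:Z ^+ 2 %/ 2)%Z + 1 - (\sum_(i < n) (m i * (m i).+1)./2)%N%:Z.

Definition expected_dim (gamma : int) (d n : nat) (m : 'I_n -> nat) : int :=
  Order.max (virtual_dim gamma d m) (- 1).

Definition non_special N (x : 'I_N.+1 -> K) (H : 'rV[C]_N.+1 -> K)
    (gamma : int) (d n : nat) (m : 'I_n -> nat) : Prop :=
  in_general_position x (fun Q : 'M[C]_(n, N.+1) =>
    exists r : nat,
      dim_eq (linear_system x (div_mul d%:Z H) Q m) r /\
      r%:Z - 1 = expected_dim gamma d m).

End ProjectiveVarieties.

(* Main.v *)
(* Write N_m = m (m + 1) / 2, and let r be the number of sections.  The claim to propagate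
   from h to 4 h and 9 h is that, for all m, the conditions that h general points of
   multiplicity m impose on the sections have rank min (r, h N_m).

   Let k = 4 or 9 points of multiplicity m collide along (e^(t+1) q.1, e^(t+2) q.2), in
   local coordinates at a general point Q with a general tangent direction.  In the limit
   they impose the vanishing of the Taylor coefficients with exponents (i, j), i + j < t
   or i + j = t, j < s, provided that the k points q of multiplicity m impose
   independent and exhaustive conditions on the span of these monomials.  This holds for
   k = 4, (t, s) = (2 m, m) and k = 9, (t, s) = (3 m, 3 m): cutting the set of exponents
   by lines (a further toric degeneration) reduces it to single points and to sets of m
   parallel rows of lengths 1, ..., m, handled by Bezout.

   The limit conditions at h general points have rank min (r, h (N_t + s)) = min (r, h k N_m):
   if one more derivative of order t in a general tangent direction does not raise the rank,
   then, differentiating in the direction, neither do all of them, and by symmetry the rank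
   is that of h points of multiplicity t + 1.

   On the surface, two commuting derivations dual to a transcendence basis detect
   multiplicities at the points of an open set, because the Euler operator acts on m^k / m^(k+1)
   as k.  General points exist by elimination (primitive element and resultant). *)
Require Import Defs.
From HB Require Import structures.
From mathcomp Require Import all_boot all_order all_algebra.
From mathcomp Require Import perm qpoly mxpoly separable boolp zify ring.
From mathcomp Require Import complex mpoly reals.

Set Implicit Arguments.
Unset Strict Implicit.
Unset Printing Implicit Defensive.

Import Order.TTheory GRing.Theory Num.Theory.
Local Open Scope ring_scope.

(** * Interpolation in the plane *)

(** Counting dictates (t, s): k N_m = N_t + s with s <= t + 1. The weights (t + 1, t + 2) order
    monomials of degree at most t by degree and then by second exponent, so that the staircase is an
    initial segment. The obstacle is that points of the surface cannot be moved along a curve with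
    prescribed expansion. The arc is therefore only formal: a ring morphism from regular functions
    to C[e] / e^(N+1), made of exponentials of the commuting derivations. A determinant that is
    nonzero under such morphisms comes from a polynomial in e over the ring of functions; one of its
    coefficients is a nonzero function, hence nonzero at an actual point. Only the existence of one
    good tuple of points is propagated. Degeneration, collision and semicontinuity all rest on one
    property of the ring of functions: two nonzero functions are both nonzero at some common point.
    General position is recovered at the end from a single minor. *)

Lemma exists_nonroot (F : numFieldType) (p : {poly F}) :
  p != 0 -> exists x, p.[x] != 0.
Proof.
move=> p0; pose rs : seq F := [seq n%:R | n <- iota 0 (size p)].
have [/allP H|] := boolP (all (root p) rs).
  have := max_poly_roots p0 (introT allP H).
  rewrite size_map size_iota ltnn map_inj_uniq ?iota_uniq; first by move=> /(_ isT).
  by move=> a b /eqP; rewrite eqr_nat => /eqP.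
by case/allPn => x _ nx; exists x.
Qed.

Section PlaneInterpolation.
Variable F : numFieldType.
Implicit Types (D : seq (nat * nat)) (q : F * F) (c : nat * nat -> F).

Definition tri m : seq (nat * nat) :=
  [seq (i, j) | i <- iota 0 m, j <- iota 0 (m - i)].

Lemma mem_tri m i j : ((i, j) \in tri m) = (i + j < m)%N.
Proof.
apply/allpairsPdep/idP => [[x [y [+ + [-> ->]]]]|h].
  by rewrite !mem_iota; lia.
by exists i, j; rewrite !mem_iota; split=> //; lia.
Qed.

Lemma tri_uniq m : uniq (tri m).
Proof.
apply: allpairs_uniq_dep; [exact: iota_uniq|by move=> *; exact: iota_uniq|].
by move=> [a b] [a' b'] _ _ /= [-> ->].
Qed.

Lemma size_tri m : size (tri m) = ((m * m.+1)./2)%N.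
Proof.
rewrite size_allpairs_dep (eq_map (fun i => size_iota 0 (m - i))) sumnE big_map.
rewrite -{1}[m]subn0 -/(index_iota 0 m).
elim: m => [|m IH]; first by rewrite big_geq.
rewrite big_nat_recl // subn0; under eq_bigr do rewrite subSS.
have -> : (m.+1 * m.+2 = m.+1.*2 + m * m.+1)%N by lia.
by rewrite IH halfD odd_double doubleK.
Qed.

Definition vanishes m D q c := forall i j : nat, (i + j < m)%N ->
  \sum_(a <- D) c a * (a.1%:R ^+ i * a.2%:R ^+ j * (q.1 ^+ a.1 * q.2 ^+ a.2)) = 0.

(* [m]-fold points at suitable [n] points of the torus impose independent and
   exhaustive conditions on the polynomials with exponents in [D]; derivatives
   are replaced by the Euler operators, which multiply the coefficient of a
   monomial by polynomials in its exponents. *)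
Definition interpolates m n D :=
  [/\ uniq D, size D = (n * size (tri m))%N &
   exists qs : seq (F * F),
   [/\ size qs = n, forall q, q \in qs -> q.1 != 0 /\ q.2 != 0 &
     forall c, (forall q, q \in qs -> vanishes m D q c) ->
       forall a, a \in D -> c a = 0]].

Lemma interpolates_perm m n D D' :
  uniq D -> D =i D' -> interpolates m n D' -> interpolates m n D.
Proof.
move=> uD e [uD' sD' [qs [sq nz h]]].
have pe : perm_eq D D' by exact: uniq_perm.
split=> //; first by rewrite (perm_size pe).
exists qs; split=> // c hc a; rewrite e; apply: h => q /hc hq i j /hq.
by rewrite (perm_big _ pe).
Qed.

Lemma interpolates_swap m n D :
  interpolates m n D -> interpolates m n [seq (a.2, a.1) | a <- D].
Proof.
move=> [uD sD [qs [sq nz h]]]; split; rewrite ?size_map //.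
  by rewrite map_inj_uniq // => -[? ?] [? ?] [-> ->].
exists [seq (q.2, q.1) | q <- qs]; split; rewrite ?size_map //.
  by move=> _ /mapP[q /nz[? ?] ->].
move=> c hc _ /mapP[a aD ->].
apply: (h (fun a => c (a.2, a.1))) => // q qq i j ij.
have := hc (q.2, q.1) (map_f (fun q => (q.2, q.1)) qq) j i.
rewrite addnC => /(_ ij); rewrite big_map /= => e; rewrite -[RHS]e.
by apply: eq_bigr => b _ /=; ring.
Qed.

Definition conditions m (qs : seq (F * F)) := [seq (q, e) | q <- qs, e <- tri m].

Definition cond_entry (k : (F * F) * (nat * nat)) (a : nat * nat) : F :=
  a.1%:R ^+ k.2.1 * a.2%:R ^+ k.2.2 * (k.1.1 ^+ a.1 * k.1.2 ^+ a.2).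

(** The dimensions are parameters, tied to [qs] and [D] only by the equations in [cond_mxP], so that
    the matrix can be typed as square without casts. *)
Definition cond_mx m k l (qs : seq (F * F)) D : 'M[F]_(k, l) :=
  \matrix_(i, j) cond_entry (nth ((0, 0), (0%N, 0%N)) (conditions m qs) i)
                            (nth (0, 0)%N D j).

Lemma size_conditions m qs : size (conditions m qs) = (size qs * size (tri m))%N.
Proof. by rewrite size_allpairs. Qed.

Lemma cond_mxP m k l qs D c : k = size (conditions m qs) -> l = size D ->
  (forall q, q \in qs -> vanishes m D q c) <->
  cond_mx m k l qs D *m \col_j c (nth (0, 0)%N D j) = 0.
Proof.
move=> -> ->; have sumE k0 : \sum_(j < size D) cond_entry k0 (nth (0, 0)%N D j)
    * c (nth (0, 0)%N D j) = \sum_(a <- D) c a * cond_entry k0 a.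
  rewrite [RHS](big_nth (0, 0)%N) big_mkord.
  by apply: eq_bigr => j _; rewrite mulrC.
split=> [h|h q qq i j ij].
  apply/matrixP => i j; rewrite !mxE; under eq_bigr do rewrite !mxE.
  rewrite sumE; set k0 := nth _ _ _.
  have : k0 \in conditions m qs by apply: mem_nth.
  by case/allpairsP => -[q [e1 e2]] /= [/h hq]; rewrite mem_tri => /hq e ->.
have kin : (q, (i, j)) \in conditions m qs.
  by apply/allpairsP; exists (q, (i, j)); rewrite mem_tri.
have ki : (index (q, (i, j)) (conditions m qs) < size (conditions m qs))%N.
  by rewrite index_mem.
move/matrixP: h => /(_ (Ordinal ki) 0); rewrite !mxE.
under eq_bigr do rewrite !mxE.
by rewrite sumE nth_index.
Qed.

Lemma cond_mx_unit m n D (qs : seq (F * F)) : uniq D ->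
  size D = (n * size (tri m))%N -> size qs = n ->
  (forall c, (forall q, q \in qs -> vanishes m D q c) ->
     forall a, a \in D -> c a = 0) ->
  cond_mx m (size D) (size D) qs D \in unitmx.
Proof.
move=> uD sD sq h; rewrite -unitmx_tr -row_free_unit; apply: inj_row_free => v.
move/(congr1 trmx); rewrite trmx_mul trmxK trmx0 => hv.
pose c a := if insub (index a D) is Some i then v 0 i else 0.
have cE : \col_j c (nth (0, 0)%N D j) = v^T.
  apply/matrixP => j i; rewrite !mxE ord1 /c index_uniq //.
  by case: insubP => [u _ eu|/negP[]//]; congr (v _ _); apply: val_inj.
have c0 : forall a, a \in D -> c a = 0.
  by apply: h; apply/(@cond_mxP m (size D) (size D)); rewrite ?size_conditions ?sq ?cE.
apply/matrixP => i j; rewrite ord1 [RHS]mxE -(mxE trmx_key (fun j i => v i j) j 0) -/(trmx v).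
by rewrite -cE mxE c0 // mem_nth.
Qed.

(* Moving the second group of points to infinity along a one-parameter subgroup
   of the torus with weights [w1, w2] makes the interpolation matrix block
   triangular in the limit. *)
Lemma interpolates_cut m n1 n2 D1 D2 (w1 w2 t : int) :
  interpolates m n1 D1 -> interpolates m n2 D2 ->
  (forall a, a \in D1 -> w1 * a.1%:Z + w2 * a.2%:Z <= t) ->
  (forall a, a \in D2 -> t < w1 * a.1%:Z + w2 * a.2%:Z) ->
  interpolates m (n1 + n2) (D1 ++ D2).
Proof.
move=> [u1 s1 [qs1 [sq1 nz1 h1]]] [u2 s2 [qs2 [sq2 nz2 h2]]] W1 W2.
have uD : uniq (D1 ++ D2).
  rewrite cat_uniq u1 u2 andbT; apply/hasPn => a aD2; apply/negP => aD1.
  by have := W1 _ aD1; have := W2 _ aD2; lia.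
split=> //; first by rewrite size_cat s1 s2 mulnDl.
pose W (a : nat * nat) : int := w1 * a.1%:Z + w2 * a.2%:Z - t.
have W1' a : a \in D1 -> W a = - (`|W a|%N)%:Z.
  by move=> /W1 h; rewrite abszE ler0_norm ?opprK // subr_le0.
have W2'' a : a \in D2 -> (0 < `|W a|)%N.
  by move=> /W2 h; rewrite absz_gt0 subr_eq0 gt_eqF.
have W2' a : a \in D2 -> W a = (`|W a|%N)%:Z.
  by move=> /W2 h; rewrite abszE ger0_norm // subr_ge0 ltW.
have sc1 : size D1 = size (conditions m qs1) by rewrite size_conditions sq1.
have sc2 : size D2 = size (conditions m qs2) by rewrite size_conditions sq2.
pose a0 := (0, 0)%N.
pose A1 := cond_mx m (size D1) (size D1) qs1 D1.
pose A2 := cond_mx m (size D1) (size D2) qs1 D2.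
pose B1 := cond_mx m (size D2) (size D1) qs2 D1.
pose B2 := cond_mx m (size D2) (size D2) qs2 D2.
have A1U : A1 \in unitmx by exact: (cond_mx_unit u1 s1 sq1 h1).
have B2U : B2 \in unitmx by exact: (cond_mx_unit u2 s2 sq2 h2).
(* The relative weight [W] is at most 0 on [D1] and positive on [D2]. Scaling the columns in [D2] by
   s^W and the rows at the moved points by s^t leaves only powers s^|W|, in the off-diagonal blocks.
   At s = 0 the upper right block vanishes; the lower left one may survive on the cut line
   itself. *)
pose M : 'M[{poly F}]_(size D1 + size D2) := block_mx
  (map_mx polyC A1) (\matrix_(i, j) ((A2 i j)%:P * 'X^(`|W (nth a0 D2 j)|%N)))
  (\matrix_(i, j) ((B1 i j)%:P * 'X^(`|W (nth a0 D1 j)|%N))) (map_mx polyC B2).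
have evalM s : map_mx (horner_eval s) M = block_mx
    A1 (\matrix_(i, j) (A2 i j * s ^+ (`|W (nth a0 D2 j)|%N)))
    (\matrix_(i, j) (B1 i j * s ^+ (`|W (nth a0 D1 j)|%N))) B2.
  rewrite map_block_mx; congr block_mx; apply/matrixP => i j;
    by rewrite !mxE /= /horner_eval ?hornerM ?hornerC ?hornerXn.
have detM s : (\det M).[s] = \det (map_mx (horner_eval s) M).
  by rewrite -[LHS]/(horner_eval s _) -det_map_mx.
have M0 : \det M != 0.
  apply/eqP => /(congr1 (horner_eval 0)); rewrite /horner_eval detM horner0 evalM.
  have -> : \matrix_(i, j) (A2 i j * 0 ^+ (`|W (nth a0 D2 j)|%N)) = 0 :> 'M_(_, _).
    apply/matrixP => i j; rewrite !mxE expr0n.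
    by rewrite (negPf (lt0n_neq0 (W2'' _ (mem_nth _ _)))) ?mulr0.
  rewrite det_lblock => /eqP; rewrite mulf_eq0.
  by move: A1U B2U; rewrite !unitmxE !unitfE => /negPf-> /negPf->.
(* The factor 'X keeps [s] nonzero, as the moved points must stay in the torus. *)
have [s] : exists s, ('X * \det M).[s] != 0.
  by apply: exists_nonroot; rewrite mulf_neq0 // polyX_eq0.
rewrite hornerM hornerX mulf_eq0 negb_or => /andP[s0 dM].
pose g (q : F * F) : F * F := (q.1 * s^-1 ^ w1, q.2 * s^-1 ^ w2).
have gpow (q : F * F) (a : nat * nat) : (g q).1 ^+ a.1 * (g q).2 ^+ a.2 =
    q.1 ^+ a.1 * q.2 ^+ a.2 * (s^-1 ^ t * s^-1 ^ W a).
  have -> : s^-1 ^ t * s^-1 ^ W a = (s^-1 ^ w1) ^+ a.1 * (s^-1 ^ w2) ^+ a.2.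
    rewrite -expfzDr ?invr_eq0 // /W addrC subrK expfzDr ?invr_eq0 //.
    by rewrite -!exprz_exp -!exprnP.
  by rewrite /g /= !exprMn; ring.
exists (qs1 ++ map g qs2); split.
- by rewrite size_cat size_map sq1 sq2.
- move=> q; rewrite mem_cat => /orP[/nz1//|/mapP[q' /nz2[n1' n2'] ->]] /=.
  by rewrite !mulf_neq0 // expfz_neq0 // invr_eq0.
move=> c hc.
pose c' a := if a \in D1 then c a else c a * s^-1 ^ W a.
have D2n a : a \in D2 -> a \in D1 = false.
  by move=> a2; apply/negP => a1; have := W1 _ a1; have := W2 _ a2; lia.
have c'0 a : a \in D1 ++ D2 -> c' a = 0.
  pose v : 'cV[F]_(size D1 + size D2) :=
    col_mx (\col_j c' (nth a0 D1 j)) (\col_j c' (nth a0 D2 j)).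
  suff v0 : v = 0.
    have [e1 e2] : \col_j c' (nth a0 D1 j) = 0 :> 'cV_(size D1) /\
                   \col_j c' (nth a0 D2 j) = 0 :> 'cV_(size D2).
      by apply: eq_col_mx; rewrite -/v v0 col_mx0.
    rewrite mem_cat => /orP[] aD.
      have ai : (index a D1 < size D1)%N by rewrite index_mem.
      by move/matrixP: e1 => /(_ (Ordinal ai) 0); rewrite !mxE nth_index.
    have ai : (index a D2 < size D2)%N by rewrite index_mem.
    by move/matrixP: e2 => /(_ (Ordinal ai) 0); rewrite !mxE nth_index.
  have MU : map_mx (horner_eval s) M \in unitmx.
    by rewrite unitmxE unitfE -detM.
  rewrite -(mulKmx MU v); suff -> : map_mx (horner_eval s) M *m v = 0.
    by rewrite mulmx0.
  rewrite evalM mul_block_col -col_mx0.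
  have sW b : b \in D2 -> s^-1 ^ W b * s ^+ `|W b|%N = 1.
    by move=> aD; rewrite {1}W2' // -exprnP exprVn mulVf // expf_neq0.
  have sW1 b : b \in D1 -> s^-1 ^ W b = s ^+ `|W b|%N.
    by move=> aD; rewrite {1}W1' // -invr_expz -exprnP exprVn invrK.
  have sum_mx D k n (X : 'M[F]_(n, size D)) i (e : nat * nat -> F) :
      (forall j : 'I_(size D), X i j = cond_entry k (nth a0 D j) * e (nth a0 D j)) ->
      (X *m \col_j c' (nth a0 D j)) i 0 =
      \sum_(a <- D) c' a * (cond_entry k a * e a).
    move=> hX; rewrite mxE [RHS](big_nth a0) big_mkord.
    by apply: eq_bigr => j _; rewrite hX !mxE mulrC.
  have c'1 b : b \in D1 -> c' b = c b by rewrite /c' => ->.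
  have c'2 b : b \in D2 -> c' b = c b * s^-1 ^ W b by rewrite /c' => /D2n->.
  congr col_mx; apply/matrixP => i j; rewrite ord1 [RHS]mxE mxE.
    pose k := nth ((0, 0), (0%N, 0%N)) (conditions m qs1) i.
    rewrite (sum_mx D1 k _ _ _ (fun=> 1)) => [|l]; last by rewrite mxE mulr1.
    rewrite (sum_mx D2 k _ _ _ (fun a => s ^+ `|W a|%N)) => [|l]; last by rewrite !mxE.
    have : k \in conditions m qs1 by rewrite mem_nth // -sc1.
    case/allpairsP => -[q [e1 e2]] /= [qq]; rewrite mem_tri => he kE.
    have := hc q; rewrite mem_cat qq => /(_ isT _ _ he); rewrite big_cat /= => e0.
    rewrite -[RHS]e0 kE; congr (_ + _); apply: eq_big_seq => b bD; rewrite /cond_entry /=.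
      by rewrite c'1 // mulr1.
    by rewrite c'2 // -[c b in RHS]mulr1 -(sW _ bD); ring.
  pose k := nth ((0, 0), (0%N, 0%N)) (conditions m qs2) i.
  rewrite (sum_mx D1 k _ _ _ (fun a => s ^+ `|W a|%N)) => [|l]; last by rewrite !mxE.
  rewrite (sum_mx D2 k _ _ _ (fun=> 1)) => [|l]; last by rewrite mxE mulr1.
  have : k \in conditions m qs2 by rewrite mem_nth // -sc2.
  case/allpairsP => -[q [e1 e2]] /= [qq]; rewrite mem_tri => he kE.
  have := hc (g q); rewrite mem_cat map_f // orbT => /(_ isT _ _ he).
  rewrite big_cat /= => e0.
  apply: (@mulfI _ (s^-1 ^ t)); first by rewrite expfz_neq0 // invr_eq0.
  rewrite mulr0 -[RHS]e0 mulrDr !big_distrr kE /=.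
  congr (_ + _); apply: eq_big_seq => b bD; rewrite /cond_entry gpow /=.
    by rewrite c'1 // -sW1 //; ring.
  by rewrite c'2 //; ring.
move=> a aD; have := c'0 a aD; rewrite /c'; case: ifP => // _ /eqP.
have ns : s^-1 != 0 by rewrite invr_eq0.
by rewrite mulf_eq0 (negPf (expfz_neq0 _ ns)) orbF => /eqP.
Qed.

End PlaneInterpolation.

(** Vandermonde: [d] is orthogonal to every polynomial of degree below [size s], in particular to
    the one vanishing at all nodes except [x]. *)
Lemma lagrange_vanish (F : numFieldType) (s : seq F) (d : F -> F) : uniq s ->
  (forall i, (i < size s)%N -> \sum_(x <- s) d x * x ^+ i = 0) ->
  forall x, x \in s -> d x = 0.
Proof.
move=> us h x xs.
have hp (p : {poly F}) : (size p <= size s)%N -> \sum_(y <- s) d y * p.[y] = 0.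
  move=> sp; under eq_bigr do rewrite horner_coef big_distrr /=.
  rewrite exchange_big /= big1 // => i _.
  under eq_bigr do rewrite mulrCA.
  by rewrite -big_distrr /= h ?mulr0 // (leq_trans _ sp).
pose p := \prod_(y <- rem x s) ('X - y%:P).
have := hp p; rewrite size_prod_XsubC size_rem // prednK ?leqnn; last by case: (s) xs.
move=> /(_ isT); rewrite (perm_big _ (perm_to_rem xs)) /= big_cons big1_seq ?addr0.
  move/eqP; rewrite mulf_eq0 => /orP[/eqP//|].
  by rewrite -/(root _ _) root_prod_XsubC mem_rem_uniqF.
move=> y /andP[_ ys]; apply/eqP; rewrite mulf_eq0 -/(root _ _).
by rewrite root_prod_XsubC ys orbT.
Qed.

(** Parallel rows of lengths 1, ..., m. The offsets [g k] are free because Bezout counts the points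
    on each line, not their position; this allows upright and inverted triangles alike. *)
Definition rows (f g : nat -> nat) m : seq (nat * nat) :=
  flatten [seq [seq ((g k + i)%N, f k) | i <- iota 0 k.+1] | k <- iota 0 m].

Lemma rowsS f g m : rows f g m.+1 = rows f g m ++ [seq ((g m + i)%N, f m) | i <- iota 0 m.+1].
Proof. by rewrite /rows -{1}(addn1 m) iotaD map_cat flatten_cat /= cats0. Qed.

Lemma mem_rows f g m a : (a \in rows f g m) =
  has (fun k => (a.2 == f k) && (g k <= a.1 <= g k + k)%N) (iota 0 m).
Proof.
rewrite /rows; apply/flatten_mapP/hasP => -[k km].
  case/mapP => i; rewrite mem_iota => h ->; exists k => //=; rewrite eqxx; lia.
case/andP => /eqP e1 e2.
exists k => //; apply/mapP; exists (a.1 - g k)%N; first by rewrite mem_iota; lia.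
by case: a e1 e2 => x y /= -> h; congr (_, _); lia.
Qed.

(* Bezout: a curve of degree less than [m] through the points of [rows f g m]
   contains the line through [m] of them; split it off. *)
Lemma interpolates_rows (F : numFieldType) m f g :
  {in gtn m &, injective f} -> interpolates F m 1 (rows f g m).
Proof.
move=> fi; split.
- elim: m fi => // m IH fi; rewrite rowsS cat_uniq; apply/and3P; split.
  + by apply: IH => i j hi hj; apply: fi; rewrite inE /= ltnW.
  + apply/hasPn => _ /mapP[i _ ->]; rewrite mem_rows; apply/hasPn => k.
    rewrite mem_iota add0n => /= km; apply/negP => /andP[/eqP /fi].
    by rewrite !inE => /(_ (ltnSn _) (ltnW km)); lia.
  + by rewrite map_inj_uniq ?iota_uniq // => i j [/addnI].
- rewrite mul1n; elim: m {fi} => // m IH; rewrite rowsS size_cat IH size_map size_iota.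
  rewrite !size_tri; have -> : (m.+1 * m.+2 = m.+1.*2 + m * m.+1)%N by lia.
  by rewrite halfD odd_double doubleK /= add0n addnC.
(* At (1, 1) the conditions say that [c] is orthogonal to the values at the exponents of all
   polynomials of degree below m: the exponents become the interpolation nodes. *)
exists [:: (1 : F, 1 : F)]; split=> // [q|c]; first by rewrite inE => /eqP ->; rewrite oner_eq0.
move=> /(_ _ (mem_head _ _)); rewrite /vanishes /= => h.
have {h} : forall i j : nat, (i + j < m)%N ->
    \sum_(a <- rows f g m) c a * (a.1%:R ^+ i * a.2%:R ^+ j) = 0.
  by move=> i j /h e; rewrite -[RHS]e; apply: eq_bigr => a _; rewrite !expr1n !mulr1.
elim: m fi c => // m IH fi c h.
have hrow a : a \in [seq ((g m + i)%N, f m) | i <- iota 0 m.+1] -> a.2 = f m.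
  by case/mapP => ? _ ->.
have c0 a : a \in rows f g m -> c a = 0.
  move=> ain; have ne : (a.2%:R - (f m)%:R : F) != 0.
    move: ain; rewrite mem_rows => /hasP[k]; rewrite mem_iota => km /andP[/eqP -> _].
    rewrite subr_eq0 eqr_nat; apply/eqP => /fi; rewrite !inE /= => /(_ _ _) e.
    by have := e (ltnW km) (ltnSn _); lia.
  apply: (mulIf ne); rewrite mul0r.
  (* Multiplying by the equation of the longest line costs one degree and removes its m + 1
     points. *)
  apply: (IH _ (fun a => c a * (a.2%:R - (f m)%:R))) ain => [k l hk hl|i j ij].
    by apply: fi; rewrite inE /= ltnW.
  have e1 := h i j.+1; have e2 := h i j.
  rewrite addnS ltnS in e1; move: (e1 ij) (e2 (ltnW ij)) => {}e1 {}e2.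
  transitivity (\sum_(a <- rows f g m.+1)
      c a * (a.2%:R - (f m)%:R) * (a.1%:R ^+ i * a.2%:R ^+ j)).
    rewrite rowsS big_cat /= [X in _ = _ + X]big1_seq ?addr0 // => b /andP[_ bm].
    by rewrite (hrow _ bm) subrr mulr0 mul0r.
  transitivity (\sum_(a <- rows f g m.+1) c a * (a.1%:R ^+ i * a.2%:R ^+ j.+1) -
      (f m)%:R * \sum_(a <- rows f g m.+1) c a * (a.1%:R ^+ i * a.2%:R ^+ j)).
    by rewrite mulr_sumr -sumrB; apply: eq_bigr => b _; rewrite exprS; ring.
  by rewrite e1 e2 mulr0 subr0.
move=> a; rewrite rowsS mem_cat => /orP[/c0//|].
case/mapP => i0 i0m ->.
(* Only the longest row is left: m + 1 nodes on a line, tested by m + 1 powers of the first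
   coordinate. *)
pose s : seq F := [seq (g m + i)%:R | i <- iota 0 m.+1].
pose d (x : F) := if [pick i : 'I_m.+1 | x == (g m + i)%:R] is Some i then
  c ((g m + i)%N, f m) else 0.
have dE i : (i < m.+1)%N -> d (g m + i)%:R = c ((g m + i)%N, f m).
  rewrite /d => im; case: pickP => [j|/(_ (Ordinal im))]; last by rewrite eqxx.
  by rewrite eqr_nat => /eqP <-.
have im : (i0 < m.+1)%N by move: i0m; rewrite mem_iota.
rewrite -dE //; apply: (@lagrange_vanish F s).
- by rewrite map_inj_uniq ?iota_uniq // => i j /eqP; rewrite eqr_nat eqn_add2l => /eqP.
- move=> i; rewrite size_map size_iota => im'; have e := h i 0%N.
  rewrite addn0 in e; rewrite -[RHS]e // rowsS big_cat.
  rewrite [X in _ = _ X _]big1_seq => [|b /andP[_ /c0 ->]]; last by rewrite mul0r.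
  rewrite [RHS]add0r /s !big_map; apply: eq_big_seq => k; rewrite mem_iota => /= km.
  by rewrite dE // expr0 mulr1.
by apply/mapP; exists i0.
Qed.

(** As conditions on Taylor coefficients: multiplicity t, with the form of degree t divisible by the
    s-th power of the second coordinate. *)
Definition staircase t s : seq (nat * nat) :=
  [seq a <- tri t.+1 | (a.1 + a.2 < t)%N || (a.2 < s)%N].

Lemma mem_staircase t s i j : ((i, j) \in staircase t s) =
  ((i + j < t)%N || (i + j == t)%N && (j < s)%N).
Proof. by rewrite mem_filter mem_tri /=; lia. Qed.

Lemma staircase_uniq t s : uniq (staircase t s).
Proof. by rewrite filter_uniq // tri_uniq. Qed.

Lemma rowsP f g m x y : reflect (exists2 k, (k < m)%N & y = f k /\ (g k <= x <= g k + k)%N)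
  ((x, y) \in rows f g m).
Proof.
rewrite mem_rows; apply: (iffP hasP) => [[k]|[k km [-> h]]].
  by rewrite mem_iota => /= km /andP[/eqP e h]; exists k.
by exists k; rewrite ?mem_iota //= eqxx.
Qed.

Lemma rows_swapP f g m x y :
  reflect (exists2 k, (k < m)%N & x = f k /\ (g k <= y <= g k + k)%N)
  ((x, y) \in [seq (a.2, a.1) | a <- rows f g m]).
Proof.
rewrite -[(x, y)]/((fun a : nat * nat => (a.2, a.1)) (y, x)) mem_map.
  exact: rowsP.
by move=> [? ?] [? ?] [-> ->].
Qed.

(** Halving the sides gives three upright triangles [A], [B], [E] and the inverted [D]; the boundary
    monomials are shared out so that each piece has rows of lengths 1, ..., m. *)
Lemma interpolates_4 (F : numFieldType) m :
  interpolates F m 4 (staircase (2 * m) m).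
Proof.
pose A := rows (fun k => m.-1 - k)%N (fun=> 0%N) m.
pose B := rows (fun k => m.-1 - k)%N (fun=> m.+1) m.
pose D := rows id (fun k => m - k)%N m.
pose E := rows (fun k => m + (m.-1 - k))%N (fun=> 0%N) m.
have mA x y : ((x, y) \in A) = (x + y < m)%N.
  apply/rowsP/idP => [[k km [-> h]]|h]; first by lia.
  by exists (m.-1 - y)%N; lia.
have mB x y : ((x, y) \in B) = (m < x)%N && (x + y <= 2 * m)%N.
  apply/rowsP/idP => [[k km [-> h]]|h]; first by lia.
  by exists (m.-1 - y)%N; lia.
have mD x y : ((x, y) \in D) = [&& x <= m, y < m & m <= x + y]%N.
  apply/rowsP/idP => [[k km [-> h]]|h]; first by lia.
  by exists y; lia.
have mE x y : ((x, y) \in E) = (m <= y)%N && (x + y < 2 * m)%N.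
  apply/rowsP/idP => [[k km [-> h]]|h]; first by lia.
  by exists (m.-1 - (y - m))%N; lia.
have iA : interpolates F m 1 A by apply: interpolates_rows => i j; rewrite !inE; lia.
have iB : interpolates F m 1 B by apply: interpolates_rows => i j; rewrite !inE; lia.
have iD : interpolates F m 1 D by apply: interpolates_rows => i j; rewrite !inE; lia.
have iE : interpolates F m 1 E by apply: interpolates_rows => i j; rewrite !inE; lia.
have iAD : interpolates F m (1 + 1) (A ++ D).
  by apply: (interpolates_cut (w1 := 1) (w2 := 1) (t := m%:Z - 1)) => // -[x y] /=;
     rewrite ?mA ?mD; lia.
have iADE : interpolates F m (1 + 1 + 1) ((A ++ D) ++ E).
  by apply: (interpolates_cut (w1 := 0) (w2 := 1) (t := m%:Z - 1)) => // -[x y] /=;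
     rewrite ?mem_cat ?mA ?mD ?mE; lia.
have iADEB : interpolates F m (1 + 1 + 1 + 1) (((A ++ D) ++ E) ++ B).
  apply: (interpolates_cut (w1 := m.+1) (w2 := 1) (t := (m * m.+1 + m)%N)) => // -[x y] /=;
     rewrite ?mem_cat ?mA ?mD ?mE ?mB; nia.
apply: interpolates_perm iADEB; first exact: staircase_uniq.
by move=> [x y]; rewrite mem_staircase !mem_cat mA mB mD mE; lia.
Qed.

(** Cutting the sides in three gives six upright triangles [U], [V], [R], [B], [A], [T] and three
    inverted ones [E], [G], [D]. They tile the staircase with coordinates exchanged, which lacks the
    corner (3 m, 0); the corner piece [R] therefore misses its column of length 1 and takes (2 m, m)
    instead. *)
Lemma interpolates_9 (F : numFieldType) m :
  interpolates F m 9 (staircase (3 * m) (3 * m)).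
Proof.
pose sw := map (fun a : nat * nat => (a.2, a.1)).
pose R := sw (rows (fun k => if k is 0 then 2 * m else 3 * m - k)%N
  (fun k => if k is 0 then m else 0)%N m).
pose T := rows (fun k => 3 * m - k)%N (fun=> 0)%N m.
pose B := rows (fun k => 2 * m - k)%N (fun=> 0)%N m.
pose D := rows (fun k => m + k.+1)%N (fun k => m - k)%N m.
pose A := rows (fun k => 2 * m - k.+1)%N (fun k => if k.+1 == m then m else m.+1) m.
pose U := rows (fun k => m - k.+1)%N (fun=> 0)%N m.
pose E := rows (fun k => k.+1) (fun k => m - k.+1)%N m.
pose V := rows (fun k => m - k.+1)%N (fun=> m) m.
pose G := rows id (fun k => 2 * m - k)%N m.
have mR x y : ((x, y) \in R) = (0 < m)%N && ((x == 2 * m) && (y == m) ||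
    [&& 2 * m < x, x < 3 * m & x + y <= 3 * m])%N.
  apply/rows_swapP/idP => [[[|k] km [-> h]]|/andP[m0 /orP[/andP[/eqP-> /eqP->]|h]]]; try lia.
    by exists 0%N => //; lia.
  by exists (3 * m - x).-1.+1; lia.
have mT x y : ((x, y) \in T) = (2 * m < y)%N && (x + y <= 3 * m)%N.
  apply/rowsP/idP => [[k km [-> h]]|h]; first by lia.
  by exists (3 * m - y)%N; lia.
have mB x y : ((x, y) \in B) = (m < y)%N && (x + y <= 2 * m)%N.
  apply/rowsP/idP => [[k km [-> h]]|h]; first by lia.
  by exists (2 * m - y)%N; lia.
have mD x y : ((x, y) \in D) = [&& m < y, y <= 2 * m, x <= m & 2 * m < x + y]%N.
  apply/rowsP/idP => [[k km [-> h]]|h]; first by lia.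
  by exists (y - m.+1)%N; lia.
have mA x y : ((x, y) \in A) = (y == m) && (m <= x < 2 * m)%N ||
    [&& m < y, m < x & x + y <= 3 * m]%N.
  apply/rowsP/idP => [[k km [-> ]]|h]; first by case: eqP; lia.
  by exists (2 * m - y.+1)%N; [lia|case: eqP; lia].
have mU x y : ((x, y) \in U) = (x + y < m)%N.
  apply/rowsP/idP => [[k km [-> h]]|h]; first by lia.
  by exists (m - y.+1)%N; lia.
have mE x y : ((x, y) \in E) = [&& x < m, y <= m & m <= x + y]%N.
  apply/rowsP/idP => [[k km [-> h]]|h]; first by lia.
  by exists y.-1; lia.
have mV x y : ((x, y) \in V) = (m <= x)%N && (x + y < 2 * m)%N.
  apply/rowsP/idP => [[k km [-> h]]|h]; first by lia.
  by exists (m - y.+1)%N; lia.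
have mG x y : ((x, y) \in G) = [&& y < m, x <= 2 * m & 2 * m <= x + y]%N.
  apply/rowsP/idP => [[k km [-> h]]|h]; first by lia.
  by exists y; lia.
have iR : interpolates F m 1 R.
  by apply/interpolates_swap/interpolates_rows => -[|i] [|j]; rewrite !inE; lia.
have iT : interpolates F m 1 T by apply: interpolates_rows => i j; rewrite !inE; lia.
have iB : interpolates F m 1 B by apply: interpolates_rows => i j; rewrite !inE; lia.
have iD : interpolates F m 1 D by apply: interpolates_rows => i j; rewrite !inE; lia.
have iA : interpolates F m 1 A by apply: interpolates_rows => i j; rewrite !inE; lia.
have iU : interpolates F m 1 U by apply: interpolates_rows => i j; rewrite !inE; lia.
have iE : interpolates F m 1 E by apply: interpolates_rows => i j; rewrite !inE; lia.
have iV : interpolates F m 1 V by apply: interpolates_rows => i j; rewrite !inE; lia.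
have iG : interpolates F m 1 G by apply: interpolates_rows => i j; rewrite !inE; lia.
have iVG := interpolates_cut (w1 := 1) (w2 := 1) (t := (2 * m)%:Z - 1) iV iG.
have {}iVG : interpolates F m 2 (V ++ G).
  by apply: iVG => -[x y]; rewrite ?mV ?mG /=; lia.
have {}iE : interpolates F m 3 (E ++ (V ++ G)).
  apply: (interpolates_cut (w1 := 1) (w2 := 0) (t := m%:Z - 1)) iE iVG _ _ => -[x y];
    by rewrite ?mem_cat ?mE ?mV ?mG /=; lia.
have {}iU : interpolates F m 4 (U ++ (E ++ (V ++ G))).
  apply: (interpolates_cut (w1 := 1) (w2 := 1) (t := m%:Z - 1)) iU iE _ _ => -[x y];
    by rewrite ?mem_cat ?mU ?mE ?mV ?mG /=; lia.
have {}iD : interpolates F m 2 (B ++ D).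
  apply: (interpolates_cut (w1 := 1) (w2 := 1) (t := (2 * m)%:Z)) iB iD _ _ => -[x y];
    by rewrite ?mB ?mD /=; lia.
(* The cut is the line x = m slightly tilted, so that (m, m) falls to [A] and the points (m, y) with
   y > m to [D]. The two later cuts whose weights depend on m are tilted likewise along y = m and x
   = 2 m, to separate [E] from [A] on that row and to give (2 m, m) to [R]. *)
have {}iA : interpolates F m 3 ((B ++ D) ++ A).
  apply: (interpolates_cut (w1 := 2 * m%:Z) (w2 := -2) (t := 2 * m%:Z * m%:Z - 1 - 2 * m%:Z)) iD iA _ _ => -[x y];
    rewrite ?mem_cat ?mB ?mD ?mA /=; nia.
have {}iU : interpolates F m 7 ((U ++ (E ++ (V ++ G))) ++ ((B ++ D) ++ A)).
  apply: (interpolates_cut (w1 := 1) (w2 := m.+1) (t := (m * m.+1 + m)%N%:Z - 1)) iU iA _ _ => -[x y];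
    rewrite ?mem_cat ?mU ?mE ?mV ?mG ?mB ?mD ?mA /=; nia.
have {}iU : interpolates F m 8 (((U ++ (E ++ (V ++ G))) ++ ((B ++ D) ++ A)) ++ T).
  apply: (interpolates_cut (w1 := 0) (w2 := 1) (t := (2 * m)%:Z)) iU iT _ _ => -[x y];
    by rewrite ?mem_cat ?mU ?mE ?mV ?mG ?mB ?mD ?mA ?mT /=; lia.
have {}iU : interpolates F m 9 ((((U ++ (E ++ (V ++ G))) ++ ((B ++ D) ++ A)) ++ T) ++ R).
  apply: (interpolates_cut (w1 := 2 * m.+1%:Z) (w2 := 2)
    (t := 4 * m%:Z * m.+1%:Z + 2 * m%:Z - 1)) iU iR _ _ => -[x y];
    rewrite ?mem_cat ?mU ?mE ?mV ?mG ?mB ?mD ?mA ?mT ?mR /=; nia.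
apply: interpolates_perm (interpolates_swap iU); first exact: staircase_uniq.
move=> [x y]; rewrite mem_staircase.
rewrite -[X in X \in [seq _ | _ <- _]]/((fun a : nat * nat => (a.2, a.1)) (y, x)).
rewrite mem_map => [|[? ?] [? ?] [-> ->]//].
by rewrite !mem_cat mU mE mV mG mB mD mA mT mR; lia.
Qed.

(** * Generic rank and tangent directions *)

Section Minors.
Variable F : fieldType.

(** A rank bound is certified by one determinant. Compressing by arbitrary matrices, instead of
    selecting rows and columns, makes the certificate immediate from the normal form of [A]. *)
Lemma rank_minor m n (A : 'M[F]_(m, n)) k : (k <= \rank A)%N ->
  exists (P : 'M_(k, m)) (J : 'M_(n, k)), \det (P *m A *m J) != 0.
Proof.
move=> kr; exists (pid_mx k *m invmx (col_ebase A)), (invmx (row_ebase A) *m pid_mx k).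
suff : pid_mx k *m invmx (col_ebase A) *m (col_ebase A *m pid_mx (\rank A) *m row_ebase A)
    *m (invmx (row_ebase A) *m pid_mx k) = 1%:M :> 'M_k.
  by rewrite mulmx_ebase => ->; rewrite det1 oner_eq0.
rewrite !mulmxA mulmxKV ?col_ebase_unit // mulmxK ?row_ebase_unit // -pid_mx_1.
have rm := rank_leq_row A; have rn := rank_leq_col A.
by rewrite !mul_pid_mx; congr pid_mx; lia.
Qed.

Lemma minor_rank m n (A : 'M[F]_(m, n)) k (P : 'M_(k, m)) (J : 'M_(n, k)) :
  \det (P *m A *m J) != 0 -> (k <= \rank A)%N.
Proof.
move=> d; have U : P *m A *m J \in unitmx by rewrite unitmxE unitfE.
by rewrite -{1}(mxrank_unit U) (leq_trans (mxrankM_maxl _ _)) ?mxrankM_maxr.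
Qed.

End Minors.

Section Generic.
Variables (C : fieldType) (A : comNzRingType) (Omega : Type).
Variables (ev : Omega -> {rmorphism A -> C}) (cst : {rmorphism C -> A}).
Hypothesis ev_cst : forall o c, ev o (cst c) = c.
(** Irreducibility: two nonempty basic open sets meet. With [g = 1] it also says that a nonzero
    function is nonzero at some point. *)
Hypothesis irr : forall f g : A, f != 0 -> g != 0 -> exists o, ev o f != 0 /\ ev o g != 0.

Lemma irr_seq (gs : seq A) : (forall g, g \in gs -> g != 0) ->
  exists o, forall g, g \in gs -> ev o g != 0.
Proof.
move=> h; suff: \prod_(g <- gs) g != 0.
  move=> /[dup] h0 /(irr h0)[o [e _]]; exists o => g ggs; apply: contraNneq e.
  by move=> eg; rewrite (big_rem g) //= rmorphM eg mul0r.
elim: gs h => [|g gs IH] h; first by rewrite big_nil oner_neq0.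
have gn0 : g != 0 by rewrite h ?mem_head.
have pn0 : \prod_(i <- gs) i != 0 by apply: IH => i ii; rewrite h // inE ii orbT.
have [o [e1 e2]] := irr gn0 pn0; rewrite big_cons.
by apply: contraNneq e1 => e; rewrite -(mulIr_eq0 _ (mulIf e2)) -rmorphM e rmorph0.
Qed.

(** Semicontinuity: the minor certifying the bound at [o] lifts to an element of [A], which
    certifies it wherever it does not vanish. *)
Lemma rank_open b n r (B : 'M[C]_(b, r)) (Phi : 'M[A]_(n, r)) o k :
  (k <= \rank (B + map_mx (ev o) Phi)%MS)%N ->
  exists g, ev o g != 0 /\
    forall o', ev o' g != 0 -> (k <= \rank (B + map_mx (ev o') Phi)%MS)%N.
Proof.
rewrite addsmxE => /rank_minor[P [J d]].
pose G := map_mx cst P *m col_mx (map_mx cst B) Phi *m map_mx cst J.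
have mapK m p o' (X : 'M[C]_(m, p)) : map_mx (ev o') (map_mx cst X) = X.
  by apply/matrixP => i j; rewrite !mxE ev_cst.
have evG o' : ev o' (\det G) = \det (P *m col_mx B (map_mx (ev o') Phi) *m J).
  by rewrite -det_map_mx !map_mxM map_col_mx !mapK.
exists (\det G); rewrite evG; split=> // o'; rewrite evG => h.
by rewrite addsmxE; exact: minor_rank h.
Qed.

Section Families.
Variables (h r : nat) (sz : nat -> nat) (Phi : forall a, 'M[A]_(sz a, r)).

Definition span_at (a : 'I_h -> nat) (o : 'I_h -> Omega) : 'M[C]_r :=
  (\sum_(i < h) <<map_mx (ev (o i)) (Phi (a i))>>)%MS.

(** Irreducibility is assumed for single points and not for tuples, so the private tuples [oT x] are
    replaced by a common one coordinate by coordinate. *)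
Lemma generic_common (T : eqType) (L : seq T) (cfg : T -> 'I_h -> nat)
    (k : T -> nat) (oT : T -> 'I_h -> Omega) :
  (forall x, x \in L -> (k x <= \rank (span_at (cfg x) (oT x)))%N) ->
  exists o, forall x, x \in L -> (k x <= \rank (span_at (cfg x) o))%N.
Proof.
move=> H; have [o0 _] := irr (oner_neq0 A) (oner_neq0 A).
suff /(_ h (leqnn h))[o ho] : forall j, (j <= h)%N -> exists o, forall x, x \in L ->
    (k x <= \rank (span_at (cfg x) (fun i => if (i < j)%N then o i else oT x i)))%N.
  exists o => x /ho; congr (_ <= \rank _)%N; apply: eq_bigr => i _.
  by rewrite ltn_ord.
elim=> [|j IH] jh; first by exists (fun=> o0); exact: H.
have [o ho] := IH (ltnW jh); pose j0 := Ordinal jh.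
pose hyb x (i : 'I_h) := if (i < j)%N then o i else oT x i.
pose B x := (\sum_(i < h | i != j0) <<map_mx (ev (hyb x i)) (Phi (cfg x i))>>)%MS.
have hB x o' : span_at (cfg x) (fun i => if i == j0 then o' else hyb x i) =
    (B x + <<map_mx (ev o') (Phi (cfg x j0))>>)%MS.
  rewrite /span_at (bigD1 j0) //= eqxx addsmxC; congr (_ + _)%MS.
  by apply: eq_bigr => i /negPf ->.
have /choice[g hg] : forall x, exists g, x \in L -> ev (oT x j0) g != 0 /\
    forall o', ev o' g != 0 ->
    (k x <= \rank (B x + map_mx (ev o') (Phi (cfg x j0)))%MS)%N.
  move=> x; have [xL|] := boolP (x \in L); last by exists 0.
  have [|g hg] := @rank_open _ _ _ (B x) (Phi (cfg x j0)) (oT x j0) (k x);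
    last by exists g.
  have := ho _ xL; congr (_ <= _)%N.
  transitivity (\rank (span_at (cfg x) (fun i => if i == j0 then oT x j0 else hyb x i))).
    congr (\rank _); apply: eq_bigr => i _; rewrite /hyb.
    by case: eqP => [->|//]; rewrite ltnn.
  by rewrite hB (adds_eqmx (eqmx_refl _) (genmxE _)).
have [o' ho'] : exists o', forall y, y \in [seq g x | x <- L] -> ev o' y != 0.
  apply: irr_seq => _ /mapP[x xL ->]; have [+ _] := hg x xL.
  by apply: contraNneq => ->; rewrite rmorph0.
exists (fun i => if i == j0 then o' else o i) => x xL.
have [_ /(_ o')] := hg x xL; rewrite ho' ?map_f // => /(_ isT).
congr (_ <= _)%N.
transitivity (\rank (span_at (cfg x) (fun i => if i == j0 then o' else hyb x i))).
  by rewrite hB (adds_eqmx (eqmx_refl _) (genmxE _)).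
congr (\rank _); apply: eq_bigr => i _; rewrite /hyb ltnS [(i <= j)%N]leq_eqVlt.
by rewrite -[(i == j :> nat)]/(i == j0); case: (i == j0).
Qed.

Lemma generic_max (T : finType) (cfg : T -> 'I_h -> nat) :
  exists o, forall x o', (\rank (span_at (cfg x) o') <= \rank (span_at (cfg x) o))%N.
Proof.
have [o0 _] := irr (oner_neq0 A) (oner_neq0 A).
have /choice[om hom] : forall x, exists o, forall o',
    (\rank (span_at (cfg x) o') <= \rank (span_at (cfg x) o))%N.
  move=> x; pose p n := `[< exists o, \rank (span_at (cfg x) o) = n >].
  have p0 : exists n, p n by eexists; apply/asboolP; exists (fun=> o0).
  have pb n : p n -> (n <= r)%N by move=> /asboolP[o <-]; exact: rank_leq_row.
  case: (ex_maxnP p0 pb) => n /asboolP[o on] nmax; exists o => o'.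
  by rewrite on; apply: nmax; apply/asboolP; exists o'.
have [o ho] := @generic_common T (enum T) cfg (fun x => \rank (span_at (cfg x) (om x))) om
  (fun _ _ => leqnn _).
by exists o => x o'; apply: leq_trans (hom x o') (ho x (mem_enum _ _)).
Qed.

End Families.
End Generic.

Lemma poly_eq0P (F : numFieldType) (p : {poly F}) : (forall x, p.[x] = 0) -> p = 0.
Proof.
move=> h; apply/eqP; apply: contraT => /exists_nonroot[x].
by rewrite h eqxx.
Qed.

(* If one more derivative of a polynomial curve in [w] does not enlarge its span
   (modulo constants) at any point, then this span is stable under
   differentiation. *)
Lemma derivative_span (C : numFieldType) (r b t s : nat) (B : 'M[C]_(b, r))
    (w : nat -> 'rV[{poly C}]_r) (l0 : C) :
  let Y k l := (B + \matrix_(e < k) map_mx (horner_eval l) (w e))%MS in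
  (forall e, (e < t)%N -> map_mx (fun p => p^`()) (w e) = (t - e)%:R *: w e.+1) ->
  (s <= t)%N ->
  (forall l, \rank (Y s.+1 l) <= \rank (Y s l0))%N ->
  forall e, (e <= t)%N -> (map_mx (horner_eval l0) (w e) <= Y s l0)%MS.
Proof.
move=> Y dw st rk.
set rho := \rank (Y s l0) in rk.
pose W : 'M[{poly C}]_(s, r) := \matrix_(e < s) w e.
pose YY := col_mx (map_mx polyC B) W.
have mC m n (X : 'M[C]_(m, n)) l : map_mx (horner_eval l) (map_mx polyC X) = X.
  by apply/matrixP => i j; rewrite !mxE /horner_eval hornerC.
have evZ m n (c : {poly C}) (X : 'M[{poly C}]_(m, n)) l :
    map_mx (horner_eval l) (c *: X) = c.[l] *: map_mx (horner_eval l) X.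
  by apply/matrixP => i j; rewrite !mxE /horner_eval hornerM.
have mW l : map_mx (horner_eval l) W = \matrix_(e < s) map_mx (horner_eval l) (w e).
  by apply/matrixP => i j; rewrite !mxE.
have YE l : (Y s l :=: map_mx (horner_eval l) YY)%MS.
  by rewrite map_col_mx mC mW; exact: addsmxE.
(* The rows of [Z], chosen by a maximal minor at [l0], form a basis of the span wherever the
   determinant [D] is nonzero; by hypothesis the span with one more derivative is then the same. *)
have [P [J dPJ]] := rank_minor (leqnn (\rank (map_mx (horner_eval l0) YY))).
have rhoE : \rank (map_mx (horner_eval l0) YY) = rho by rewrite -YE.
move: P J dPJ; rewrite rhoE => P J dPJ.
pose Z := map_mx polyC P *m YY.
pose Jp := map_mx polyC J.
pose D := \det (Z *m Jp).
have mZ l : map_mx (horner_eval l) Z = P *m map_mx (horner_eval l) YY.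
  by rewrite map_mxM mC.
have DE l : D.[l] = \det (P *m map_mx (horner_eval l) YY *m J).
  by rewrite -[LHS]/(horner_eval l D) -det_map_mx map_mxM mZ mC.
have D0 : D.[l0] != 0 by rewrite DE.
have Dn0 : D != 0 by apply: contraNneq D0 => ->; rewrite horner0.
have Y1 l e : (e <= s)%N -> (map_mx (horner_eval l) (w e) <= Y s.+1 l)%MS.
  rewrite -ltnS => es; apply: submx_trans (addsmxSr _ _).
  have -> : map_mx (horner_eval l) (w e) = row (Ordinal es)
     (\matrix_(e < s.+1) map_mx (horner_eval l) (w e)).
    by apply/matrixP => i j; rewrite !mxE ord1.
  exact: row_sub.
have Z1 l : (map_mx (horner_eval l) Z <= Y s.+1 l)%MS.
  rewrite mZ (submx_trans (submxMl _ _)) // -YE addsmx_sub addsmxSl /=.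
  by apply/row_subP => i; rewrite rowK; apply: Y1; exact: ltnW.
(* Cramer's rule, checked where [D] is nonzero and hence an identity of polynomials. *)
have Kramer e : (e <= s)%N -> D *: w e = (w e *m Jp *m \adj (Z *m Jp)) *m Z.
  move=> es; apply/eqP; rewrite -subr_eq0; apply/eqP; set u := _ - _.
  have u0 l : D.[l] != 0 -> map_mx (horner_eval l) u = 0.
    move=> Dl; rewrite /u map_mxB evZ !map_mxM map_mx_adj map_mxM mC.
    set Zl := map_mx _ Z; set wl := map_mx _ (w e).
    have DZ : D.[l] = \det (Zl *m J) by rewrite DE /Zl mZ.
    have rZ : \rank Zl = rho.
      apply/eqP; rewrite eqn_leq rank_leq_row /=.
      apply: (@minor_rank _ _ _ Zl rho 1%:M J); rewrite mul1mx -DZ //.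
    have /submxP[a ->] : (wl <= Zl)%MS.
      have ZY : (Zl <= Y s.+1 l)%MS by exact: Z1.
      have e1 : \rank (Y s.+1 l) = rho.
        by apply/eqP; rewrite eqn_leq rk -rZ mxrankS.
      have := mxrank_leqif_eq ZY; rewrite /leqif rZ e1 eqxx => -[_ /esym].
      by move/eqmxP => ->; exact: Y1.
    rewrite -map_mxM -/Z -/Zl -(mulmxA a) -(mulmxA a) mul_mx_adj -DZ mul_mx_scalar -scalemxAl subrr //.
  apply/matrixP => i j; rewrite [RHS]mxE; apply: (mulfI Dn0); rewrite mulr0.
  apply: poly_eq0P => l; rewrite hornerM.
  have [->|/u0/matrixP/(_ i j)] := eqVneq D.[l] 0; first by rewrite mul0r.
  by rewrite !mxE /horner_eval => ->; rewrite mulr0.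
have derM m n p (X : 'M[{poly C}]_(m, n)) (V : 'M_(n, p)) :
    map_mx (fun p => p^`()) (X *m V) =
    map_mx (fun p => p^`()) X *m V + X *m map_mx (fun p => p^`()) V.
  apply/matrixP => i j; rewrite !mxE raddf_sum -big_split /=.
  by apply: eq_bigr => k _; rewrite derivM !mxE.
have derZ n (c : {poly C}) (V : 'rV[{poly C}]_n) : map_mx (fun p => p^`()) (c *: V) =
    c^`() *: V + c *: map_mx (fun p => p^`()) V.
  by apply/matrixP => i j; rewrite !mxE derivM.
(* Differentiation raises the index e < s by one, and w (e + 1) is still covered by Cramer's
   rule. *)
have [N hN] : exists N, D *: map_mx (fun p => p^`()) Z = N *m Z.
  pose Q (e : nat) := w e *m Jp *m \adj (Z *m Jp).
  exists (map_mx polyC P *m col_mx 0 (\matrix_(e < s) ((t - e)%:R *: Q e.+1))).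
  rewrite -[in RHS]mulmxA derM (_ : map_mx _ (map_mx polyC P) = 0); last first.
    by apply/matrixP => i j; rewrite !mxE derivC.
  rewrite mul0mx add0r scalemxAr; congr (_ *m _).
  rewrite mul_col_mx mul0mx map_col_mx scale_col_mx; congr col_mx.
    by apply/matrixP => i j; rewrite !mxE derivC mulr0.
  apply/row_matrixP => i; rewrite row_mul rowK -scalemxAl -Kramer //.
  have kt : (i < t)%N by apply: leq_trans (ltn_ord i) st.
  have -> : row i (D *: map_mx (fun p => p^`()) W) = D *: map_mx (fun p => p^`()) (w i).
    by apply/matrixP => k l; rewrite !mxE ord1.
  by rewrite dw // !scalerA mulrC.
have claim e : (e <= t)%N -> exists k a, D ^+ k *: w e = a *m Z.
  elim: e => [|e IH] et; first by exists 1%N; eexists; rewrite expr1 Kramer.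
  have [es|se] := leqP e.+1 s; first by exists 1%N; eexists; rewrite expr1 Kramer.
  have [k [a ha]] := IH (ltnW et).
  have := congr1 (map_mx (fun p => p^`())) ha.
  rewrite derM derZ dw // => h1.
  have nz : ((t - e)%:R : {poly C}) != 0.
    by rewrite -polyC_natr polyC_eq0 pnatr_eq0 -lt0n subn_gt0.
  (* Clearing denominators in the derivative of D^k w e = a Z: k factors are there already, one
     serves the derivative of [Z], and k more serve the term with w e. *)
  exists (k + k).+1.
  exists ((t - e)%:R^-1%:P *: (D ^+ k.+1 *: map_mx (fun p => p^`()) a +
     D ^+ k *: (a *m N) - (D * (D ^+ k)^`()) *: a)).
  have nC : ((t - e)%:R^-1%:P * (t - e)%:R : {poly C}) = 1.
    by rewrite -polyC_natr -polyCM mulVf // pnatr_eq0 -lt0n subn_gt0.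
  set da := map_mx _ a in h1 *; set dZ := map_mx _ Z in h1 hN.
  have h2 : D ^+ k *: ((t - e)%:R *: w e.+1) = da *m Z + a *m dZ - (D ^+ k)^`() *: w e.
    by rewrite -h1 addrAC subrr add0r.
  have h3 : D ^+ k.+1 *: (a *m dZ) = (D ^+ k *: (a *m N)) *m Z.
    by rewrite exprSr -scalerA scalemxAr hN mulmxA scalemxAl.
  have h4 : D ^+ k.+1 *: ((D ^+ k)^`() *: w e) = ((D * (D ^+ k)^`()) *: a) *m Z.
    by rewrite -scalemxAl -ha !scalerA exprS; congr (_ *: _); ring.
  rewrite -scalemxAl mulmxBl mulmxDl -h3 -h4 -[_ *: da *m Z]scalemxAl.
  rewrite -scalerDr -scalerBr -h2 !scalerA; congr (_ *: _).
  rewrite -[LHS]mulr1 -[X in _ * X = _]nC !exprS exprD.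
  by move: (_%:P) (_%:R : {poly C}) => c1 c2; ring.
move=> e /claim[k [a /(congr1 (map_mx (horner_eval l0)))]].
rewrite evZ map_mxM mZ horner_exp => h.
have Dk : D.[l0] ^+ k != 0 by rewrite expf_neq0.
rewrite -[X in (X <= _)%MS]scale1r -(mulVf Dk) -scalerA h scalemx_sub //.
by rewrite mulmxA (submx_trans (submxMl _ _)) // -YE.
Qed.

Section Tangents.
Variables (C : numFieldType) (R : comNzRingType) (U : Type).
Variables (ev : U -> {rmorphism R -> C}) (cst : {rmorphism C -> R}).
Hypothesis ev_cst : forall o c, ev o (cst c) = c.
Hypothesis irr : forall f g : R, f != 0 -> g != 0 -> exists o, ev o f != 0 /\ ev o g != 0.

(** Elements of R[X] are functions of a point of [U] and the slope of a tangent direction at it. *)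
Definition ev_dir (o : U * C) : {rmorphism {poly R} -> C} :=
  (horner_eval o.2 \o map_poly (ev o.1)).

Lemma ev_dirE o p : ev_dir o p = (map_poly (ev o.1) p).[o.2].
Proof. by []. Qed.

Lemma ev_dir_cst o c : ev_dir o ((polyC \o cst) c) = c.
Proof. by rewrite ev_dirE /= map_polyC /= hornerC ev_cst. Qed.

Lemma irr_dir (f g : {poly R}) : f != 0 -> g != 0 ->
  exists o, ev_dir o f != 0 /\ ev_dir o g != 0.
Proof.
rewrite -lead_coef_eq0 -[g != 0]negbK -[g == 0]lead_coef_eq0 negbK.
move=> /irr h /h[q [f0 g0]].
have nz (p : {poly R}) : ev q (lead_coef p) != 0 -> map_poly (ev q) p != 0.
  by apply: contraNneq => e0; rewrite lead_coefE -coef_map e0 coef0.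
have [l] := exists_nonroot (mulf_neq0 (nz _ f0) (nz _ g0)).
by rewrite hornerM mulf_eq0 negb_or => /andP[h1 h2]; exists (q, l).
Qed.

(* [J] collects the derivatives of order [< t] of the sections, and [w e] those of
   order [t] which test whether the leading form vanishes to order [> e] in a
   tangent direction. *)
Variables (n r t h : nat) (J : 'M[R]_(n, r)) (w : nat -> 'rV[{poly R}]_r).
Hypothesis dw : forall e, (e < t)%N ->
  map_mx (fun p => p^`()) (w e) = (t - e)%:R *: w e.+1.

Definition tangent_mx a : 'M[{poly R}]_(n + a, r) :=
  col_mx (map_mx polyC J) (\matrix_(e < a) w e).

Definition tangent_span (a : 'I_h -> nat) (o : 'I_h -> U * C) :=
  span_at ev_dir tangent_mx a o.

Let S a o : 'M[C]_r := <<map_mx (ev_dir o) (tangent_mx a)>>%MS.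

Let SE a o : (S a o :=: map_mx (ev o.1) J +
  \matrix_(e < a) map_mx (horner_eval o.2) (map_mx (map_poly (ev o.1)) (w e)))%MS.
Proof.
apply: eqmx_trans (genmxE _) _.
have -> : map_mx (ev_dir o) (tangent_mx a) = col_mx (map_mx (ev o.1) J)
   (\matrix_(e < a) map_mx (horner_eval o.2) (map_mx (map_poly (ev o.1)) (w e))).
  rewrite map_col_mx; congr col_mx; apply/matrixP => i j; rewrite !mxE //.
  by rewrite ev_dirE map_polyC /= hornerC.
exact: eqmx_sym (addsmxE _ _).
Qed.

Let S_le a b o : (a <= b)%N -> (S a o <= S b o)%MS.
Proof.
move=> ab; rewrite !SE addsmxS // ; apply/row_subP => i; rewrite rowK.
have ib : (i < b)%N by apply: leq_trans ab.
by rewrite (_ : map_mx _ _ = row (Ordinal ib) (\matrix_(e < b)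
  map_mx (horner_eval o.2) (map_mx (map_poly (ev o.1)) (w e)))) ?row_sub // rowK.
Qed.

(** The hypotheses treat multiplicities t and t + 1; the conclusion fills in the intermediate
    conditions. At a tuple that is optimal for all configurations at once, conditions are added one
    by one while the rank grows; if it stops too early, the conditions of multiplicity t + 1 are
    already in the span. *)
Lemma tangent_rank s :
  (s <= t.+1)%N ->
  (exists q : 'I_h -> U, (minn r (h * n) <=
      \rank (\sum_(i < h) <<map_mx (ev (q i)) J>>)%MS)%N) ->
  (exists o, (minn r (h * (n + t.+1)) <= \rank (tangent_span (fun=> t.+1) o))%N) ->
  exists o, (minn r (h * (n + s)) <= \rank (tangent_span (fun=> s) o))%N.
Proof.
move=> st [q hq] [ot hot].
pose T := {ffun 'I_h -> 'I_t.+2}.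
pose cfg (x : T) (i : 'I_h) : nat := x i.
have [o om] := generic_max ev_dir_cst irr_dir tangent_mx cfg.
exists o.
pose V (x : T) := tangent_span (cfg x) o.
have VE x : V x = (\sum_(i < h) S (x i) (o i))%MS by [].
pose Cs a : T := [ffun=> inord a].
have CsE' a o' : (a <= t.+1)%N ->
    tangent_span (fun=> a) o' = tangent_span (cfg (Cs a)) o'.
  by move=> at1; apply: eq_bigr => i _; rewrite /cfg ffunE inordK.
have CsE a : (a <= t.+1)%N -> tangent_span (fun=> a) o = V (Cs a) by exact: CsE'.
have CsM a o' : (a <= t.+1)%N ->
    (\rank (tangent_span (fun=> a) o') <= \rank (tangent_span (fun=> a) o))%N.
  by move=> at1; rewrite !CsE' //; exact: om.
have r0 : (minn r (h * n) <= \rank (V (Cs 0%N)))%N.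
  apply: leq_trans hq _; rewrite -CsE //.
  apply: leq_trans (CsM 0%N (fun i => (q i, 0)) isT); apply: mxrankS.
  apply/sumsmx_subP => i _; apply: submx_trans (sumsmx_sup i _ (submx_refl _)) => //.
  by rewrite genmxE -/(S 0 _) SE addsmxSl.
have rt : (minn r (h * (n + t.+1)) <= \rank (V (Cs t.+1)))%N.
  by apply: leq_trans hot _; rewrite -CsE // CsM.
rewrite CsE //.
pose upd (x : T) (i : 'I_h) (b : 'I_t.+2) : T := [ffun j => if j == i then b else x j].
have V_le (x y : T) : (forall i, x i <= y i)%N -> (V x <= V y)%MS.
  move=> xy; rewrite !VE; apply/sumsmx_subP => i _.
  by apply: submx_trans (sumsmx_sup i _ (submx_refl _)) => //; exact: S_le.
(* Configurations with at most [s] extra conditions at each point, each of which counts fully in the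
   rank. *)
pose ok (x : T) := [forall i, x i <= s]%N &&
  (\rank (V (Cs 0%N)) + \sum_i x i <= \rank (V x))%N.
have ok0 : ok (Cs 0%N).
  apply/andP; split; first by apply/forallP => i; rewrite ffunE inordK.
  by rewrite big1 ?addn0 // => i _; rewrite ffunE inordK.
case: (@arg_maxnP _ (Cs 0%N) ok (fun x => \sum_i x i)%N ok0) => x okx xmax.
have /andP[/forallP xs rkx] := okx.
have [/forallP xall|/forallPn[i xi]] := boolP [forall i, x i == s :> nat].
  have <- : x = Cs s.
    by apply/ffunP => i; apply: val_inj; rewrite ffunE /= inordK //; exact/eqP.
  apply: leq_trans rkx.
  rewrite (eq_bigr (fun=> s)) => [|i _]; last exact/eqP.
  by rewrite sum_nat_const card_ord; lia.
have xis : (x i < s)%N by rewrite ltn_neqAle xi xs.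
have xit : (x i < t.+1)%N by apply: leq_trans xis st.
pose y := upd x i (inord (x i).+1).
have yi : y i = (x i).+1 :> nat by rewrite ffunE eqxx inordK.
have ysum : (\sum_j y j = (\sum_j x j).+1)%N.
  rewrite (bigD1 i) //= [in RHS](bigD1 i) //= yi addSn; congr (_ + _).+1.
  by apply: eq_bigr => j ji; rewrite ffunE (negPf ji).
have yle : forall j, (x j <= y j)%N.
  by move=> j; rewrite ffunE; case: eqP => // ->; rewrite inordK.
have rky : (\rank (V y) <= \rank (V x))%N.
  rewrite leqNgt; apply/negP => lt; suff /xmax : ok y by rewrite /= ysum; exact: (elimF idP (ltnn _)).
  apply/andP; split; last by rewrite ysum addnS (leq_ltn_trans rkx).
  by apply/forallP => j; rewrite ffunE; case: eqP => // _; rewrite inordK.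
pose Bi := (\sum_(j < h | j != i) S (x j) (o j))%MS.
have VyE l : (tangent_span (cfg y) (fun j => if j == i then ((o i).1, l) else o j)
     :=: (Bi + map_mx (ev (o i).1) J) + \matrix_(e < (x i).+1) map_mx (horner_eval l)
       (map_mx (map_poly (ev (o i).1)) (w e)))%MS.
  have -> : tangent_span (cfg y) (fun j => if j == i then ((o i).1, l) else o j) =
      (S (cfg y i) ((o i).1, l) + Bi)%MS.
    rewrite /tangent_span /span_at (bigD1 i) //= eqxx; congr (_ + _)%MS.
    by apply: eq_bigr => j ji; rewrite /S /cfg ffunE (negPf ji).
  rewrite /cfg yi -(addsmxA Bi) addsmxC; apply: adds_eqmx => //; exact: SE.
have VxE : (V x :=: (Bi + map_mx (ev (o i).1) J) + \matrix_(e < x i)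
    map_mx (horner_eval (o i).2) (map_mx (map_poly (ev (o i).1)) (w e)))%MS.
  have -> : V x = (S (x i) (o i) + Bi)%MS by rewrite VE (bigD1 i).
  by rewrite -(addsmxA Bi) addsmxC; apply: adds_eqmx => //; exact: SE.
have wV e : (e <= t)%N -> (map_mx (ev_dir (o i)) (w e) <= V x)%MS.
  move=> et; have := @derivative_span C r _ t (x i) (Bi + map_mx (ev (o i).1) J)%MS
    (fun e => map_mx (map_poly (ev (o i).1)) (w e)) (o i).2.
  have -> : map_mx (ev_dir (o i)) (w e) = map_mx (horner_eval (o i).2)
     (map_mx (map_poly (ev (o i).1)) (w e)).
    by apply/matrixP => k l; rewrite !mxE.
  rewrite -[X in _ -> (_ <= X)%MS]/(V x) VxE; apply=> //.
  - move=> e' /dw /(congr1 (map_mx (map_poly (ev (o i).1)))) de.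
    apply/matrixP => k l; move/matrixP: de => /(_ k l); rewrite !mxE => de.
    by rewrite deriv_map de rmorphM rmorph_nat.
  (* Another slope at the point [i] cannot help either, because [o] is optimal for the configuration
     [y]. *)
  - move=> l; rewrite -VyE -VxE; apply: leq_trans (om y _) rky.
have StV j : (S t.+1 (o j) <= V (Cs s))%MS.
  have VxCs : (V x <= V (Cs s))%MS.
    by apply: V_le => k; rewrite ffunE inordK.
  pose z k := upd (Cs s) k (inord t.+1).
  have Si : (S t.+1 (o i) <= V (Cs s))%MS.
    apply: submx_trans VxCs; rewrite SE addsmx_sub; apply/andP; split.
      rewrite VxE; apply: submx_trans (addsmxSl _ _); exact: addsmxSr.
    apply/row_subP => k; rewrite rowK; have := wV k (ltnSE (ltn_ord k)).
    by congr (_ <= _)%MS; apply/matrixP => ? ?; rewrite !mxE.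
  have zV k : V (z k) = (S t.+1 (o k) + \sum_(j < h | j != k) S s (o j))%MS.
    rewrite VE (bigD1 k) //= ffunE eqxx inordK //; congr (_ + _)%MS.
    by apply: eq_bigr => l lk; rewrite !ffunE (negPf lk) inordK.
  have CsV k : V (Cs s) = (S s (o k) + \sum_(j < h | j != k) S s (o j))%MS.
    by rewrite VE (bigD1 k) //= ffunE inordK //; congr (_ + _)%MS;
       apply: eq_bigr => l lk; rewrite ffunE inordK.
  have rzi : (\rank (V (z i)) <= \rank (V (Cs s)))%N.
    apply: mxrankS; rewrite zV addsmx_sub Si /= (CsV i); exact: addsmxSr.
  (* Symmetry: exchanging two points of [o] gives another tuple, so the optimal rank of [z k] does
     not depend on [k]. *)
  have rzj : (\rank (V (z j)) <= \rank (V (z i)))%N.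
    pose o' k := o (tperm i j k).
    have := om (z i) o'; congr (_ <= _)%N; congr (\rank _).
    rewrite /V /tangent_span /span_at (reindex_inj (@perm_inj _ (tperm i j))) /=.
    apply: eq_bigr => k _; rewrite /o' tpermK /cfg !ffunE.
    have -> // : (tperm i j k == i) = (k == j).
    by rewrite -(inj_eq (@perm_inj _ (tperm i j))) tpermK tpermL.
  have le : (V (Cs s) <= V (z j))%MS.
    by apply: V_le => k; rewrite !ffunE; case: eqP => // _; rewrite !inordK.
  have := mxrank_leqif_eq le; rewrite /leqif => -[_ /esym].
  rewrite eqn_leq mxrankS //= (leq_trans rzj rzi) => /eqmxP ->.
  by rewrite zV addsmxSl.
have leV : (V (Cs t.+1) <= V (Cs s))%MS.
  rewrite [V (Cs t.+1)]VE; apply/sumsmx_subP => j _.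
  by rewrite ffunE inordK //; exact: StV.
apply: leq_trans (mxrankS leV); apply: leq_trans rt.
rewrite leq_min geq_minl /=; apply: leq_trans (geq_minr _ _) _.
by rewrite leq_mul2l leq_add2l st orbT.
Qed.

End Tangents.

(** * Collision of points *)

(** The ring C[e] / e^(N+1), known to the sequel only through its projection, which is surjective
    with the given kernel. *)
Lemma truncation (C : fieldType) N : exists (T : comNzRingType)
    (pr : {rmorphism {poly C} -> T}),
  (forall x, exists p, x = pr p) /\
  forall p, pr p = 0 <-> forall e, (e <= N)%N -> p`_e = 0.
Proof.
exists ({poly %/ ('X^(N.+1) : {poly C})} : comNzRingType), (in_qpoly ('X^(N.+1))).
split=> [x|p].
  have H := @size_npoly _ _ x; exists (val x); apply: val_inj => /=.
  move: (x : {poly C}) H => q; rewrite mk_monic_Xn size_polyXn => qs.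
  by rewrite Pdiv.CommonRing.rmodp_small // size_polyXn ltnS.
have E : (in_qpoly ('X^(N.+1) : {poly C}) p = 0) <-> Pdiv.CommonRing.rmodp p ('X^(N.+1)) = 0.
  split=> [/(congr1 val)|h]; last apply: val_inj; by rewrite /= mk_monic_Xn.
split=> [/E e k kN|h].
  have := Pdiv.RingMonic.rdivp_eq (monicXn C N.+1) p; rewrite e addr0 => ->.
  by rewrite coefMXn ltnS kN.
apply/E/eqP; change (is_true (Pdiv.CommonRing.rdvdp ('X^(N.+1) : {poly C}) p)).
apply/(Pdiv.RingMonic.rdvdpP (monicXn C N.+1)).
exists (drop_poly N.+1 p); rewrite -{1}(poly_take_drop N.+1 p).
suff -> : take_poly N.+1 p = 0 by rewrite add0r.
by apply/polyP => k; rewrite coef_take_poly coef0; case: ltnP => // /h.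
Qed.

Section ExpDerivation.
Variables (C : numFieldType) (R B : comNzRingType) (g : {rmorphism R -> B}).
Variables (cB : {rmorphism C -> B}) (D : R -> R) (eta : B) (N : nat).
Hypothesis DD : forall a b, D (a + b) = D a + D b.
Hypothesis DM : forall a b, D (a * b) = a * D b + b * D a.
Hypothesis eta0 : eta ^+ N.+1 = 0.

Let iterB n a b : iter n D (a - b) = iter n D a - iter n D b.
Proof.
have DB u v : D (u - v) = D u - D v.
  by apply: (addIr (D v)); rewrite -DD !subrK.
by elim: n => //= n ->.
Qed.

Let D1 : D 1 = 0.
Proof.
have := DM 1 1; rewrite !mul1r -[D 1 in LHS]addr0 => /addrI.
by move=> /esym.
Qed.

(** Divided powers D^n / n! followed by [g]; the division frees the Leibniz rule [dpM] of binomial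
    coefficients. *)
Let dp n a : B := cB (n`!%:R^-1) * g (iter n D a).

Let dpM n a b : dp n (a * b) = \sum_(i < n.+1) dp i a * dp (n - i) b.
Proof.
elim: n a b => [|n IH] a b.
  by rewrite big_ord1 /dp /= fact0 invr1 rmorph1 !mul1r rmorphM.
have step k x : cB (k.+1%:R) * dp k.+1 x = dp k (D x).
  rewrite /dp iterSr mulrA -rmorphM factS natrM invfM mulrA divff ?mul1r //.
  by rewrite pnatr_eq0.
have stepU k x y : cB (k.+1%:R) * x = cB (k.+1%:R) * y -> x = y.
  move=> /(congr1 ( *%R (cB (k.+1%:R^-1)))); rewrite !mulrA -!rmorphM mulVf ?pnatr_eq0 //.
  by rewrite rmorph1 !mul1r.
apply: (stepU n); rewrite step DM [b * _]mulrC mulr_sumr.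
have -> : dp n (a * D b + D a * b) = dp n (a * D b) + dp n (D a * b).
  have iterD m u v : iter m D (u + v) = iter m D u + iter m D v.
    by elim: m => //= m ->.
  by rewrite /dp iterD rmorphD mulrDr.
rewrite !IH; pose F (i : nat) := dp i a * dp (n.+1 - i) b.
have -> : \sum_(i < n.+1) dp i a * dp (n - i) (D b) =
    \sum_(i < n.+2) cB (n.+1 - i)%:R * F i.
  rewrite [RHS]big_ord_recr /= subnn rmorph0 mul0r addr0.
  apply: eq_bigr => i _; have le : (i <= n)%N by rewrite -ltnS.
  by rewrite -step /F subSn //; ring.
have -> : \sum_(i < n.+1) dp i (D a) * dp (n - i) b =
    \sum_(i < n.+2) cB i%:R * F i.
  rewrite [RHS]big_ord_recl /= rmorph0 mul0r add0r.
  by apply: eq_bigr => i _; rewrite -step /F /bump /= add1n subSS; ring.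
rewrite -big_split; apply: eq_bigr => i _ /=.
by rewrite -mulrDl -rmorphD -natrD subnK // -ltnS.
Qed.

Let eta_horner (p : {poly B}) : p.[eta] = \sum_(n < N.+1) p`_n * eta ^+ n.
Proof.
have h m : eta ^+ (N.+1 + m) = 0 by rewrite exprD eta0 mul0r.
rewrite (@horner_coef_wide _ (N.+1 + size p)) ?leq_addl // big_split_ord /=.
by rewrite [X in _ + X]big1 ?addr0 // => i _; rewrite h mulr0.
Qed.

(** The truncated exponential of eta D, multiplicative by the Leibniz rule because eta^(N+1) = 0. As
    [g] is arbitrary, a second exponential can be built on top of a first one. *)
Lemma exp_derivation : exists psi : {rmorphism R -> B},
  forall a, psi a = \sum_(n < N.+1) cB (n`!%:R^-1) * g (iter n D a) * eta ^+ n.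
Proof.
pose psi a := \sum_(n < N.+1) dp n a * eta ^+ n.
have psiE a : psi a = (\poly_(n < N.+1) dp n a).[eta].
  by rewrite eta_horner; apply: eq_bigr => n _; rewrite coef_poly ltn_ord.
have psiB : zmod_morphism psi.
  move=> a b; rewrite /psi -sumrB; apply: eq_bigr => n _.
  by rewrite /dp iterB rmorphB mulrBr mulrBl.
have psi1 : psi 1 = 1.
  rewrite /psi big_ord_recl big1 => [|i _].
    by rewrite /dp /= fact0 invr1 !rmorph1 addr0 !mulr1.
  have iter0 n : iter n D 0 = 0 by elim: n => //= n ->; have := DD 0 0; rewrite addr0;
    rewrite -[X in X = _]addr0 => /addrI.
  by rewrite /dp /= -iterS iterSr D1 iter0 rmorph0 mulr0 mul0r.
have psiM : monoid_morphism psi.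
  split=> // a b; rewrite !psiE -hornerM !eta_horner.
  apply: eq_bigr => n _; rewrite coef_poly ltn_ord coefM dpM; congr (_ * _).
  apply: eq_bigr => i _; rewrite !coef_poly.
  by rewrite !ifT // (leq_ltn_trans _ (ltn_ord n)) // ?leq_subr // -ltnS.
exists (HB.pack_for {rmorphism R -> B} psi (GRing.isZmodMorphism.Build _ _ psi psiB)
  (GRing.isMonoidMorphism.Build _ _ psi psiM)).
by [].
Qed.

End ExpDerivation.

Section Slots.
Variables (C : numFieldType) (R : comNzRingType) (U : Type).
Variables (ev : U -> {rmorphism R -> C}) (cst : {rmorphism C -> R}).
Hypothesis ev_cst : forall o c, ev o (cst c) = c.
Hypothesis irr : forall f g : R, f != 0 -> g != 0 -> exists o, ev o f != 0 /\ ev o g != 0.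
Variables (T : comNzRingType) (pr : {rmorphism {poly C} -> T}) (N : nat).
Hypothesis prP : forall p, pr p = 0 <-> forall e, (e <= N)%N -> p`_e = 0.
Variables (k n r : nat) (M : 'M[R]_(n, r)).

(** [X] lifts to polynomials the value of [M] at a formal arc, that is, at a T-valued point [psi] of
    [R]. *)
Definition formal_value (X : 'M[{poly C}]_(n, r)) :=
  exists2 psi : {rmorphism R -> T},
    forall c, psi (cst c) = pr c%:P & map_mx pr X = map_mx psi M.

Definition const_value (Q : U) : 'M[{poly C}]_(n, r) := map_mx polyC (map_mx (ev Q) M).

(* The determinant is an element [G] of [R[X]] evaluated by a ring morphism;
   coefficients of [G] vanishing at all points of [U] are zero. *)
Lemma specialize_value (A : 'M[{poly C}]_(k, r)) (S : 'M[{poly C}]_(k, n)) J X :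
  formal_value X -> pr (\det ((A + S *m X) *m J)) != 0 ->
  exists Q, pr (\det ((A + S *m const_value Q) *m J)) != 0.
Proof.
case=> psi psiC XM h.
pose c m m' (Y : 'M[{poly C}]_(m, m')) : 'M[{poly R}]_(m, m') := map_mx (map_poly cst) Y.
pose G := \det ((c _ _ A + c _ _ S *m map_mx polyC M) *m c _ _ J).
pose Psi : {rmorphism {poly R} -> T} := (horner_eval (pr 'X) \o map_poly psi).
have PsicE p : Psi (map_poly cst p) = pr p.
  elim/poly_ind: p => [|p a IH]; first by rewrite !rmorph0.
  rewrite !rmorphD !rmorphM IH /= map_polyX map_polyC /= /horner_eval map_polyX.
  by rewrite map_polyC /= hornerX hornerC psiC.
have Psic m m' (Y : 'M[{poly C}]_(m, m')) : map_mx Psi (c _ _ Y) = map_mx pr Y.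
  by apply/matrixP => i j; rewrite !mxE PsicE.
have PsiM : map_mx Psi (map_mx polyC M) = map_mx pr X.
  by rewrite XM; apply/matrixP => i j; rewrite !mxE /Psi /= map_polyC /horner_eval hornerC.
have GPsi : Psi G = pr (\det ((A + S *m X) *m J)).
  by rewrite /G -!det_map_mx !map_mxM !map_mxD !map_mxM !Psic PsiM.
have [e eN Ge] : exists2 e, (e <= N)%N & G`_e != 0.
  apply/not_exists2P => H; case/negP: h; rewrite -GPsi; apply/eqP.
  have X0 : pr 'X ^+ N.+1 = 0.
    by rewrite -rmorphXn; apply/prP => e eN; rewrite coefXn; case: eqP => // ee; lia.
  rewrite /Psi /= /horner_eval (@horner_coef_wide _ (size G)) ?size_poly //.
  rewrite big1 // => i _; rewrite coef_map /=; have [iN|Ni] := leqP i N.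
    by case: (H i) => [/negP//|/negP]; rewrite negbK => /eqP ->; rewrite rmorph0 mul0r.
  by rewrite -(subnKC Ni) exprD X0 mul0r mulr0.
have [Q [Qe _]] := irr Ge (oner_neq0 _); exists Q.
have evc p : map_poly (ev Q) (map_poly cst p) = p.
  by rewrite -map_poly_comp (eq_map_poly (ev_cst Q)) map_poly_id.
have evG : map_poly (ev Q) G = \det ((A + S *m const_value Q) *m J).
  have evcm m m' (Y : 'M[{poly C}]_(m, m')) : map_mx (map_poly (ev Q)) (c _ _ Y) = Y.
    by apply/matrixP => i j; rewrite !mxE evc.
  rewrite /G -!det_map_mx !map_mxM !map_mxD !map_mxM !evcm; congr (\det ((_ + _ *m _) *m _)).
  by apply/matrixP => i j; rewrite !mxE /= map_polyC.
by rewrite -evG; apply/eqP => /prP/(_ e eN)/eqP; rewrite coef_map (negPf Qe).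
Qed.

Lemma specialize_values (L : seq ('M[{poly C}]_(k, n) * 'M[{poly C}]_(n, r))) A J :
  (forall x, x \in L -> formal_value x.2) ->
  pr (\det ((A + \sum_(x <- L) x.1 *m x.2) *m J)) != 0 ->
  exists Qs : seq U, size Qs = size L /\
    pr (\det ((A + \sum_(y <- zip L Qs) y.1.1 *m const_value y.2) *m J)) != 0.
Proof.
elim: L A => [|[S X] L IH] A hL.
  by rewrite big_nil => h; exists [::]; rewrite /= big_nil.
rewrite big_cons addrA addrAC => h.
have [|Q {}h] := specialize_value _ h; first by apply: (hL (S, X)); rewrite mem_head.
rewrite addrAC in h; have [x xL|Qs [sQ {}h]] := IH _ _ h; first by apply: hL; rewrite inE xL orbT.
by exists (Q :: Qs); rewrite /= sQ big_cons addrA.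
Qed.

(** Once actual points replace the arcs, the determinant is a polynomial in e and can be evaluated
    where it does not vanish; the multipliers [x.1] only recombine the conditions at these
    points. *)
Lemma specialize_rank b (B : 'M[C]_(b, r))
    (L : seq ('M[{poly C}]_(k, n) * 'M[{poly C}]_(n, r))) A J :
  (forall x, x \in L -> formal_value x.2) ->
  (forall e, (map_mx (horner_eval e) A <= B)%MS) ->
  pr (\det ((A + \sum_(x <- L) x.1 *m x.2) *m J)) != 0 ->
  exists Qs : seq U, size Qs = size L /\
    (k <= \rank (B + \sum_(Q <- Qs) <<map_mx (ev Q) M>>)%MS)%N.
Proof.
move=> hL hA /(specialize_values hL)[Qs [sQ h]]; exists Qs; split=> //.
set p := \det _ in h.
have [e pe] : exists e, p.[e] != 0.
  by apply: exists_nonroot; apply: contraNneq h => ->; rewrite rmorph0.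
pose Y := map_mx (horner_eval e) (A + \sum_(y <- zip L Qs) y.1.1 *m const_value y.2).
have dY : \det (1%:M *m Y *m map_mx (horner_eval e) J) != 0.
  by rewrite mul1mx /Y -map_mxM det_map_mx.
apply: leq_trans (minor_rank dY) _; apply: mxrankS.
rewrite /Y map_mxD addmx_sub_adds ?hA //.
have : size L = size Qs by rewrite sQ.
elim: L Qs {hL h p pe Y dY sQ} => [|x L IH] [|Q Qs] //= => [_|[/IH hs]].
  by rewrite big_nil raddf0 sub0mx.
rewrite !big_cons map_mxD addmx_sub_adds // map_mxM genmxE.
have -> : map_mx (horner_eval e) (const_value Q) = map_mx (ev Q) M.
  by apply/matrixP => i j; rewrite !mxE /horner_eval hornerC.
exact: submxMl.
Qed.

End Slots.

(** * Jets, and tangent directions of indeterminate slope *)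

Section Jets.
Variables (C : numFieldType) (R : comNzRingType) (U : Type).
Variables (ev : U -> {rmorphism R -> C}) (cst : {rmorphism C -> R}).
Hypothesis ev_cst : forall o c, ev o (cst c) = c.

Definition is_der (D : R -> R) := [/\ forall a b, D (a + b) = D a + D b,
  forall a b, D (a * b) = a * D b + b * D a & forall c, D (cst c) = 0].

Definition commuting (D1 D2 : R -> R) := forall a, D1 (D2 a) = D2 (D1 a).

Definition dir (D1 D2 : R -> R) (l : C) a := D1 a + cst l * D2 a.

Definition mon (D1 D2 : R -> R) (a : nat * nat) g := iter a.1 D1 (iter a.2 D2 g).

Lemma der_cstM D c a : is_der D -> D (cst c * a) = cst c * D a.
Proof. by case=> _ DM Dc; rewrite DM Dc mulr0 addr0. Qed.

Lemma der0 D : is_der D -> D 0 = 0.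
Proof. by case=> _ _ /(_ 0); rewrite rmorph0. Qed.

Lemma dir_der D1 D2 l : is_der D1 -> is_der D2 -> is_der (dir D1 D2 l).
Proof.
move=> [A1 M1 c1] [A2 M2 c2]; split=> [a b|a b|c]; rewrite /dir.
- by rewrite A1 A2; ring.
- by rewrite M1 M2; ring.
- by rewrite c1 c2 mulr0 addr0.
Qed.

Lemma dir_comm D1 D2 l : is_der D2 -> commuting D1 D2 -> commuting (dir D1 D2 l) D2.
Proof.
move=> d2 c12 a; rewrite /dir; case: (d2) => A2 _ _.
by rewrite A2 c12 (der_cstM _ _ d2).
Qed.

Lemma dirK D1 D2 l : dir (dir D1 D2 l) D2 (- l) =1 D1.
Proof. by move=> a; rewrite /dir rmorphN; ring. Qed.

Lemma comm_iter D1 D2 : commuting D1 D2 -> forall n a, iter n D1 (D2 a) = D2 (iter n D1 a).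
Proof. by move=> c n a; elim: n => //= n ->. Qed.

Lemma iter_add D n a b : is_der D -> iter n D (a + b) = iter n D a + iter n D b.
Proof. by case=> A _ _; elim: n => //= n ->. Qed.

Lemma iter_cstM D n c a : is_der D -> iter n D (cst c * a) = cst c * iter n D a.
Proof. by move=> d; elim: n => //= n ->; rewrite (der_cstM _ _ d). Qed.

Lemma mon_mon D1 D2 a b g : commuting D1 D2 ->
  mon D1 D2 a (mon D1 D2 b g) = mon D1 D2 (a.1 + b.1, a.2 + b.2)%N g.
Proof.
move=> c; rewrite /mon /= !iterD; congr (iter _ _ _).
by elim: (a.2) => //= k ->; rewrite (comm_iter c).
Qed.

Variables (r : nat) (f : 'I_r -> R).

Definition jet_mx D1 D2 (s : seq (nat * nat)) : 'M[R]_(size s, r) :=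
  \matrix_(i, j) mon D1 D2 (nth (0, 0)%N s i) (f j).

Lemma jet_row D1 D2 s a Q : a \in s ->
  (\row_j ev Q (mon D1 D2 a (f j)) <= map_mx (ev Q) (jet_mx D1 D2 s))%MS.
Proof.
rewrite -index_mem => ai.
rewrite (_ : \row_j _ = row (Ordinal ai) (map_mx (ev Q) (jet_mx D1 D2 s))) ?row_sub //.
by apply/rowP => j; rewrite !mxE nth_index // -index_mem.
Qed.

Lemma jet_dir D1 D2 l m Q : is_der D1 -> is_der D2 -> commuting D1 D2 ->
  (map_mx (ev Q) (jet_mx (dir D1 D2 l) D2 (tri m)) <=
   map_mx (ev Q) (jet_mx D1 D2 (tri m)))%MS.
Proof.
move=> d1 d2 c12; have dd := dir_der l d1 d2.
have key i a b : (i + (a + b) < m)%N ->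
    (\row_j ev Q (iter i (dir D1 D2 l) (mon D1 D2 (a, b) (f j))) <=
     map_mx (ev Q) (jet_mx D1 D2 (tri m)))%MS.
  elim: i a b => [|i IH] a b h; first by apply: (@jet_row _ _ _ (a, b)); rewrite mem_tri.
  have -> : \row_j ev Q (iter i.+1 (dir D1 D2 l) (mon D1 D2 (a, b) (f j))) =
     \row_j ev Q (iter i (dir D1 D2 l) (mon D1 D2 (a.+1, b) (f j))) +
     l *: \row_j ev Q (iter i (dir D1 D2 l) (mon D1 D2 (a, b.+1) (f j))).
    apply/rowP => j; rewrite !mxE iterSr {2}/dir iter_add // iter_cstM //.
    by rewrite rmorphD rmorphM ev_cst -[D2 (mon _ _ _ _)](comm_iter c12).
  by rewrite addmx_sub ?scalemx_sub // IH //; lia.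
apply/row_subP => i; set a := nth (0, 0)%N (tri m) i.
have : a \in tri m by rewrite mem_nth.
case aE: a => [a1 a2]; rewrite mem_tri => am.
have := key a1 0%N a2; rewrite add0n => /(_ am); congr (_ <= _)%MS.
by apply/rowP => j; rewrite !mxE -/a aE.
Qed.

Section Tangent.
Variables (D1 D2 : R -> R).
Hypotheses (d1 : is_der D1) (d2 : is_der D2) (c12 : commuting D1 D2).

Definition dirX (p : {poly R}) := map_poly D1 p + 'X * map_poly D2 p.

(** [dirX] is D1 + X D2 with indeterminate slope X. As D2 commutes with it, differentiating a power
    of it in X trades one factor for D2, which is the recursion required by [derivative_span]. *)
Definition tangent_w t e : 'rV[{poly R}]_r :=
  \row_j iter (t - e) dirX (iter e D2 (f j))%:P.

Let coef_der D p i : is_der D -> (map_poly D p)`_i = D p`_i.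
Proof. by move=> d; rewrite coef_map_id0 // der0. Qed.

Let horner_der D l p : is_der D -> (map_poly D p).[cst l] = D p.[cst l].
Proof.
move=> d; elim/poly_ind: p => [|p a IH].
  rewrite (_ : map_poly D 0 = 0) ?horner0 ?der0 //.
  by apply/polyP => i; rewrite coef_der // coef0 der0.
have -> : map_poly D (p * 'X + a%:P) = map_poly D p * 'X + (D a)%:P.
  apply/polyP => i; rewrite coef_der // !coefD !coefMX !coefC.
  case: i => [|i] /=; first by rewrite !add0r.
  by rewrite coef_der // !addr0.
rewrite !hornerMXaddC IH; case: (d) => A M c.
by rewrite A M c mulr0 add0r [_ * cst l]mulrC.
Qed.

Let mapDD D p q : is_der D -> map_poly D (p + q) = map_poly D p + map_poly D q.
Proof. by move=> d; apply/polyP => i; case: (d) => A _ _; rewrite !(coef_der, coefD) // A. Qed.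

Let mapDX D p : is_der D -> map_poly D ('X * p) = 'X * map_poly D p.
Proof.
move=> d; apply/polyP => i; rewrite coef_der // !coefXM; case: eqP => _; first exact: der0.
by rewrite coef_der.
Qed.

Let dirXD p q : dirX (p + q) = dirX p + dirX q.
Proof. by rewrite /dirX !mapDD // mulrDr addrACA. Qed.

Let dirX_comm p : map_poly D2 (dirX p) = dirX (map_poly D2 p).
Proof.
rewrite /dirX mapDD // mapDX //; congr (_ + _).
by apply/polyP => i; rewrite !coef_der // c12.
Qed.

Let deriv_map_der D p : is_der D -> (map_poly D p)^`() = map_poly D p^`().
Proof.
move=> d; apply/polyP => i; rewrite coef_deriv !coef_der // coef_deriv.
case: (d) => A _ _; move: (nth 0 p i.+1) => c; move: (i.+1) => k.
by elim: k => [|n IH]; rewrite ?mulr0n ?der0 // !mulrSr IH A.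
Qed.

Let deriv_dirX p : (dirX p)^`() = dirX p^`() + map_poly D2 p.
Proof. by rewrite /dirX derivD derivM derivX !deriv_map_der // mul1r addrCA addrC -addrA. Qed.

Let deriv_iter n g :
  (iter n.+1 dirX g%:P)^`() = (iter n dirX (D2 g)%:P) *+ n.+1.
Proof.
have D2C : map_poly D2 g%:P = (D2 g)%:P.
  by apply/polyP => i; rewrite coef_der // !coefC; case: eqP => // _; rewrite der0.
elim: n => [|n IH].
  rewrite /= deriv_dirX derivC D2C mulr1n /dirX.
  have m0 D : is_der D -> map_poly D 0 = 0.
    by move=> d; apply/polyP => i; rewrite coef_der // coef0 der0.
  by rewrite !m0 // mulr0 !add0r.
rewrite iterS deriv_dirX IH.
have -> : map_poly D2 (iter n.+1 dirX g%:P) = iter n.+1 dirX (D2 g)%:P.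
  by elim: (n.+1) => [|k IHk] /=; rewrite ?D2C // dirX_comm IHk.
rewrite [RHS]mulrSr; congr (_ + _); rewrite iterS; move: (iter n dirX _) => z.
elim: (n.+1) => [|k IHk]; last by rewrite !mulrSr dirXD IHk.
by rewrite !mulr0n; apply: (addIr (dirX 0)); rewrite -dirXD !add0r.
Qed.

Lemma tangent_w_deriv t e : (e < t)%N ->
  map_mx (fun p => p^`()) (tangent_w t e) = (t - e)%:R *: tangent_w t e.+1.
Proof.
move=> et; apply/matrixP => i j; rewrite !mxE.
have -> : (t - e = (t - e.+1).+1)%N by lia.
by rewrite deriv_iter mulr_natl.
Qed.

Lemma ev_tangent_w t e Q l : map_mx (ev_dir ev (Q, l)) (tangent_w t e) =
  \row_j ev Q (mon (dir D1 D2 l) D2 (t - e, e)%N (f j)).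
Proof.
apply/rowP => j; rewrite !mxE ev_dirE /=.
rewrite -[X in _.[X] = _](ev_cst Q l) horner_map; congr (ev Q _); rewrite /mon /=.
elim: (t - e)%N => [|n IH] /=; first by rewrite hornerC.
by rewrite -IH /dirX hornerD hornerM hornerX !horner_der.
Qed.

Lemma tangent_span_jet t s Q l : (s <= t.+1)%N ->
  (map_mx (ev_dir ev (Q, l)) (tangent_mx (jet_mx D1 D2 (tri t)) (tangent_w t) s)
   <= map_mx (ev Q) (jet_mx (dir D1 D2 l) D2 (staircase t s)))%MS.
Proof.
move=> st; have dd := dir_der l d1 d2; have dc := dir_comm l d2 c12.
rewrite map_col_mx -addsmxE addsmx_sub; apply/andP; split.
  have -> : map_mx (ev_dir ev (Q, l)) (map_mx polyC (jet_mx D1 D2 (tri t))) =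
    map_mx (ev Q) (jet_mx D1 D2 (tri t)).
    by apply/matrixP => i j; rewrite !mxE ev_dirE map_polyC /= hornerC.
  (* D1 is itself the direction of slope -l relative to the pair (D1 + l D2, D2), so [jet_dir] also
     applies backwards. *)
  have -> : jet_mx D1 D2 (tri t) = jet_mx (dir (dir D1 D2 l) D2 (- l)) D2 (tri t).
    apply/matrixP => i j; rewrite !mxE /mon; apply/esym/eq_iter; exact: dirK.
  apply: submx_trans (jet_dir _ _ _ dd d2 dc) _.
  apply/row_subP => i; set a := nth (0, 0)%N (tri t) i.
  have -> : row i (map_mx (ev Q) (jet_mx (dir D1 D2 l) D2 (tri t))) =
     \row_j ev Q (mon (dir D1 D2 l) D2 a (f j)).
    by apply/rowP => j; rewrite !mxE.
  apply: jet_row; have : a \in tri t by rewrite mem_nth.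
  by case: (a) => x y; rewrite mem_tri mem_staircase => ->.
apply/row_subP => e.
have -> : row e (map_mx (ev_dir ev (Q, l)) (\matrix_(e < s) tangent_w t e)) =
   \row_j ev Q (mon (dir D1 D2 l) D2 (t - e, nat_of_ord e)%N (f j)).
  rewrite -(ev_tangent_w t e); apply/rowP => j; rewrite !mxE.
  by [].
apply: jet_row; rewrite mem_staircase; have := ltn_ord e; lia.
Qed.

End Tangent.
End Jets.

(** This is q^b times the derivative of order b of the monomial x^a at q. *)
Definition fat_coef (C : numFieldType) (q : C * C) (b a : nat * nat) : C :=
  (a.1 ^_ b.1)%:R * (a.2 ^_ b.2)%:R * (q.1 ^+ a.1 * q.2 ^+ a.2).

(* Passage from derivatives to Euler operators: [x * x^_b = x^_(b+1) + b * x^_b]. *)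
Lemma fat_coef_vanishes (C : numFieldType) m (D : seq (nat * nat)) q (c : nat * nat -> C) :
  (forall b, b \in tri m -> \sum_(a <- D) c a * fat_coef q b a = 0) ->
  vanishes m D q c.
Proof.
move=> h; pose T (i j b1 b2 : nat) := \sum_(a <- D)
  c a * (a.1%:R ^+ i * a.2%:R ^+ j * fat_coef q (b1, b2) a).
have ff (n k : nat) : n%:R * (n ^_ k)%:R = (n ^_ k.+1)%:R + k%:R * (n ^_ k)%:R :> C.
  rewrite -!natrM -natrD; congr _%:R; rewrite ffactnSr [(k * _)%N]mulnC -mulnDr mulnC.
  case: (leqP k n) => [kn|nk]; first by rewrite subnK.
  by rewrite ffact_small // !mul0n.
suff T0 i j b1 b2 : (i + j + (b1 + b2) < m)%N -> T i j b1 b2 = 0.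
  move=> i j ij; rewrite -[RHS](T0 i j 0%N 0%N) ?addn0 //; apply: eq_bigr => a _.
  by rewrite /fat_coef /= !ffactn0 !mul1r.
elim: i j b1 b2 => [|i IHi] j b1 b2.
  elim: j b1 b2 => [|j IHj] b1 b2 hm.
    rewrite -[RHS](h (b1, b2)) ?mem_tri //.
    by apply: eq_bigr => a _; rewrite !expr0 !mul1r.
  have -> : T 0%N j.+1 b1 b2 = T 0%N j b1 b2.+1 + b2%:R * T 0%N j b1 b2.
    rewrite /T mulr_sumr -big_split; apply: eq_bigr => a _ /=.
    have := ff a.2 b2; rewrite /fat_coef /= exprS => e.
    transitivity (c a * (a.1%:R ^+ 0 * a.2%:R ^+ j * ((a.1 ^_ b1)%:R *
      (a.2%:R * (a.2 ^_ b2)%:R) * (q.1 ^+ a.1 * q.2 ^+ a.2)))); first by ring.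
    by rewrite e; ring.
  by rewrite !IHj ?mulr0 ?addr0 //; lia.
move=> hm.
have -> : T i.+1 j b1 b2 = T i j b1.+1 b2 + b1%:R * T i j b1 b2.
  rewrite /T mulr_sumr -big_split; apply: eq_bigr => a _ /=.
  have := ff a.1 b1; rewrite /fat_coef /= exprS => e.
  transitivity (c a * (a.1%:R ^+ i * a.2%:R ^+ j * ((a.1%:R * (a.1 ^_ b1)%:R) *
    (a.2 ^_ b2)%:R * (q.1 ^+ a.1 * q.2 ^+ a.2)))); first by ring.
  by rewrite e; ring.
by rewrite !IHi ?mulr0 ?addr0 //; lia.
Qed.

(** The dual form of interpolation used in the collision: for every exponent, a combination [v] of
    the conditions that extracts its coefficient. *)
Lemma interpolates_inverse (C : numFieldType) m n D : interpolates C m n D ->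
  exists (q : 'I_n -> C * C) (v : 'I_(size D) -> 'I_n -> 'I_(size (tri m)) -> C),
  forall i j : 'I_(size D), \sum_l \sum_b v i l b *
    fat_coef (q l) (nth (0, 0)%N (tri m) b) (nth (0, 0)%N D j) = (i == j)%:R.
Proof.
case=> uD sD [qs [sq _ h]].
pose q (l : 'I_n) := nth (0, 0) qs l; exists q.
pose X : finType := ('I_n * 'I_(size (tri m)))%type.
pose y (x : 'I_#|X|) : 'I_n * 'I_(size (tri m)) := enum_val x.
pose A : 'M[C]_(#|X|, size D) := \matrix_(x, j)
  fat_coef (q (y x).1) (nth (0, 0)%N (tri m) (y x).2) (nth (0, 0)%N D j).
have /row_freeP[V VA] : row_free A^T.
  apply: inj_row_free => u /(congr1 trmx); rewrite trmx_mul trmxK trmx0 => hu.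
  pose c a := if insub (index a D) is Some i then u 0 i else 0.
  have cE (j : 'I_(size D)) : c (nth (0, 0)%N D j) = u 0 j.
    rewrite /c index_uniq //; case: insubP => [k _ ek|/negP[]//].
    by congr (u _ _); apply: val_inj.
  apply/rowP => j; rewrite mxE -cE; apply: h (mem_nth _ _) => // p pq.
  apply: fat_coef_vanishes => b bt.
  have pi : (index p qs < n)%N by rewrite -sq index_mem.
  have bi : (index b (tri m) < size (tri m))%N by rewrite index_mem.
  have /matrixP/(_ (enum_rank (Ordinal pi, Ordinal bi)) 0) := hu.
  rewrite !mxE => e; rewrite -[RHS]e (big_nth (0, 0)%N) big_mkord.
  by apply: eq_bigr => k _; rewrite !mxE /y enum_rankK /= /q !nth_index // cE mulrC.
exists (fun i l b => V (enum_rank (l, b)) i) => i j.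
have /matrixP/(_ j i) := VA; rewrite !mxE eq_sym => <-.
rewrite pair_big /= (reindex y) /=; last first.
  by exists (fun z => enum_rank (z : X)) => x _; rewrite /y ?enum_valK ?enum_rankK.
apply: eq_bigr => x _; rewrite !mxE -surjective_pairing /y enum_valK mulrC.
by [].
Qed.

Section Collision.
Variables (C : numFieldType) (R : comNzRingType) (U : Type).
Variables (ev : U -> {rmorphism R -> C}) (cst : {rmorphism C -> R}).
Hypothesis ev_cst : forall o c, ev o (cst c) = c.
Hypothesis irr : forall f g : R, f != 0 -> g != 0 -> exists o, ev o f != 0 /\ ev o g != 0.
Variables (D1 D2 : R -> R).
Hypotheses (d1 : is_der cst D1) (d2 : is_der cst D2) (c12 : commuting D1 D2).

Let sum_shift (V : nmodType) (F : nat -> V) b M :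
  (forall a, (a < b)%N -> F a = 0) -> (forall a, (M < a)%N -> F a = 0) ->
  \sum_(i < M.+1) F (i + b)%N = \sum_(i < M.+1) F i.
Proof.
move=> lo hi; rewrite -[LHS](big_mkord predT (fun i => F (i + b)%N)).
rewrite -[RHS](big_mkord predT F).
transitivity (\sum_(0 <= i < M.+1 + b) F i).
  rewrite [RHS](@big_cat_nat _ _ _ b) ?leq_addl //= [X in _ = X + _]big_nat_cond.
  rewrite [X in _ = X + _]big1 ?add0r => [|i /andP[/andP[_ /lo]]//].
  by rewrite -{2}[b]add0n big_addn addnK.
rewrite (@big_cat_nat _ _ _ M.+1) ?leq_addr //= [X in _ + X]big_nat_cond.
by rewrite [X in _ + X]big1 ?addr0 // => i /andP[/andP[/hi]].
Qed.

Section Arc.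
Variables (T : comNzRingType) (pr : {rmorphism {poly C} -> T}) (N : nat).
Hypothesis prP : forall p, pr p = 0 <-> forall e, (e <= N)%N -> p`_e = 0.
Variables (w1 w2 : nat) (Q : U).
Hypotheses (w1_gt0 : (0 < w1)%N) (w2_gt0 : (0 < w2)%N).

Definition weight (a : nat * nat) := (w1 * a.1 + w2 * a.2)%N.

Definition taylor (a : nat * nat) g : C :=
  ev Q (mon D1 D2 a g) / (a.1`! * a.2`!)%:R.

Let prX n : (N < n)%N -> pr 'X^n = 0.
Proof. by move=> nN; apply/prP => e eN; rewrite coefXn; case: eqP => // ee; lia. Qed.

(** [psi] is evaluation along the arc from [Q] with coordinates (q.1 e^w1, q.2 e^w2). The monomial
    factor on the left turns the Taylor expansion of the derivative of order [b] into a sum over all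
    exponents with coefficients [fat_coef]; exponents above N disappear in the truncation because
    the weights are positive. *)
Lemma formal_arc (q : C * C) : exists psi : {rmorphism R -> T},
  (forall c, psi (cst c) = pr c%:P) /\
  forall b g, pr ((q.1 ^+ b.1 * q.2 ^+ b.2)%:P * 'X^(weight b)) * psi (mon D1 D2 b g) =
    \sum_(i < N.+1) \sum_(j < N.+1)
      pr ((fat_coef q b (nat_of_ord i, nat_of_ord j) *
           taylor (nat_of_ord i, nat_of_ord j) g)%:P *
          'X^(weight (nat_of_ord i, nat_of_ord j))).
Proof.
pose cB : {rmorphism C -> T} := (pr \o polyC).
pose g0 : {rmorphism R -> T} := (cB \o ev Q).
pose e1 := pr ((q.1)%:P * 'X^w1); pose e2 := pr ((q.2)%:P * 'X^w2).
have nil (c : C) w : (0 < w)%N -> pr (c%:P * 'X^w) ^+ N.+1 = 0.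
  move=> w0; rewrite -rmorphXn exprMn -exprM rmorphM prX ?mulr0 //.
  by rewrite -{1}[N.+1]mul1n leq_mul2r w0 orbT.
have [A1 M1 z1] := d1; have [A2 M2 z2] := d2.
have [p1 hp1] := exp_derivation g0 cB A1 M1 (nil q.1 w1 w1_gt0).
have [p2 hp2] := exp_derivation p1 cB A2 M2 (nil q.2 w2 w2_gt0).
exists p2; split.
  have it D c n : is_der cst D -> iter n.+1 D (cst c) = 0.
    by move=> d; elim: n => [|n] /=; [case: d|move=> ->; rewrite (der0 d)].
  move=> c; rewrite hp2 big_ord_recl big1 ?addr0 => [|i _]; last first.
    by rewrite it // rmorph0 mulr0 mul0r.
  rewrite fact0 invr1 rmorph1 mul1r expr0 mulr1 /=.
  rewrite hp1 big_ord_recl big1 ?addr0 => [|i _]; last first.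
    by rewrite it // rmorph0 mulr0 mul0r.
  by rewrite fact0 invr1 rmorph1 mul1r expr0 mulr1 /= ev_cst.
move=> b g.
pose F (a : nat * nat) := pr ((fat_coef q b a * taylor a g)%:P * 'X^(weight a)).
have Flo1 i j : (i < b.1)%N -> F (i, j) = 0.
  by move=> h; rewrite /F /fat_coef /= ffact_small // mulr0n !mul0r rmorph0.
have Flo2 i j : (j < b.2)%N -> F (i, j) = 0.
  move=> h; rewrite /F /fat_coef /= (ffact_small h) mulr0n mulr0 !mul0r.
  by rewrite rmorph0.
have Fhi i j : (N < i)%N || (N < j)%N -> F (i, j) = 0.
  move=> h; rewrite /F rmorphM prX ?mulr0 // /weight /=; nia.
rewrite -[RHS]/(\sum_(i < N.+1) \sum_(j < N.+1) F (nat_of_ord i, nat_of_ord j)).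
transitivity (\sum_(i < N.+1) \sum_(j < N.+1) F (i + b.1, j + b.2)%N); last first.
  rewrite (sum_shift (F := fun i => \sum_(j < N.+1) F (i, j + b.2)%N)).
  - apply: eq_bigr => i _; apply: (sum_shift (F := fun j => F (nat_of_ord i, j))).
    + by move=> a; exact: Flo2.
    + by move=> a h; rewrite Fhi // h orbT.
  - by move=> a h; rewrite big1 // => j _; rewrite Flo1.
  - by move=> a h; rewrite big1 // => j _; rewrite Fhi // h.
rewrite hp2 mulr_sumr exchange_big /=; apply: eq_bigr => j _.
rewrite hp1 mulr_sumr mulr_suml mulr_sumr; apply: eq_bigr => i _.
have -> : iter i D1 (iter j D2 (mon D1 D2 b g)) = mon D1 D2 (i + b.1, j + b.2)%N g.
  by rewrite -(mon_mon (i : nat, j : nat)).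
rewrite /F /fat_coef /taylor /= -!(rmorphXn pr) -!(rmorphM pr) /=.
congr (pr _).
have wE : 'X^(weight (i + b.1, j + b.2)%N) = 'X^(weight b) * 'X^w1 ^+ i * 'X^w2 ^+ j :> {poly C}.
  by rewrite -!exprM -!exprD /weight /=; congr ('X^_); lia.
have fE (k l : nat) : ((k + l) ^_ l)%:R / (k + l)`!%:R = k`!%:R^-1 :> C.
  have := ffact_fact (leq_addl k l); rewrite addnK => <-.
  rewrite natrM invfM mulrA divff ?mul1r // pnatr_eq0 -lt0n ffact_gt0.
  exact: leq_addl.
rewrite wE natrM invfM -(fE i b.1) -(fE j b.2) !exprMn !exprD -!polyC_exp !polyCM; ring.
Qed.

End Arc.
Section Cluster.
Variables (r : nat) (f : 'I_r -> R).
Variables (m n t s : nat).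
Hypothesis interp : interpolates C m n (staircase t s).

(** In degree n the weights run from n (t + 1) to n (t + 2), so for n <= t degree n stays below
    degree n + 1, and within a degree the second exponent decides. [W] bounds the weights on the
    staircase. *)
Let w1 := t.+1.
Let w2 := t.+2.
Let wt := weight w1 w2.
Let W := (t * t.+1 + t)%N.

Let wt_in a : a \in staircase t s -> (wt a <= W)%N.
Proof.
case: a => x y; rewrite mem_staircase /wt /weight /w1 /w2 /W /= => h.
have h2 : (x + y <= t)%N by lia.
nia.
Qed.

Let wt_out a b : a \in staircase t s -> b \notin staircase t s -> (wt a < wt b)%N.
Proof.
case: a b => [x y] [x' y']; rewrite !mem_staircase /wt /weight /w1 /w2 /=.
move=> h1 h2; have [lt|ge] := ltnP (x + y) (x' + y'); first by nia.
have e : (x' + y' = x + y)%N by lia.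
nia.
Qed.

(* In coordinates adapted to [Q], the points [(e^w1 q.1, e^w2 q.2)] tend to [Q] so
   that the conditions of the [m]-fold points tend to the Taylor coefficients with
   exponents in the staircase, an initial segment for the weight [(w1, w2)]. *)
Lemma cluster k b (B : 'M[C]_(b, r)) Q :
  (k <= \rank (B + map_mx (ev Q) (jet_mx f D1 D2 (staircase t s)))%MS)%N ->
  exists Qs : seq U, size Qs = n /\
    (k <= \rank (B + \sum_(P <- Qs) <<map_mx (ev P) (jet_mx f D1 D2 (tri m))>>)%MS)%N.
Proof.
set I := staircase t s => hk.
have [q [v hv]] := interpolates_inverse interp.
pose CI : 'M[C]_(size I, r) := \matrix_(i, j) taylor Q (nth (0, 0)%N I i) (f j).
have hk' : (k <= \rank (col_mx B CI))%N.
  apply: leq_trans hk _; rewrite -addsmxE; apply/mxrankS/addsmxS => //.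
  apply/row_subP => i; set a := nth (0, 0)%N I i.
  have fa : (a.1`! * a.2`!)%:R != 0 :> C by rewrite pnatr_eq0 muln_eq0 negb_or -!lt0n !fact_gt0.
  have -> : row i (map_mx (ev Q) (jet_mx f D1 D2 I)) = (a.1`! * a.2`!)%:R *: row i CI.
    by apply/rowP => j; rewrite !mxE /taylor -/a mulrC divfK.
  by rewrite scalemx_sub // row_sub.
have [P [J dPJ]] := rank_minor hk'.
(* The leading term of the k by k determinant has order W k in e and must survive the truncation;
   the summand t puts the staircase inside the box of exponents up to N. *)
pose N := (W * k + t)%N.
have [T [pr [pr_surj prP]]] := truncation C N.
have w1p : (0 < w1)%N by []. have w2p : (0 < w2)%N by [].
have /choice[psi hpsi] := fun l => formal_arc prP Q w1p w2p (q l).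
have /choice[lift hlift] := pr_surj.
pose M := jet_mx f D1 D2 (tri m).
pose X l : 'M[{poly C}]_(size (tri m), r) := map_mx lift (map_mx (psi l) M).
pose bb (b : 'I_(size (tri m))) := nth (0, 0)%N (tri m) b.
pose aa (i : 'I_(size I)) := nth (0, 0)%N I i.
(* The combinations [v], scaled so that the row of each exponent has leading term e^W times its
   Taylor coefficient. *)
pose V l : 'M[{poly C}]_(size I, size (tri m)) := \matrix_(i, b)
  ((v i l b * ((q l).1 ^+ (bb b).1 * (q l).2 ^+ (bb b).2))%:P *
   'X^(W - wt (aa i) + wt (bb b))).
pose S l := map_mx polyC (rsubmx P) *m V l.
pose L := [seq (S l, X l) | l <- enum 'I_n].
pose A := 'X^W *: map_mx polyC (lsubmx P *m B).
have [x xL|e||Qs [sQs hQs]] :=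
  @specialize_rank C R U ev cst ev_cst irr T pr N prP k _ r M b B L A (map_mx polyC J).
- case/mapP: xL => l _ ->; exists (psi l); first by case: (hpsi l).
  by apply/matrixP => i j; rewrite !mxE -hlift.
- apply: submx_trans (submxMl (lsubmx P) B).
  have -> : map_mx (horner_eval e) A = e ^+ W *: (lsubmx P *m B).
    by apply/matrixP => i j; rewrite !mxE /horner_eval hornerM hornerXn hornerC.
  by rewrite scalemx_sub.
- pose u i a := \sum_l \sum_b v i l b * fat_coef (q l) (bb b) a.
  pose box := [seq (x, y) | x <- iota 0 N.+1, y <- iota 0 N.+1].
  (* The remainder: exponents outside the staircase have strictly larger weight, which leaves a
     factor e once e^W is taken out. *)
  pose Y : 'M[{poly C}]_(size I, r) := \matrix_(i, j)
    \sum_(a <- box | a \notin I) (u i a * taylor Q a (f j))%:P * 'X^(wt a - wt (aa i) - 1).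
  have Ibox : {subset I <= box}.
    move=> [x y]; rewrite mem_staircase => h; apply/allpairsP; exists (x, y).
    by rewrite !mem_iota /=; split=> //; rewrite /N; move: (W * k)%N => z; lia.
  have ubox : uniq box.
    by apply: allpairs_uniq; rewrite ?iota_uniq // => -[? ?] [? ?] _ _ [-> ->].
  have key i j : \sum_l pr ((V l *m X l) i j) =
      pr ('X^W * ((taylor Q (aa i) (f j))%:P + 'X * Y i j)).
    have wi : (wt (aa i) <= W)%N by apply: wt_in; rewrite mem_nth.
    transitivity (\sum_(a <- box) pr ((u i a * taylor Q a (f j))%:P * 'X^(W - wt (aa i) + wt a))).
      transitivity (\sum_l \sum_b pr ((v i l b)%:P * 'X^(W - wt (aa i))) *
          \sum_(a <- box) pr ((fat_coef (q l) (bb b) a * taylor Q a (f j))%:P * 'X^(wt a))).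
        apply: eq_bigr => l _; rewrite mxE rmorph_sum; apply: eq_bigr => c _.
        have [_ /(_ (bb c) (f j))] := hpsi l.
        have -> : \sum_(a <- box) pr ((fat_coef (q l) (bb c) a * taylor Q a (f j))%:P * 'X^(wt a)) =
          \sum_(i0 < N.+1) \sum_(j0 < N.+1) pr ((fat_coef (q l) (bb c) (nat_of_ord i0, nat_of_ord j0) *
           taylor Q (nat_of_ord i0, nat_of_ord j0) (f j))%:P * 'X^(wt (nat_of_ord i0, nat_of_ord j0))).
          rewrite big_allpairs -[iota 0 N.+1]/(index_iota 0 N.+1) big_mkord.
          by apply: eq_bigr => i0 _; rewrite big_mkord.
        move=> <-; rewrite mxE /X !mxE /= (rmorphM pr) -hlift [RHS]mulrA -(rmorphM pr); congr (pr _ * _).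
        by rewrite exprD polyCM; ring.
      under eq_bigr => l _ do under eq_bigr => c _ do rewrite mulr_sumr.
      under eq_bigr => l _ do rewrite exchange_big.
      rewrite exchange_big; apply: eq_bigr => a _ /=.
      rewrite /u mulr_suml rmorph_sum mulr_suml rmorph_sum; apply: eq_bigr => l _.
      rewrite mulr_suml rmorph_sum mulr_suml rmorph_sum; apply: eq_bigr => c _.
      by rewrite -rmorphM exprD /= !polyCM; congr (pr _); ring.
    rewrite -rmorph_sum; congr (pr _); rewrite (bigID (mem I)) mulrDr; congr (_ + _).
      rewrite -big_filter (perm_big I); last first.
        apply: uniq_perm; [by rewrite filter_uniq|exact: staircase_uniq|move=> a].
        by rewrite mem_filter andb_idr // => /Ibox.
      rewrite (big_nth (0, 0)%N) big_mkord (bigD1 i) //= big1 ?addr0 => [|j' ji].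
        by rewrite /u hv eqxx mul1r subnK // mulrC.
      by rewrite /u hv eq_sym (negPf ji) mul0r mul0r.
    rewrite /Y mxE !mulr_sumr; apply: eq_bigr => a aI.
    have wa : (wt (aa i) < wt a)%N by apply: wt_out; rewrite ?mem_nth.
    have -> : (W - wt (aa i) + wt a = W + (1 + (wt a - wt (aa i) - 1)))%N by lia.
    by rewrite !exprD expr1; ring.
  pose G := (map_mx polyC (P *m col_mx B CI) + 'X *: (map_mx polyC (rsubmx P) *m Y)) *m map_mx polyC J.
  have detE : pr (\det ((A + \sum_(x <- L) x.1 *m x.2) *m map_mx polyC J)) = pr ('X^(W * k) * \det G).
    have -> : 'X^(W * k) * \det G = \det ('X^W *: G) by rewrite detZ exprM.
    have sumV : map_mx pr (\sum_l V l *m X l) =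
        map_mx pr ('X^W *: (map_mx polyC CI + 'X *: Y)).
      apply/matrixP => i j; rewrite mxE summxE rmorph_sum key !mxE.
      by rewrite -/(aa i).
    have -> : \sum_(x <- L) x.1 *m x.2 = map_mx polyC (rsubmx P) *m \sum_l V l *m X l.
      rewrite /L big_map big_enum mulmx_sumr; apply: eq_bigr => l _.
      by rewrite /S mulmxA.
    rewrite -!det_map_mx /G scalemxAl; congr (\det _).
    rewrite [LHS]map_mxM [RHS]map_mxM; congr (_ *m _).
    rewrite map_mxD map_mxM sumV -(map_mxM pr) -(map_mxD pr) /A; congr (map_mx pr _).
    have -> : P *m col_mx B CI = lsubmx P *m B + rsubmx P *m CI.
      by rewrite -{1}(hsubmxK P) mul_row_col.
    rewrite map_mxD -scalemxAr -scalerDr.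
    by rewrite (map_mxM polyC (rsubmx P)) mulmxDr -scalemxAr addrA.
  (* The coefficient of e^(W k) is the determinant of [G] at e = 0, which is the nonzero minor [dPJ]
     of the limit conditions. *)
  rewrite detE; apply/eqP => /prP/(_ (W * k)%N (leq_addr _ _))/eqP.
  rewrite coefXnM ltnn subnn; apply/negP; rewrite -horner_coef0.
  rewrite -[X in X != 0]/(horner_eval 0 (\det G)) -det_map_mx.
  have ev0 p p' (Z : 'M[C]_(p, p')) : map_mx (horner_eval 0) (map_mx polyC Z) = Z.
    by apply/matrixP => i j; rewrite !mxE /horner_eval hornerC.
  have X0 p p' (Z : 'M[{poly C}]_(p, p')) : map_mx (horner_eval 0) ('X *: Z) = 0.
    by apply/matrixP => i j; rewrite !mxE /horner_eval hornerM hornerX mul0r.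
  by rewrite /G map_mxM map_mxD !ev0 X0 addr0.
- by exists Qs; split; rewrite // sQs size_map size_enum_ord.
Qed.

End Cluster.
End Collision.

(** * From [h] points to [4 h] and [9 h] points *)

Section Nonspecial.
Variables (C : numFieldType) (R : comNzRingType) (U : Type).
Variables (ev : U -> {rmorphism R -> C}) (cst : {rmorphism C -> R}).
Hypothesis ev_cst : forall o c, ev o (cst c) = c.
Hypothesis irr : forall f g : R, f != 0 -> g != 0 -> exists o, ev o f != 0 /\ ev o g != 0.
Variables (D1 D2 : R -> R).
Hypotheses (d1 : is_der cst D1) (d2 : is_der cst D2) (c12 : commuting D1 D2).
Variables (r : nat) (f : 'I_r -> R).

Definition fat_span m (Qs : seq U) : 'M[C]_r :=
  (\sum_(P <- Qs) <<map_mx (ev P) (jet_mx f D1 D2 (tri m))>>)%MS.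

(** One good tuple for each multiplicity is enough for the induction; general position is derived
    from it only at the end. *)
Definition independent n := forall m, exists2 Qs,
  size Qs = n & (minn r (n * size (tri m)) <= \rank (fat_span m Qs))%N.

Lemma size_triS t : size (tri t.+1) = (size (tri t) + t.+1)%N.
Proof.
rewrite !size_tri; have -> : (t.+1 * t.+2 = t.+1.*2 + t * t.+1)%N by lia.
by rewrite halfD odd_double doubleK add0n addnC.
Qed.

(** The points with tangent direction are replaced one after another by clusters, with the
    conditions at all other points kept in [B]. *)
Let clusters m n t s (os : seq (U * C)) (B : 'M[C]_r) k : (s <= t.+1)%N ->
  interpolates C m n (staircase t s) ->
  (k <= \rank (B + \sum_(o <- os) <<map_mx (ev_dir ev o)
     (tangent_mx (jet_mx f D1 D2 (tri t)) (tangent_w f D1 D2 t) s)>>)%MS)%N ->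
  exists2 Qs, size Qs = (n * size os)%N & (k <= \rank (B + fat_span m Qs)%MS)%N.
Proof.
move=> st interp; elim: os B => [|[Q l] os IH] B.
  by rewrite big_nil => hk; exists [::]; rewrite ?muln0 // /fat_span big_nil.
rewrite big_cons [(<<_>> + _)%MS]addsmxC addsmxA => hk.
have dd := dir_der l d1 d2; have dc := dir_comm l d2 c12.
have [|Q1 [sQ1 hQ1]] := cluster ev_cst irr dd d2 dc interp (k := k) (f := f)
  (B := (B + \sum_(o <- os) <<map_mx (ev_dir ev o)
     (tangent_mx (jet_mx f D1 D2 (tri t)) (tangent_w f D1 D2 t) s)>>)%MS) (Q := Q).
  apply: leq_trans hk _; apply/mxrankS/addsmxS => //; rewrite genmxE.
  exact: tangent_span_jet.
have [|Qs sQs hQs] := IH (B + fat_span m Q1)%MS.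
  apply: leq_trans hQ1 _; apply: mxrankS.
  rewrite addsmx_sub addsmxS ?addsmxSl //=.
  apply: submx_trans (addsmxSl _ _); apply: submx_trans (addsmxSr _ _).
  rewrite /fat_span; elim: (Q1) => [|P Q' IHQ]; first by rewrite !big_nil.
  by rewrite !big_cons addsmxS // !genmxE jet_dir.
exists (Q1 ++ Qs); first by rewrite size_cat sQ1 sQs mulnS.
apply: leq_trans hQs _; apply: mxrankS; rewrite -addsmxA addsmxS //.
by rewrite /fat_span big_cat.
Qed.

Let seq_fun (V : Type) n (s : seq V) : size s = n -> exists q : 'I_n -> V,
  forall F : V -> 'M[C]_r, (\sum_(x <- s) F x = \sum_(i < n) F (q i))%MS.
Proof.
move=> /eqP sn; exists (tnth (Tuple sn)) => F.
by rewrite -(big_tuple _ _ (Tuple sn) predT F).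
Qed.

Lemma independent_mul h n :
  (forall m, exists t s, [/\ (s <= t.+1)%N, (n * size (tri m) = size (tri t) + s)%N &
     interpolates C m n (staircase t s)]) ->
  independent h -> independent (n * h).
Proof.
move=> H ih m; have [t [s [st nE interp]]] := H m.
have [Q0 /seq_fun[q0 q0E] h0] := ih t.
have [Q1 /seq_fun[q1 q1E] h1] := ih t.+1.
have [||o ho] := @tangent_rank C R U ev cst ev_cst irr _ r t h
  (jet_mx f D1 D2 (tri t)) (tangent_w f D1 D2 t) (tangent_w_deriv f d1 d2 c12 (t:=t)) s st.
- by exists q0; rewrite /fat_span q0E in h0.
(* With all t + 1 conditions of order t, any slope gives the full point of multiplicity t + 1; slope
   0 makes this literal. *)
- exists (fun i => (q1 i, 0)); rewrite -size_triS.
  apply: leq_trans h1 _; apply: mxrankS; rewrite /fat_span q1E.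
  apply/sumsmx_subP => i _; apply: submx_trans (sumsmx_sup i _ (submx_refl _)) => //.
  rewrite !genmxE; apply/row_subP => k; set a := nth (0, 0)%N (tri t.+1) k.
  have -> : row k (map_mx (ev (q1 i)) (jet_mx f D1 D2 (tri t.+1))) =
     \row_j ev (q1 i) (mon D1 D2 a (f j)) by apply/rowP => j; rewrite !mxE.
  have : a \in tri t.+1 by rewrite mem_nth.
  rewrite map_col_mx -addsmxE; case: a => x y; rewrite mem_tri ltnS leq_eqVlt => /orP[/eqP xy|xy].
    have yt : (y < t.+1)%N by lia.
    apply: submx_trans (addsmxSr _ _).
    have -> : \row_j ev (q1 i) (mon D1 D2 (x, y) (f j)) =
       row (Ordinal yt) (map_mx (ev_dir ev (q1 i, 0)) (\matrix_(e < t.+1) tangent_w f D1 D2 t e)).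
      transitivity (map_mx (ev_dir ev (q1 i, 0)) (tangent_w f D1 D2 t y)).
        rewrite (ev_tangent_w ev_cst _ d1 d2); apply/rowP => j; rewrite !mxE.
        have -> : (t - y = x)%N by lia.
        congr (ev _ _); rewrite /mon /=; apply: eq_iter => z.
        by rewrite /dir rmorph0 mul0r addr0.
      by apply/rowP => j; rewrite !mxE.
    exact: row_sub.
  apply: submx_trans (addsmxSl _ _).
  have -> : map_mx (ev_dir ev (q1 i, 0)) (map_mx polyC (jet_mx f D1 D2 (tri t))) =
    map_mx (ev (q1 i)) (jet_mx f D1 D2 (tri t)).
    by apply/matrixP => i' j; rewrite !mxE ev_dirE map_polyC /= hornerC.
  by apply: jet_row; rewrite mem_tri.
have [|Qs sQs hQs] := clusters (os := codom o) (B := 0) st interp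
  (k := minn r (h * (size (tri t) + s))).
  apply: leq_trans ho _; apply: mxrankS; apply: submx_trans (addsmxSr _ _).
  rewrite /codom /image_mem big_map big_enum /=; exact: submx_refl.
exists Qs; first by rewrite sQs size_codom card_ord.
rewrite -mulnA mulnCA nE; apply: leq_trans hQs _; apply: mxrankS.
by rewrite addsmx_sub sub0mx submx_refl.
Qed.

Lemma independent_4_9 u w : independent 1 -> independent (4 ^ u * 9 ^ w).
Proof.
move=> i1; have i9 : independent (9 ^ w).
  elim: w => [|w IH]; first by rewrite expn0.
  rewrite expnS; apply: independent_mul IH => m.
  exists (3 * m)%N, (3 * m)%N; split; [by []| |exact: interpolates_9].
  by rewrite !size_tri; have := odd_double_half (m * m.+1);
     have := odd_double_half ((3 * m) * (3 * m).+1); rewrite !oddM /=; case: (odd m); lia.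
elim: u => [|u IH]; first by rewrite expn0 mul1n.
rewrite expnS -mulnA; apply: independent_mul IH => m.
exists (2 * m)%N, m; split; [by lia| |exact: interpolates_4].
by rewrite !size_tri; have := odd_double_half (m * m.+1);
   have := odd_double_half ((2 * m) * (2 * m).+1); rewrite !oddM /=; case: (odd m); lia.
Qed.

End Nonspecial.

(** * Derivations of function fields *)

Section SubRing.
Variables (K : comNzRingType) (S : subringClosed K).
Record subring_carrier := SubringCarrier { subring_val : K; _ : subring_val \in S }.
HB.instance Definition _ := [isSub for subring_val].
HB.instance Definition _ := [Choice of subring_carrier by <:].
HB.instance Definition _ := [SubChoice_isSubComNzRing of subring_carrier by <:].
End SubRing.

Section SubField.
Variables (K : fieldType) (S : divringClosed K).
Record subfield_carrier := SubfieldCarrier { subfield_val : K; _ : subfield_val \in S }.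
HB.instance Definition _ := [isSub for subfield_val].
HB.instance Definition _ := [Choice of subfield_carrier by <:].
HB.instance Definition _ := [SubChoice_isSubIntegralDomain of subfield_carrier by <:].
HB.instance Definition _ := [SubIntegralDomain_isSubField of subfield_carrier by <:].
End SubField.

Lemma subring_type (K : comNzRingType) (P : K -> Prop) :
  P 1 -> (forall a b, P a -> P b -> P (a - b)) -> (forall a b, P a -> P b -> P (a * b)) ->
  exists (R : comNzRingType) (j : {rmorphism R -> K}),
    injective j /\ forall a, P a <-> exists z, a = j z.
Proof.
move=> P1 PB PM; pose S : {pred K} := fun a => `[< P a >].
have SP : GRing.subring_closed S.
  by split; [apply/asboolP|move=> a b /asboolP Pa /asboolP Pb; apply/asboolP; exact: PB|
    move=> a b /asboolP Pa /asboolP Pb; apply/asboolP; exact: PM].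
pose S' : subringClosed K := HB.pack_for (subringClosed K) S (GRing.isSubringClosed.Build _ S SP).
exists (subring_carrier S' : comNzRingType), (val : {rmorphism subring_carrier S' -> K}).
split=> [|a]; first exact: val_inj.
split=> [Pa|[[z zS] ->]]; last exact/asboolP.
have aS : a \in S' by apply/asboolP.
by exists (SubringCarrier aS).
Qed.

Lemma subfield_type (K : fieldType) (P : K -> Prop) :
  P 1 -> (forall a b, P a -> P b -> P (a - b)) -> (forall a b, P a -> P b -> P (a / b)) ->
  exists (k : fieldType) (j : {rmorphism k -> K}), forall a, P a <-> exists z, a = j z.
Proof.
move=> P1 PB PM; pose S : {pred K} := fun a => `[< P a >].
have SP : GRing.divring_closed S.
  by split; [apply/asboolP|move=> a b /asboolP Pa /asboolP Pb; apply/asboolP; exact: PB|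
    move=> a b /asboolP Pa /asboolP Pb; apply/asboolP; exact: PM].
pose S' : divringClosed K := HB.pack_for (divringClosed K) S (GRing.isDivringClosed.Build _ S SP).
exists (subfield_carrier S' : fieldType), (val : {rmorphism subfield_carrier S' -> K}) => a.
split=> [Pa|[[z zS] ->]]; last exact/asboolP.
have aS : a \in S' by apply/asboolP.
by exists (SubfieldCarrier aS).
Qed.

Section AlgebraicExtension.
Variables (k K : fieldType) (j : {rmorphism k -> K}).
Hypothesis char0 : [pchar k] =i pred0.
Hypothesis alg : forall a : K, exists2 p : {poly k}, p != 0 & (map_poly j p).[a] = 0.

Let pev (p : {poly k}) (z : K) := (map_poly j p).[z].

Lemma minimal_poly z : exists P : {poly k}, [/\ P != 0, pev P z = 0 &
  forall p, pev p z = 0 -> (size p < size P)%N -> p = 0].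
Proof.
pose A n := `[< exists2 p : {poly k}, p != 0 & pev p z = 0 /\ size p = n >].
have exA : exists n, A n.
  by have [p p0 pz] := alg z; exists (size p); apply/asboolP; exists p.
case: (ex_minnP exA) => n /asboolP[P P0 [Pz Pn]] nmin; exists P; split=> // p pz.
rewrite Pn ltnNge => lt; apply/eqP; apply: contraNT lt => p0.
by apply: nmin; apply/asboolP; exists p.
Qed.

Lemma natk n : (n.+1%:R : k) != 0.
Proof. by have /pcharf0P -> := char0. Qed.

Lemma separable_minimal z P : P != 0 -> pev P z = 0 ->
  (forall p, pev p z = 0 -> (size p < size P)%N -> p = 0) -> pev P^`() z != 0.
Proof.
move=> P0 Pz Pmin; apply/eqP => /Pmin; rewrite lt_size_deriv // => /(_ isT) d0.
have PC : P = (P`_0)%:P.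
  apply/polyP => i; rewrite coefC; case: i => [|i] //=.
  have := congr1 (fun p : {poly k} => p`_i) d0; rewrite /= coef_deriv coef0.
  by rewrite -mulr_natr => /eqP; rewrite mulf_eq0 (negPf (natk i)) orbF => /eqP.
move: Pz P0; rewrite PC /pev map_polyC /= hornerC => /eqP; rewrite fmorph_eq0.
by rewrite polyC_eq0 => ->.
Qed.

Lemma finite_primitive (s : seq K) : exists z, forall x, x \in s -> exists p, pev p z = x.
Proof.
elim: s => [|x s [z IH]]; first by exists 0.
have [p p0 pz] := alg z; have [q q0 qx] := alg x.
have [n [[pz' hz] [px hx]]] := pchar0_PET p0 (introT rootP pz) q0 (introT rootP qx) char0.
exists (x *+ n - z) => y; rewrite inE => /orP[/eqP->|/IH[py <-]]; first by exists px.
by exists (py \Po pz'); rewrite /pev map_comp_poly horner_comp hz.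
Qed.

Variable delta : k -> K.
Hypothesis deltaD : forall a b, delta (a + b) = delta a + delta b.
Hypothesis deltaM : forall a b, delta (a * b) = j a * delta b + j b * delta a.

Let delta0 : delta 0 = 0.
Proof. by apply: (addIr (delta 0)); rewrite -deltaD !add0r. Qed.

Let coef_delta p i : (map_poly delta p)`_i = delta p`_i.
Proof. by rewrite coef_map_id0 // delta0. Qed.

(** The value at p(z) of a derivation that extends [delta] and takes [z] to [w]. *)
Let Th z w p := (map_poly delta p).[z] + pev p^`() z * w.

Let ThD z w p q : Th z w (p + q) = Th z w p + Th z w q.
Proof.
have -> : Th z w (p + q) = (map_poly delta p + map_poly delta q).[z] +
    pev (p + q)^`() z * w.
  by congr (_.[z] + _); apply/polyP => i; rewrite !(coef_delta, coefD) deltaD.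
by rewrite derivD /pev rmorphD !hornerD mulrDl addrACA.
Qed.

Let ThC z w c : Th z w c%:P = delta c.
Proof.
rewrite /Th derivC /pev rmorph0 horner0 mul0r addr0.
rewrite (_ : map_poly delta c%:P = (delta c)%:P) ?hornerC //.
by apply/polyP => i; rewrite coef_delta !coefC; case: eqP.
Qed.

Let ThCM z w c p : Th z w (c%:P * p) = delta c * pev p z + j c * Th z w p.
Proof.
have -> : Th z w (c%:P * p) = ((delta c)%:P * map_poly j p + (j c)%:P * map_poly delta p).[z] +
    pev (c%:P * p)^`() z * w.
  congr (_.[z] + _); apply/polyP => i.
  by rewrite coef_delta !coefCM coefD !coefCM coef_map coef_delta deltaM addrC [j _ * _]mulrC mulrC [_ * delta c]mulrC.
rewrite derivM derivC mul0r add0r /pev rmorphM /= map_polyC /= !(hornerD, hornerM, hornerC).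
by rewrite /Th /pev; ring.
Qed.

Let ThMX z w p : Th z w (p * 'X) = Th z w p * z + pev p z * w.
Proof.
have -> : Th z w (p * 'X) = (map_poly delta p * 'X).[z] + pev (p * 'X)^`() z * w.
  congr (_.[z] + _); apply/polyP => i.
  by rewrite coef_delta !coefMX; case: eqP; rewrite ?delta0 // coef_delta.
rewrite derivM derivX mulr1 /pev rmorphD rmorphM /= map_polyX !(hornerD, hornerM, hornerX).
by rewrite /Th /pev; ring.
Qed.

Let ThM z w p q : Th z w (p * q) = Th z w p * pev q z + pev p z * Th z w q.
Proof.
elim/poly_ind: p => [|p c IH].
  by rewrite mul0r -polyC0 ThC delta0 /pev map_polyC /= rmorph0 hornerC !mul0r addr0.
have -> : (p * 'X + c%:P) * q = (p * q) * 'X + c%:P * q by ring.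
rewrite !ThD !ThMX ThCM IH ThC /pev rmorphM rmorphD rmorphM /= map_polyX map_polyC /=.
by rewrite !(hornerD, hornerM, hornerX, hornerC); ring.
Qed.

Let Th_comp z w s p : Th z w (s \Po p) = Th (pev p z) (Th z w p) s.
Proof.
elim/poly_ind: s => [|s c IH]; first by rewrite comp_poly0 -polyC0 !ThC.
rewrite comp_poly_MXaddC !ThD !ThC ThMX ThM IH.
by rewrite /pev map_comp_poly horner_comp; ring.
Qed.

(** [w] is an admissible value at [z]; separability of the minimal polynomial leaves exactly one. *)
Let rel z w := forall p, pev p z = 0 -> Th z w p = 0.

Let rel_exists z : exists w, rel z w.
Proof.
have [P [P0 Pz Pmin]] := minimal_poly z; have dP := separable_minimal P0 Pz Pmin.
exists (- (map_poly delta P).[z] / pev P^`() z) => p pz.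
have pE := divp_eq p P.
have r0 : p %% P = 0.
  apply: Pmin; last by rewrite ltn_modp.
  move: pz; rewrite {1}pE /pev rmorphD rmorphM hornerD hornerM /= -/(pev P z) Pz.
  by rewrite mulr0 add0r.
by rewrite pE r0 addr0 ThM Pz mulr0 add0r /Th [pev P^`() z * _]mulrC divfK // subrr mulr0.
Qed.

Let rel_unique z w w' : rel z w -> rel z w' -> w = w'.
Proof.
have [P [P0 Pz Pmin]] := minimal_poly z; have dP := separable_minimal P0 Pz Pmin.
move=> /(_ P Pz) h /(_ P Pz); rewrite -[in RHS]h /Th => /addrI /(mulfI dP).
exact: esym.
Qed.

(** [D z] is the admissible value at [z]. By uniqueness it is consistent on k[z], and any two
    elements of K lie in a common k[z], where additivity and the Leibniz rule are inherited from
    [Th]. *)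
Lemma derivation_extension : exists D : K -> K,
  [/\ forall a b, D (a + b) = D a + D b, forall a b, D (a * b) = a * D b + b * D a &
      forall a, D (j a) = delta a].
Proof.
have /choice[D DP] := rel_exists; exists D.
have Dp z p : D (pev p z) = Th z (D z) p.
  apply: (rel_unique (DP _)) => s sz; rewrite -Th_comp; apply: DP.
  by rewrite /pev map_comp_poly horner_comp.
have two a b : exists z p q, a = pev p z /\ b = pev q z.
  have [z hz] := finite_primitive [:: a; b]; exists z.
  have [p pa] := hz a (mem_head _ _).
  have [|q qb] := hz b; first by rewrite !inE eqxx orbT.
  by exists p, q.
split=> [a b|a b|a].
- have [z [p [q [-> ->]]]] := two a b.
  have -> : pev p z + pev q z = pev (p + q) z by rewrite /pev rmorphD hornerD.
  by rewrite !Dp ThD.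
- have [z [p [q [-> ->]]]] := two a b.
  have -> : pev p z * pev q z = pev (p * q) z by rewrite /pev rmorphM hornerM.
  by rewrite !Dp ThM; ring.
- have -> : j a = pev a%:P 0 by rewrite /pev map_polyC hornerC.
  by rewrite Dp ThC.
Qed.

End AlgebraicExtension.

(** Differentiating P(z) = 0 for the minimal polynomial gives P'(z) D z = 0, and P'(z) is nonzero by
    separability. *)
Lemma derivation_eq0 (k K : fieldType) (j : {rmorphism k -> K}) (D : K -> K) :
  [pchar k] =i pred0 ->
  (forall a : K, exists2 p : {poly k}, p != 0 & (map_poly j p).[a] = 0) ->
  (forall a b, D (a + b) = D a + D b) -> (forall a b, D (a * b) = a * D b + b * D a) ->
  (forall a, D (j a) = 0) -> forall a, D a = 0.
Proof.
move=> char0 alg DD DM Dj z.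
have [P [P0 Pz Pmin]] := minimal_poly alg z.
have dP := separable_minimal char0 P0 Pz Pmin.
have D0 : D 0 = 0 by rewrite -{1}(rmorph0 j) Dj.
have Dp p : D (map_poly j p).[z] = (map_poly j p^`()).[z] * D z.
  elim/poly_ind: p => [|p c IH].
    by rewrite deriv0 !rmorph0 !horner0 mul0r.
  rewrite derivD derivM derivX derivC addr0 mulr1 !rmorphD !rmorphM /= map_polyX map_polyC /=.
  by rewrite !(hornerD, hornerM, hornerX, hornerC) DD DM IH Dj; ring.
have := Dp P; rewrite Pz D0 => /esym/eqP.
by rewrite mulf_eq0 (negPf dP) => /eqP.
Qed.

(** * Evaluation of multivariate polynomials *)

Section MpolyEvaluation.
Variables (n : nat) (A : nzRingType).

Lemma mmap_homog (S : comNzRingType) (f : {rmorphism A -> S}) (h : 'I_n -> S)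
    (c : S) d (F : {mpoly A[n]}) : F \is d.-homog ->
  mmap f (fun i => c * h i) F = c ^+ d * mmap f h F.
Proof.
move=> /dhomogP hF; rewrite /mmap mulr_sumr; apply: eq_big_seq => m mF.
rewrite mulrCA; congr (_ * _); rewrite /mmap1 -(hF m mF) /= mdegE.
by rewrite -prodrXr -big_split; apply: eq_bigr => i _; rewrite exprMn.
Qed.

Lemma rmorph_mmap (S T : comNzRingType) (f : {rmorphism A -> S}) (h : 'I_n -> S)
    (g : {rmorphism S -> T}) (f' : A -> T) (h' : 'I_n -> T) F :
  (forall a, g (f a) = f' a) -> (forall i, g (h i) = h' i) ->
  g (mmap f h F) = mmap f' h' F.
Proof.
move=> ef eh; rewrite /mmap rmorph_sum; apply: eq_bigr => m _.
rewrite rmorphM ef /mmap1 rmorph_prod; congr (_ * _).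
by apply: eq_bigr => i _; rewrite rmorphXn eh.
Qed.

Lemma mmap_id (F : {mpoly A[n]}) : mmap (@mpolyC n A) (fun i => 'X_i) F = F.
Proof.
rewrite [RHS]mpolyE /mmap; apply: eq_bigr => m _.
by rewrite -mul_mpolyC mpolyXE_id.
Qed.

End MpolyEvaluation.

Section Muni.
Variables (A : comNzRingType) (n : nat).

Lemma horner_muni (S : comNzRingType) (f : {rmorphism A -> S}) (y : 'I_n -> S) (a : S)
    (F : {mpoly A[n.+1]}) :
  (map_poly (mmap f y) (muni F)).[a] =
  mmap f (fun i => match split (cast_ord (esym (addn1 n)) i) with
    | inl j => y j | inr _ => a end) F.
Proof.
pose g : {rmorphism {poly {mpoly A[n]}} -> S} := (horner_eval a \o map_poly (mmap f y)).
rewrite -[LHS]/(g (muni F)); apply: rmorph_mmap => [c|i].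
  by rewrite /g /= map_polyC /horner_eval hornerC /= mmapC.
case: split => j; rewrite /g /= /horner_eval; last by rewrite map_polyX hornerX.
by rewrite map_polyC hornerC /= mmapX mmap1U.
Qed.

Lemma muni_eq0 (F : {mpoly A[n.+1]}) : muni F = 0 -> F = 0.
Proof.
move=> h; rewrite -[F]mmap_id.
pose W : 'I_n -> {mpoly A[n.+1]} := fun j => 'X_(cast_ord (addn1 n) (lshift 1 j)).
have := horner_muni (@mpolyC n.+1 A) W 'X_ord_max F; rewrite h rmorph0 horner0 => ->.
congr (mmap _ _ F); apply/funext => i; rewrite /W.
case: splitP => j e; congr 'X__; apply: val_inj => /=; first by rewrite -e.
by move: e => /= ->; rewrite ord1 addn0.
Qed.

End Muni.

Lemma mpoly_nonroot (C : numFieldType) n (F : {mpoly C[n]}) :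
  F != 0 -> exists c, F.@[c] != 0.
Proof.
elim: n F => [|n IH] F F0.
  exists (fun=> 0); have FE : F = (F@_0%MM)%:MP.
    by apply/mpolyP => m; rewrite mcoeffC (_ : m = 0%MM) ?eqxx ?mulr1 //; apply/mnmP => -[].
  by apply: contraNneq F0; rewrite FE mevalC => ->.
have u0 : muni F != 0 by apply: contraNneq F0 => /muni_eq0 ->.
have [c hc] : exists c, (lead_coef (muni F)).@[c] != 0 by apply: IH; rewrite lead_coef_eq0.
have p0 : map_poly (meval c) (muni F) != 0.
  apply: contraNneq hc => e; rewrite lead_coefE -[meval c _]/((meval c) (muni F)`_(size (muni F)).-1).
  by rewrite -coef_map e coef0.
have [a] := exists_nonroot p0; rewrite horner_muni => ha.
by eexists; exact: ha.
Qed.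

Section FunctionField.
Variables (C : numClosedFieldType) (K : fieldType) (iota : {rmorphism C -> K}).

Lemma dependent_root (y : 'I_2 -> K) (a : K) : alg_indep iota y -> trdeg_eq iota 2 ->
  exists2 p : {poly {mpoly C[2]}}, p != 0 & (map_poly (mmap iota y) p).[a] = 0.
Proof.
move=> yi [_ dep].
pose y' (i : 'I_3) := match split (cast_ord (esym (addn1 2)) i) with
    | inl j => y j | inr _ => a end.
have /existsNP[F /not_implyP[F0 Fn]] := dep y'.
exists (muni F); first by apply/eqP => /muni_eq0.
by rewrite horner_muni.
Qed.

(* [k] is the purely transcendental field C(y), as a subfield of [K]. *)
Lemma purely_transcendental (y : 'I_2 -> K) : alg_indep iota y -> trdeg_eq iota 2 ->
  exists (k : fieldType) (j : {rmorphism k -> K}),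
  [/\ forall a, (exists z, a = j z) <->
        exists F G, G != 0 /\ a = mmap iota y F / mmap iota y G,
      [pchar k] =i pred0 &
      forall a : K, exists2 p : {poly k}, p != 0 & (map_poly j p).[a] = 0].
Proof.
move=> yi tr; pose e := mmap iota y.
have e0 F : F != 0 -> e F != 0 by move=> h; apply/eqP => /yi/eqP; rewrite (negPf h).
pose P a := exists F G, G != 0 /\ a = e F / e G.
have [|a b [F [G [G0 ->]]] [F' [G' [G0' ->]]]||k [j jP]] := @subfield_type K P.
- by exists 1, 1; rewrite oner_eq0 /e !rmorph1 divr1.
- exists (F * G' - F' * G), (G * G'); rewrite mulf_neq0 //; split=> //.
  rewrite /e rmorphB !rmorphM /= -/(e F) -/(e G) -/(e F') -/(e G').
  have := e0 _ G0; have := e0 _ G0' => h1 h2; field.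
  by rewrite h1 h2.
- move=> a b [F [G [G0 ->]]] [F' [G' [G0' ->]]].
  have [->|F0'] := eqVneq F' 0.
    by exists 0, 1; rewrite oner_eq0 /e !rmorph0 mul0r invr0 mulr0 mul0r.
  exists (F * G'), (G * F'); rewrite mulf_neq0 //; split=> //.
  by rewrite /e !rmorphM /= invfM !invfM invrK; ring.
exists k, j; split=> [a||a].
- by split=> [/jP|/jP].
- move=> p; rewrite !inE; apply/negP => /andP[pp /eqP pk].
  have : iota p%:R = 0 by rewrite rmorph_nat -(rmorph_nat j) pk rmorph0.
  move/eqP; rewrite fmorph_eq0 pnatr_eq0 => /eqP p0.
  by rewrite p0 in pp.
have [p p0 pa] := dependent_root a yi tr.
have /choice[l hl] : forall F, exists z, e F = j z.
  by move=> F; apply/jP; exists F, 1; rewrite oner_eq0 /e rmorph1 divr1.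
have l0 : l 0 = 0 by apply: (fmorph_inj j); rewrite -hl /e !rmorph0.
have pE : map_poly j (map_poly l p) = map_poly e p.
  apply/polyP => i; rewrite coef_map /= coef_map_id0 // -hl coef_map_id0 //.
  by rewrite /e rmorph0.
exists (map_poly l p); last by rewrite pE.
apply: contraNneq p0 => lp0; apply/eqP/polyP => i; rewrite coef0.
have := congr1 (fun q : {poly K} => q`_i) pE.
rewrite /= lp0 rmorph0 coef0 coef_map_id0 => [/esym/eqP|]; last by rewrite /e rmorph0.
by apply: contraTeq; exact: e0.
Qed.

(** The partial derivatives of C(y0, y1), extended to K. Their commutator is a derivation vanishing
    on C(y0, y1), hence zero. *)
Lemma dual_derivations : trdeg_eq iota 2 -> exists (y : 'I_2 -> K) (D : 'I_2 -> K -> K),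
  [/\ forall i, derivation iota (D i), forall i j a, D i (D j a) = D j (D i a) &
      forall i j, D i (y j) = (i == j)%:R].
Proof.
move=> tr; have [[y yi] _] := tr; exists y.
have [k [j [kP k0 ka]]] := purely_transcendental yi tr.
pose e := mmap iota y.
have e0 F : F != 0 -> e F != 0 by move=> h; apply/eqP => /yi/eqP; rewrite (negPf h).
have einj F G : e F = e G -> F = G.
  by move=> h; apply/eqP; rewrite -subr_eq0; apply/eqP/yi; rewrite rmorphB /= -/e h subrr.
have /choice[num hnum] : forall z : k, exists FG : {mpoly C[2]} * {mpoly C[2]},
    FG.2 != 0 /\ j z = e FG.1 / e FG.2.
  move=> z; have [F [G [G0 h]]] := (kP (j z)).1 (ex_intro _ z erefl).
  by exists (F, G).
(* The quotient rule on a chosen fraction; [qE] makes it independent of the choice. *)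
pose q i (F G : {mpoly C[2]}) := (e F^`M(i) * e G - e F * e G^`M(i)) / e G ^+ 2.
have qE i F G F' G' : G != 0 -> G' != 0 -> e F / e G = e F' / e G' ->
    q i F G = q i F' G'.
  move=> G0 G0' h; have h0 := e0 _ G0; have h0' := e0 _ G0'.
  have E : F * G' = F' * G.
    by apply: einj; rewrite /e !rmorphM /= -/e; apply/eqP; rewrite -eqr_div //; apply/eqP.
  have dE := congr1 (fun F => e F^`M(i)) E; rewrite /= !mderivM /e !rmorphD !rmorphM /= -/e in dE.
  have eE : e F * e G' = e F' * e G by have := congr1 e E; rewrite /e !rmorphM.
  rewrite /q; apply/eqP; rewrite eqr_div ?expf_neq0 //; apply/eqP.
  have -> : (e F^`M(i) * e G - e F * e G^`M(i)) * e G' ^+ 2 =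
    e G * e G' * (e F^`M(i) * e G' + e F * e G'^`M(i)) - e G * e G'^`M(i) * (e F * e G')
    - e G' * e G^`M(i) * (e F * e G') by ring.
  by rewrite dE eE; ring.
pose delta i z := q i (num z).1 (num z).2.
have deltaE i z F G : G != 0 -> j z = e F / e G -> delta i z = q i F G.
  by move=> G0 h; have [n0 nE] := hnum z; apply: qE => //; rewrite -nE.
have dD i a b : delta i (a + b) = delta i a + delta i b.
  have [a0 aE] := hnum a; have [b0 bE] := hnum b.
  have ha := e0 _ a0; have hb := e0 _ b0.
  rewrite (deltaE i (a + b) ((num a).1 * (num b).2 + (num b).1 * (num a).2)
    ((num a).2 * (num b).2)) ?mulf_neq0 //; last first.
    by rewrite rmorphD aE bE /e rmorphD !rmorphM /= -/e addf_div.
  rewrite /delta /q /e !(mderivD, mderivM) !(rmorphD, rmorphM) /= -/e.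
  by field; rewrite ha hb.
have dM i a b : delta i (a * b) = j a * delta i b + j b * delta i a.
  have [a0 aE] := hnum a; have [b0 bE] := hnum b.
  have ha := e0 _ a0; have hb := e0 _ b0.
  rewrite (deltaE i (a * b) ((num a).1 * (num b).1)
    ((num a).2 * (num b).2)) ?mulf_neq0 //; last first.
    by rewrite rmorphM aE bE /e !rmorphM /= -/e mulf_div.
  rewrite aE bE /delta /q /e !mderivM !rmorphD !rmorphM /= -/e.
  by field; rewrite ha hb.
have /choice[D hD] := fun i => derivation_extension k0 ka (dD i) (dM i).
have De i F : D i (e F) = e F^`M(i).
  have [z hz] : exists z, e F = j z.
    by apply/kP; exists F, 1; rewrite oner_eq0 rmorph1 divr1.
  have [_ _ Dj] := hD i; rewrite hz Dj (deltaE i z F 1) ?oner_eq0 //.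
    have d1 : (1 : {mpoly C[2]})^`M(i) = 0 by rewrite -mpolyC1 mderivC.
    by rewrite /q d1 /e rmorph0 rmorph1 mulr0 subr0 mulr1 expr1n divr1.
  by rewrite -hz /e rmorph1 divr1.
have D0 i : D i 0 = 0.
  by have [DD _ _] := hD i; apply: (addIr (D i 0)); rewrite -DD !add0r.
exists D; split=> [i|i l a|i l].
- have [DD DM _] := hD i; split=> // c.
  by rewrite -(mmapC y iota c) De mderivC /e rmorph0.
- have [DDi DMi _] := hD i; have [DDl DMl _] := hD l.
  pose G a := D i (D l a) - D l (D i a).
  suff : G a = 0 by move/eqP; rewrite subr_eq0 => /eqP.
  apply: (derivation_eq0 k0 ka (D := G)) => [u v|u v|z]; rewrite /G.
  + by rewrite DDl DDi DDi DDl; ring.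
  + by rewrite DMl DMi DDi DDl !DMi !DMl; ring.
  have [n0 nE] := hnum z; have h0 := e0 _ n0.
  pose c := j z; have cE : c * e (num z).2 = e (num z).1 by rewrite /c nE divfK.
  have Gc : G (c * e (num z).2) = 0 by rewrite cE /G !De mderiv_comm subrr.
  have Gn : G (e (num z).2) = 0 by rewrite /G !De mderiv_comm subrr.
  move: Gc; rewrite /G DMl DMi DDi DDl !DMi !DMl => Gc.
  apply: (mulIf h0); rewrite mul0r -[RHS]Gc -/c.
  rewrite -[LHS]addr0 -[X in _ + X = _](mulr0 c) -[X in c * X]Gn /G; ring.
- rewrite -[y l]/(y l) -(mmap1U y l) -(mmapX y iota U_(l)%MM) De mderivX mnmE eq_sym.
  have [->|ne] := eqVneq l i; rewrite ?eqxx ?scale0r ?rmorph0 //.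
    rewrite scale1r (_ : (U_(i) - U_(i))%MM = 0%MM) ?mpolyX0 /e ?rmorph1 //.
    by apply/mnmP => ?; rewrite !mnmE subnn.
  by rewrite /e rmorph0.
Qed.

End FunctionField.

(** * Points and multiplicities *)

Section Points.
Variables (C : numClosedFieldType) (K : fieldType) (iota : {rmorphism C -> K}).
Variables (N : nat) (x : 'I_N.+1 -> K).
Hypothesis tr : trdeg_eq iota 2.

(* [K] is generated by one element over C(y0, y1), so that the coordinates become
   polynomials in it; specialize (y0, y1) and lift the specialization to a root of
   the minimal polynomial. *)
Lemma exists_point_affine d (F : {mpoly C[N.+1]}) :
  F \is d.-homog -> mmap iota x F != 0 ->
  exists Q : 'I_N.+1 -> C, F.@[Q] != 0 /\
    forall d' (G : {mpoly C[N.+1]}), G \is d'.-homog -> mmap iota x G = 0 -> G.@[Q] = 0.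
Proof.
move=> Fh Fx; have [[y yi] _] := tr.
have [k [j [kP k0 ka]]] := purely_transcendental yi tr.
pose O : comNzRingType := {mpoly C[2]}.
pose e : {rmorphism {mpoly C[2]} -> K} := mmap iota y.
have e0 P : P != 0 -> e P != 0 by move=> h; apply/eqP => /yi/eqP; rewrite (negPf h).
have [th hth] := finite_primitive k0 ka [seq x i | i <- enum 'I_N.+1].
have /choice[p hp] : forall i, exists p : {poly k}, (map_poly j p).[th] = x i.
  by move=> i; apply: hth; apply: map_f; rewrite mem_enum.
have clear (s : seq k) : exists2 B : {mpoly C[2]}, B != 0 &
    forall z, z \in s -> exists b, j z * e B = e b.
  elim: s => [|z s [B B0 IH]]; first by exists 1; rewrite ?oner_eq0.
  have [P [Q [Q0 jz]]] := (kP (j z)).1 (ex_intro _ z erefl).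
  exists (B * Q); first by rewrite mulf_neq0.
  move=> z'; rewrite inE => /orP[/eqP->|/IH[b hb]].
    by exists (P * B); rewrite !(rmorphM e) jz [e B * _]mulrC mulrA divfK ?e0.
  by exists (b * Q); rewrite !(rmorphM e) mulrA hb.
(* A common denominator: [B] times each homogeneous coordinate becomes a polynomial in [th] over
   C[y0, y1]. *)
have [B B0 hB] := clear (flatten [seq (p i : seq k) | i <- enum 'I_N.+1]).
have /choice[num hnum] : forall z, exists b,
    z \in 0 :: flatten [seq (p i : seq k) | i <- enum 'I_N.+1] -> j z * e B = e b.
  move=> z; rewrite inE; have [->|_] := eqVneq z 0; first by exists 0; rewrite !rmorph0 mul0r.
  case: (boolP (z \in flatten _)) => [/hB[b hb]|_]; last by exists 0.
  by exists b.
pose X i : {poly {mpoly C[2]}} := \poly_(l < size (p i)) num (p i)`_l.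
pose evt : {rmorphism {poly {mpoly C[2]}} -> K} := (horner_eval th \o map_poly e).
have evX i : evt (X i) = e B * x i.
  rewrite /evt /= /horner_eval -hp -hornerZ; congr (_.[th]); apply/polyP => l.
  rewrite coef_map coefZ coef_map coef_poly /=; case: ltnP => ls; last first.
    by rewrite nth_default // !rmorph0 mulr0.
  rewrite -hnum 1?mulrC // inE; apply/orP; right; apply/flattenP.
  by exists (p i : seq k); rewrite ?mem_nth //; apply: map_f; rewrite mem_enum.
pose sub (G : {mpoly C[N.+1]}) := mmap (polyC \o (@mpolyC 2 C)) X G.
have evsub d' G : G \is d'.-homog -> evt (sub G) = e B ^+ d' * mmap iota x G.
  move=> Gh; rewrite -(mmap_homog iota x _ Gh).
  rewrite /sub; apply: rmorph_mmap => [a|i]; last exact: evX.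
  by rewrite /evt /= map_polyC /horner_eval hornerC /e /= mmapC.
have [P [P0 Pt Pmin]] : exists P : {poly {mpoly C[2]}}, [/\ P != 0, evt P = 0 &
    forall q, evt q = 0 -> (size q < size P)%N -> q = 0].
  pose A n := `[< exists2 q : {poly {mpoly C[2]}}, q != 0 & evt q = 0 /\ size q = n >].
  have exA : exists n, A n.
    have [q q0 qt] := dependent_root th yi tr.
    by exists (size q); apply/asboolP; exists q.
  case: (ex_minnP exA) => n /asboolP[P P0 [Pt Pn]] nmin; exists P; split=> // q qt.
  rewrite Pn ltnNge => lt; apply/eqP; apply: contraNT lt => q0.
  by apply: nmin; apply/asboolP; exists q.
have sP : (1 < size P)%N.
  rewrite ltnNge; apply/negP => /size1_polyC PC; move: Pt P0.
  rewrite PC /evt /= map_polyC /horner_eval hornerC /= => /eqP h.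
  by rewrite polyC_eq0; apply/negP; rewrite negbK; apply: contraTT h; exact: e0.
pose h := sub F.
have ht : evt h != 0 by rewrite (evsub d) // mulf_neq0 // expf_neq0 // e0.
(* Away from the zeros of [r], P and [h] have no common root. It is their resultant, nonzero because
   P is minimal and [h] does not vanish at [th]; a constant [h] serves as [r] itself. *)
have [r r0 hr] : exists2 r : {mpoly C[2]}, r != 0 &
    exists u v : {poly {mpoly C[2]}}, r%:P = u * P + v * h.
  have [sh|sh] := leqP (size h) 1.
    have hC := size1_polyC sh; exists h`_0.
      by apply: contraNneq ht => h0; rewrite hC h0 rmorph0.
    by exists 0, 1; rewrite -hC mul0r add0r mul1r.
  have [[u v] /= _ ruv] := resultant_in_ideal sP sh.
  exists (resultant P h); last by exists u, v.
  rewrite resultant_eq0; apply/negP => sg.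
  have := Pdiv.Idomain.dvdp_gcdl P h; rewrite Pdiv.Idomain.dvdp_eq => /eqP.
  have := Pdiv.Idomain.dvdp_gcdr P h; rewrite Pdiv.Idomain.dvdp_eq => /eqP.
  set g := gcdp P h; set c' := _ ^+ _; set c := _ ^+ _ => hg Pg.
  have g0 : g != 0 by rewrite -size_poly_gt0; apply: ltnW.
  have c0 : c != 0 by rewrite expf_neq0 // lead_coef_eq0.
  have c0' : c' != 0 by rewrite expf_neq0 // lead_coef_eq0.
  have cP0 : c *: P != 0 by rewrite -size_poly_gt0 size_scale // size_poly_gt0.
  have q0 : P %/ g != 0 by apply: contraNneq cP0 => e1; rewrite Pg e1 mul0r.
  have sq : (size (P %/ g)%R < size P)%N.
    rewrite -(size_scale P c0) Pg size_mul // -/g; move: sg; rewrite -/g; case: (size g) => [|[|n]] // _.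
    by rewrite !addnS /= ltnS leq_addr.
  have evtZ a f : evt (a *: f) = e a * evt f.
    by rewrite /evt /= map_polyZ /horner_eval hornerZ.
  have : evt (P %/ g) * evt g = 0 by rewrite -rmorphM -Pg evtZ Pt mulr0.
  move/eqP; rewrite mulf_eq0 => /orP[/eqP/Pmin/(_ sq)/eqP|/eqP eg]; first by rewrite (negPf q0).
  have : evt (c' *: h) = 0 by rewrite hg rmorphM eg mulr0.
  by move/eqP; rewrite evtZ mulf_eq0 (negPf ht) orbF (negPf (e0 _ c0')).
have [u [v uv]] := hr.
have lP0 : lead_coef P != 0 by rewrite lead_coef_eq0.
(* At such a [z] the specialized P keeps its degree and has a root [t0], which by the relation for
   [r] is not a root of [h]. *)
have [z] := mpoly_nonroot (mulf_neq0 lP0 r0); rewrite mevalM mulf_eq0 negb_or => /andP[lz rz].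
pose Pz := map_poly (meval z) P.
have sPz : size Pz != 1.
  by rewrite size_map_poly_id0 // neq_ltn sP orbT.
have [t0 /rootP t0P] := closed_rootP Pz sPz.
pose s : {rmorphism {poly {mpoly C[2]}} -> C} := (horner_eval t0 \o map_poly (meval z)).
have sC a : s a%:P = a.@[z] by rewrite /s /= map_polyC /horner_eval hornerC.
have sP0 : s P = 0 by exact: t0P.
have sZ a f : s (a *: f) = a.@[z] * s f by rewrite -mul_polyC rmorphM sC.
pose Q i := s (X i).
have sQ G : s (sub G) = G.@[Q].
  by rewrite /meval /sub; apply: rmorph_mmap => [a|i] //; rewrite -[LHS]/(s _) sC mevalC.
exists Q; split.
  rewrite -sQ; apply: contraNneq rz => sh.
  by rewrite -sC uv rmorphD !rmorphM sP0 -/h sh !mulr0 addr0.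
move=> d' G Gh Gx.
have evG : evt (sub G) = 0 by rewrite (evsub d') // Gx mulr0.
(* Pseudo-division: a form vanishing at [x] is, up to a power of the leading coefficient, a multiple
   of P, so it vanishes at the specialized point. *)
have := Pdiv.Idomain.divp_eq (sub G) P.
set c := _ ^+ _ => dG.
have rem : (sub G) %% P = 0.
  apply: Pmin; last by rewrite Pdiv.Idomain.ltn_modp.
  move: (congr1 evt dG); rewrite rmorphD rmorphM Pt mulr0 add0r -mul_polyC rmorphM evG mulr0.
  by [].
have : s (c *: sub G) = 0 by rewrite dG rem addr0 rmorphM sP0 mulr0.
rewrite sZ sQ => /eqP; rewrite mulf_eq0 => /orP[|/eqP//].
by rewrite /c rmorphXn /= expf_eq0 (negPf lz) andbF.
Qed.

Lemma meval_homog d (F : {mpoly C[N.+1]}) (c : C) (v : 'I_N.+1 -> C) : F \is d.-homog ->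
  F.@[fun i => c * v i] = c ^+ d * F.@[v].
Proof. exact: (mmap_homog idfun). Qed.

Lemma exists_point d (F : {mpoly C[N.+1]}) :
  F \is d.-homog -> mmap iota x F != 0 -> (exists i, x i != 0) ->
  exists Q : 'rV_N.+1, point iota x Q /\ F.@[Q 0] != 0.
Proof.
move=> Fh Fx [i0 xi0].
(* The extra factor keeps one coordinate nonzero, so that the point can be normalized by its first
   nonzero coordinate. *)
have [Q []] : exists Q : 'I_N.+1 -> C, (F * 'X_i0).@[Q] != 0 /\
    forall d' (G : {mpoly C[N.+1]}), G \is d'.-homog -> mmap iota x G = 0 -> G.@[Q] = 0.
  apply: (@exists_point_affine (d + 1)); first by rewrite dhomogM // dhomogX /= mdeg1.
  by rewrite rmorphM mulf_neq0 //= mmapX mmap1U.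
rewrite mevalM mevalXU mulf_eq0 negb_or => /andP[FQ Qi0] van.
case: (arg_minnP (P := fun i => Q i != 0) (fun i => i : nat) Qi0) => i Qi mini.
have QE (G : {mpoly C[N.+1]}) d' : G \is d'.-homog ->
    G.@[(\row_j ((Q i)^-1 * Q j)) 0] = (Q i)^-1 ^+ d' * G.@[Q].
  by move=> Gh; rewrite -(meval_homog _ _ Gh); apply: meval_eq => j; rewrite mxE.
exists (\row_j ((Q i)^-1 * Q j)); split; last first.
  by rewrite (QE _ _ Fh) mulf_neq0 // expf_neq0 // invr_eq0.
split=> [|d' G Gh Gx]; last by rewrite (QE _ _ Gh) (van _ _ Gh) // mulr0.
exists i; split=> [|j ji]; rewrite mxE ?mulVf //.
case: (eqVneq (Q j) 0) => [->|/mini]; first by rewrite mulr0.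
by rewrite leqNgt ji.
Qed.

End Points.

Section Values.
Variables (C : numClosedFieldType) (K : fieldType) (iota : {rmorphism C -> K}).
Variables (N : nat) (x : 'I_N.+1 -> K) (P : 'rV[C]_N.+1).
Hypothesis pP : point iota x P.

(** The residue of [f] at P, as a relation that includes membership in the local ring. *)
Definition value (f : K) (c : C) := exists d (F G : {mpoly C[N.+1]}),
  [/\ F \is d.-homog, G \is d.-homog, G.@[P 0] != 0,
      f = mmap iota x F / mmap iota x G & c = F.@[P 0] / G.@[P 0]].

Lemma form_neq0 d (G : {mpoly C[N.+1]}) :
  G \is d.-homog -> G.@[P 0] != 0 -> mmap iota x G != 0.
Proof. by move=> Gh; apply: contraNneq => /(pP.2 _ _ Gh) ->. Qed.

Lemma value_form d (F G : {mpoly C[N.+1]}) : F \is d.-homog -> G \is d.-homog ->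
  G.@[P 0] != 0 -> value (mmap iota x F / mmap iota x G) (F.@[P 0] / G.@[P 0]).
Proof. by exists d, F, G. Qed.

Lemma value_inj f c c' : value f c -> value f c' -> c = c'.
Proof.
move=> [d [F [G [Fh Gh G0 -> ->]]]] [d' [F' [G' [Fh' Gh' G0' e ->]]]].
have Gx := form_neq0 Gh G0; have Gx' := form_neq0 Gh' G0'.
apply/eqP; rewrite eqr_div // -subr_eq0 -!mevalM -mevalB; apply/eqP.
apply: (pP.2 (d + d')%N); first by rewrite rpredB ?[F' * G]mulrC ?dhomogM.
by rewrite rmorphB !rmorphM /=; apply/eqP; rewrite subr_eq0 -eqr_div //; apply/eqP.
Qed.

Lemma value_cst c : value (iota c) c.
Proof.
exists 0%N, c%:MP, 1; split; rewrite ?dhomog1 ?meval1 ?oner_eq0 //.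
- by rewrite -[c%:MP]mulr1 mul_mpolyC rpredZ ?dhomog1.
- by rewrite mmapC rmorph1 divr1.
- by rewrite mevalC divr1.
Qed.

Lemma valueM f g a b : value f a -> value g b -> value (f * g) (a * b).
Proof.
move=> [d [F [G [Fh Gh G0 -> ->]]]] [d' [F' [G' [Fh' Gh' G0' -> ->]]]].
exists (d + d')%N, (F * F'), (G * G'); split; rewrite ?dhomogM ?mevalM ?mulf_neq0 //.
  by rewrite !rmorphM mulf_div.
by rewrite mulf_div.
Qed.

Lemma valueD f g a b : value f a -> value g b -> value (f + g) (a + b).
Proof.
move=> [d [F [G [Fh Gh G0 -> ->]]]] [d' [F' [G' [Fh' Gh' G0' -> ->]]]].
exists (d + d')%N, (F * G' + F' * G), (G * G'); split.
- by rewrite rpredD ?[F' * G]mulrC ?dhomogM.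
- by rewrite dhomogM.
- by rewrite mevalM mulf_neq0.
- by rewrite addf_div ?(form_neq0 Gh) ?(form_neq0 Gh') // rmorphD !rmorphM.
- by rewrite addf_div // mevalD !mevalM.
Qed.

Lemma valueB f g a b : value f a -> value g b -> value (f - g) (a - b).
Proof.
move=> hf hg; rewrite -mulN1r -[- b]mulN1r; apply: valueD => //; apply: valueM => //.
by rewrite -(rmorph1 iota) -rmorphN; exact: value_cst.
Qed.

Lemma valueV f a : value f a -> a != 0 -> value f^-1 a^-1.
Proof.
move=> [d [F [G [Fh Gh G0 -> ->]]]] FG0; exists d, G, F; split; rewrite ?invf_div //.
by apply: contraNneq FG0 => ->; rewrite mul0r.
Qed.

Lemma localP f : local_ring iota x P f <-> exists c, value f c.
Proof.
split=> [[d [F [G [Fh Gh G0 ->]]]]|[c [d [F [G [Fh Gh G0 -> _]]]]]]; last by exists d, F, G.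
by exists (F.@[P 0] / G.@[P 0]); exact: value_form Fh Gh G0.
Qed.

Lemma max_idealP f : max_ideal iota x P f <-> value f 0.
Proof.
split=> [[d [F [G [Fh Gh F0 G0 ->]]]]|[d [F [G [Fh Gh G0 -> h]]]]].
  by have := value_form Fh Gh G0; rewrite F0 mul0r.
exists d, F, G; split=> //; apply/eqP; have /eqP := esym h.
by rewrite mulf_eq0 invr_eq0 (negPf G0) orbF.
Qed.

Notation loc := (local_ring iota x P).
Notation mx := (max_ideal iota x P).
Notation mpow := (max_ideal_pow iota x P).

Lemma max_local f : mx f -> loc f.
Proof. by move=> /max_idealP h; apply/localP; exists 0. Qed.

Lemma loc_cst c : loc (iota c). Proof. by apply/localP; exists c; exact: value_cst. Qed.

Lemma locM f g : loc f -> loc g -> loc (f * g).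
Proof.
by move=> /localP[a fa] /localP[b gb]; apply/localP; exists (a * b); exact: valueM.
Qed.

Lemma locD f g : loc f -> loc g -> loc (f + g).
Proof.
by move=> /localP[a fa] /localP[b gb]; apply/localP; exists (a + b); exact: valueD.
Qed.

Lemma locB f g : loc f -> loc g -> loc (f - g).
Proof.
by move=> /localP[a fa] /localP[b gb]; apply/localP; exists (a - b); exact: valueB.
Qed.

Lemma maxD f g : mx f -> mx g -> mx (f + g).
Proof. by rewrite !max_idealP => /valueD h /h; rewrite addr0. Qed.

Lemma maxMl f g : loc f -> mx g -> mx (f * g).
Proof. by move=> /localP[a fa]; rewrite !max_idealP => /(valueM fa); rewrite mulr0. Qed.

Lemma mpow_loc k f : mpow k f -> loc f.
Proof.
elim: k f => [|k IH] // f [r [a [b [ab ->]]]].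
elim/big_ind: _ => [||i _]; [by rewrite -(rmorph0 iota); exact: loc_cst|exact: locD|].
by apply: locM; [apply/max_local; exact: (ab i).1|apply: IH; exact: (ab i).2].
Qed.

Lemma mpowD k f g : mpow k f -> mpow k g -> mpow k (f + g).
Proof.
case: k => [|k]; first exact: locD.
move=> [r [a [b [ab ->]]]] [r' [a' [b' [ab' ->]]]]; exists (r + r')%N.
exists (fun i => match split i with inl j => a j | inr j => a' j end).
exists (fun i => match split i with inl j => b j | inr j => b' j end).
split=> [i|]; first by case: split.
rewrite big_split_ord; congr (_ + _); apply: eq_bigr => i _.
  by rewrite (unsplitK (inl i)).
by rewrite (unsplitK (inr i)).
Qed.

Lemma mpowMl k f g : loc f -> mpow k g -> mpow k (f * g).
Proof.
elim: k g => [|k IH] g lf; first exact: locM.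
move=> [r [a [b [ab ->]]]]; exists r, a, (fun i => f * b i); split=> [i|].
  by split; [exact: (ab i).1|apply: IH => //; exact: (ab i).2].
by rewrite mulr_sumr; apply: eq_bigr => i _; rewrite mulrCA.
Qed.

Lemma mpowB k f g : mpow k f -> mpow k g -> mpow k (f - g).
Proof.
move=> hf hg; apply: mpowD => //; rewrite -mulN1r; apply: mpowMl => //.
by rewrite -(rmorph1 iota) -rmorphN; exact: loc_cst.
Qed.

Lemma mpowS_ind k (S : K -> Prop) : S 0 -> (forall f g, S f -> S g -> S (f + g)) ->
  (forall a b, mx a -> mpow k b -> S (a * b)) -> forall f, mpow k.+1 f -> S f.
Proof.
move=> S0 SD SM f [r [a [b [ab ->]]]]; elim/big_ind: _ => // i _.
exact: SM (ab i).1 (ab i).2.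
Qed.

Lemma mpowSM k a b : mx a -> mpow k b -> mpow k.+1 (a * b).
Proof. by exists 1%N, (fun=> a), (fun=> b); rewrite big_ord1. Qed.

Lemma mpow0 k : mpow k 0.
Proof.
case: k => [|k]; first by rewrite -(rmorph0 iota); exact: loc_cst.
by exists 0%N, (fun=> 0), (fun=> 0); split=> [[]|] //; rewrite big_ord0.
Qed.

Lemma mpow1 f : mpow 1 f <-> mx f.
Proof.
split; last first.
  move=> mf; rewrite -[f]mulr1; apply: mpowSM => //.
  by rewrite -(rmorph1 iota); exact: loc_cst.
elim/mpowS_ind => [||a b ma lb]; last by rewrite mulrC; apply: maxMl.
  by rewrite max_idealP -{1}(rmorph0 iota); exact: value_cst.
exact: maxD.
Qed.

Lemma mpowW k f : mpow k.+1 f -> mpow k f.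
Proof.
elim: k f => [|k IH] f; first exact: mpow_loc.
elim/mpowS_ind => [||a b ma lb]; [exact: mpow0|exact: mpowD|].
by apply: mpowSM => //; exact: IH.
Qed.

Lemma mpowM i k a b : mpow i a -> mpow k b -> mpow (i + k) (a * b).
Proof.
elim: i a => [|i IH] a; first exact: mpowMl.
move=> ha hb; elim/mpowS_ind: a / ha => [|f g hf hg|a c ma hc].
- by rewrite mul0r; exact: mpow0.
- by rewrite mulrDl; exact: mpowD.
- by rewrite -mulrA addSn; apply: mpowSM => //; exact: IH.
Qed.

Section Derivations.
Variable D : K -> K.
Hypothesis dD : derivation iota D.
Let DD : forall f g, D (f + g) = D f + D g. Proof. by case: dD. Qed.
Let DM : forall f g, D (f * g) = f * D g + g * D f. Proof. by case: dD. Qed.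
Let Dc : forall c, D (iota c) = 0. Proof. by case: dD. Qed.

Lemma derivation0 : D 0 = 0. Proof. by rewrite -{1}(rmorph0 iota) Dc. Qed.

Lemma derivation_div f g : g != 0 -> D (f / g) = (g * D f - f * D g) / (g * g).
Proof.
move=> g0; have := DM (f / g) g; rewrite divfK // => ->.
by field.
Qed.

(* The coordinate ratios generate the local ring up to localization. *)
Lemma derivation_local i0 : x i0 != 0 -> P 0 i0 != 0 ->
  (forall i, loc (D (x i / x i0))) -> forall f, loc f -> loc (D f).
Proof.
move=> xi0 Pi0 la f [d [F [G [Fh Gh G0 ->]]]].
pose a i := x i / x i0.
have axE (M : {mpoly C[N.+1]}) : M \is d.-homog -> mmap iota x M = x i0 ^+ d * mmap iota a M.
  move=> Mh; rewrite -(mmap_homog iota a (x i0) Mh); congr (mmap iota _ M); apply/funext => i.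
  by rewrite /a mulrC divfK.
have via i : value (a i) (P 0 i / P 0 i0).
  have := @value_form 1 ('X_i) ('X_i0); rewrite /= !mmapX !mmap1U !mevalXU !dhomogX /= !mdeg1.
  exact.
have lla i : loc (a i) by apply/localP; eexists; exact: via.
have la_form (M : {mpoly C[N.+1]}) : loc (mmap iota a M) /\ loc (D (mmap iota a M)).
  have l0 : loc 0 by rewrite -(rmorph0 iota); exact: loc_cst.
  have closedM g h : loc g /\ loc (D g) -> loc h /\ loc (D h) -> loc (g * h) /\ loc (D (g * h)).
    move=> [lg lDg] [lh lDh]; split; first exact: locM.
    by rewrite DM; apply: locD; apply: locM.
  have lc c : loc (iota c) /\ loc (D (iota c)) by rewrite Dc; split=> //; exact: loc_cst.
  rewrite /mmap; elim/big_ind: _ => [|g h [lg lDg] [lh lDh]|m _]; first by rewrite derivation0.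
    by rewrite DD; split; apply: locD.
  apply: (closedM) => //; rewrite /mmap1; elim/big_ind: _ => [|g h|i _]; last 1 first.
  - elim: (m i) => [|n IH]; first by rewrite expr0 -(rmorph1 iota).
    by rewrite exprS; apply: closedM => //; split; [exact: lla|exact: la].
  - by rewrite -(rmorph1 iota).
  - exact: closedM.
rewrite !axE //.
have Ga : mmap iota a G != 0 by have := form_neq0 Gh G0; rewrite axE // mulf_eq0 negb_or => /andP[].
have -> : x i0 ^+ d * mmap iota a F / (x i0 ^+ d * mmap iota a G) = mmap iota a F / mmap iota a G.
  by rewrite -mulf_div divff ?mul1r // expf_neq0.
rewrite derivation_div //.
have [lF lDF] := la_form F; have [lG lDG] := la_form G.
apply: locM; first by apply: locB; apply: locM.
have lV : loc (mmap iota a G)^-1.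
  exists d, ('X_i0 ^+ d), G; split=> //; first by rewrite -{2}[d]mul1n dhomogMn // dhomogX /= mdeg1.
  rewrite (axE G) // rmorphXn /= mmapX mmap1U; field.
  by rewrite Ga expf_neq0.
by rewrite invfM; apply: locM.
Qed.

Hypothesis lD : forall f, loc f -> loc (D f).

Lemma derivation_mpow k f : mpow k.+1 f -> mpow k (D f).
Proof.
elim: k f => [|k IH] f; first by move/mpow_loc; exact: lD.
elim/mpowS_ind => [|a b ha hb|a b ma lb]; first by rewrite derivation0; exact: mpow0.
  by rewrite DD; exact: mpowD.
rewrite DM; apply: mpowD; first by apply: mpowSM => //; exact: IH.
by rewrite mulrC; apply: mpowMl => //; exact: lD (max_local _).
Qed.

End Derivations.

End Values.

(** * Multiplicity detected by commuting derivations *)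

Section Multiplicity.
Variables (C : numClosedFieldType) (K : fieldType) (iota : {rmorphism C -> K}).
Variables (N : nat) (x : 'I_N.+1 -> K) (P : 'rV[C]_N.+1).
Hypothesis pP : point iota x P.
Variables (D1 D2 : K -> K) (y1 y2 : K).
Hypotheses (d1 : derivation iota D1) (d2 : derivation iota D2).
Hypothesis c12 : forall f, D1 (D2 f) = D2 (D1 f).
Hypotheses (D11 : D1 y1 = 1) (D12 : D1 y2 = 0) (D21 : D2 y1 = 0) (D22 : D2 y2 = 1).
Notation loc := (local_ring iota x P).
Notation mx := (max_ideal iota x P).
Notation mpow := (max_ideal_pow iota x P).
Notation value := (value iota x P).
Hypotheses (lD1 : forall f, loc f -> loc (D1 f)) (lD2 : forall f, loc f -> loc (D2 f)).
Hypotheses (ly1 : loc y1) (ly2 : loc y2).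
Hypothesis gens : exists u v, gen_max_ideal iota x P u v.

Let D1M f g : D1 (f * g) = f * D1 g + g * D1 f. Proof. by case: d1. Qed.
Let D2M f g : D2 (f * g) = f * D2 g + g * D2 f. Proof. by case: d2. Qed.
Let D1D f g : D1 (f + g) = D1 f + D1 g. Proof. by case: d1. Qed.
Let D2D f g : D2 (f + g) = D2 f + D2 g. Proof. by case: d2. Qed.

Let iota_char0 n : iota n.+1%:R != 0.
Proof. by rewrite fmorph_eq0 pnatr_eq0. Qed.

Lemma value_derivation D f g u : derivation iota D -> (forall f, loc f -> loc (D f)) ->
  loc f -> mx u -> g = f * u -> forall a b, value f a -> value (D u) b -> value (D g) (a * b).
Proof.
move=> [_ DM _] lD lf mu -> a b fa ub; rewrite DM -[a * b]addr0.
apply: (valueD pP); first exact: valueM.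
by apply/max_idealP; rewrite mulrC; apply: maxMl => //; exact: lD.
Qed.

(** Expand y1 - y1(P) and y2 - y2(P) in generators u, v. Applying the derivations and taking values
    at P shows that the coefficient matrix times a Jacobian is the identity; its determinant is a
    unit, so the two differences generate the maximal ideal as well. *)
Lemma local_coordinates : exists u1 u2, [/\ gen_max_ideal iota x P u1 u2,
  D1 u1 = 1, D1 u2 = 0, D2 u1 = 0 & D2 u2 = 1].
Proof.
have [c1 hc1] := (localP iota x P y1).1 ly1; have [c2 hc2] := (localP iota x P y2).1 ly2.
have DB D : derivation iota D -> forall f c, D (f - iota c) = D f.
  by move=> [DD _ Dc] f c; rewrite -rmorphN DD Dc addr0.
have m1 : mx (y1 - iota c1).
  by apply/max_idealP; rewrite -(subrr c1); apply: (valueB pP) => //; exact: value_cst.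
have m2 : mx (y2 - iota c2).
  by apply/max_idealP; rewrite -(subrr c2); apply: (valueB pP) => //; exact: value_cst.
exists (y1 - iota c1), (y2 - iota c2); split; rewrite ?DB //; split=> // f mf.
have [u [v [mu mv uv]]] := gens.
have [a [b [la lb e1]]] := uv _ m1; have [a' [b' [la' lb' e2]]] := uv _ m2.
have [A vA] := (localP iota x P a).1 la; have [B vB] := (localP iota x P b).1 lb.
have [A' vA'] := (localP iota x P a').1 la'; have [B' vB'] := (localP iota x P b').1 lb'.
have lu D (lD : forall f, loc f -> loc (D f)) w : mx w -> exists p, value (D w) p.
  by move=> mw; apply/localP/lD/max_local.
have [p hp] := lu _ lD1 _ mu; have [q hq] := lu _ lD1 _ mv.
have [p' hp'] := lu _ lD2 _ mu; have [q' hq'] := lu _ lD2 _ mv.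
have lin D (dD : derivation iota D) (lD : forall f, loc f -> loc (D f)) s t S T U V w c :
    loc s -> loc t -> value s S -> value t T -> value (D u) U -> value (D v) V ->
    w = s * u + t * v -> value (D w) c -> S * U + T * V = c.
  move=> ls lt vs vt vU vV ->; have [DD _ _] := dD; rewrite DD => vc.
  apply: (value_inj pP) vc; apply: (valueD pP).
    exact: (value_derivation dD lD ls mu erefl).
  exact: (value_derivation dD lD lt mv erefl).
have v1 : value 1 1 by rewrite -(rmorph1 iota); exact: value_cst.
have v0 : value 0 0 by rewrite -{1}(rmorph0 iota); exact: value_cst.
have E1 : A * p + B * q = 1
  by apply: (lin _ d1 lD1 _ _ _ _ _ _ _ _ la lb) e1 _ => //; rewrite DB // D11.
have E2 : A' * p + B' * q = 0
  by apply: (lin _ d1 lD1 _ _ _ _ _ _ _ _ la' lb') e2 _ => //; rewrite DB // D12.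
have E3 : A * p' + B * q' = 0
  by apply: (lin _ d2 lD2 _ _ _ _ _ _ _ _ la lb) e1 _ => //; rewrite DB // D21.
have E4 : A' * p' + B' * q' = 1
  by apply: (lin _ d2 lD2 _ _ _ _ _ _ _ _ la' lb') e2 _ => //; rewrite DB // D22.
have det : (A * B' - A' * B) * (p * q' - p' * q) = 1.
  rewrite -[RHS](_ : (A * p + B * q) * (A' * p' + B' * q') -
    (A * p' + B * q') * (A' * p + B' * q) = _).
    by ring.
  by rewrite E1 E2 E3 E4; ring.
pose w := a * b' - a' * b.
have vw : value w (A * B' - A' * B).
  by apply: (valueB pP); exact: valueM.
have w0 : A * B' - A' * B != 0 by apply: contra_eq_neq det => ->; rewrite mul0r eq_sym oner_eq0.
have vwV := valueV vw w0.
have lwV : loc w^-1 by apply/localP; eexists; exact: vwV.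
have wn0 : w != 0.
  apply: contraNneq w0 => w0; rewrite w0 in vw.
  by rewrite (value_inj pP vw v0).
have [s [t [ls lt ->]]] := uv _ mf.
exists ((s * b' - t * a') / w), ((t * a - s * b) / w); split.
- by apply: locM => //; apply: (locB pP); exact: locM.
- by apply: locM => //; apply: (locB pP); exact: locM.
- by rewrite e1 e2 /w; move: wn0; rewrite /w => wn0; field.
Qed.

(* The Euler operator [u1 D1 + u2 D2] acts on m^k / m^(k+1) as multiplication by k. *)
Lemma mpow_derivations k f : mx f -> mpow k (D1 f) -> mpow k (D2 f) -> mpow k.+1 f.
Proof.
have [u1 [u2 [[mu1 mu2 gu] D1u1 D1u2 D2u1 D2u2]]] := local_coordinates.
pose E f := u1 * D1 f + u2 * D2 f.
have EM g h : E (g * h) = g * E h + h * E g by rewrite /E D1M D2M; ring.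
have ED g h : E (g + h) = E g + E h by rewrite /E D1D D2D; ring.
have E0 : E 0 = 0 by rewrite /E (derivation0 d1) (derivation0 d2) !mulr0 addr0.
have mE h : loc h -> mpow 1 (E h).
  by move=> lh; apply: (mpowD pP); apply: mpowSM => //; [exact: lD1|exact: lD2].
have Em1 g : mx g -> mpow 2 (E g - g).
  move=> /gu[a [b [la lb ->]]].
  rewrite (_ : _ - _ = u1 * E a + u2 * E b); last first.
    by rewrite ED !EM [E u1]/E [E u2]/E D1u1 D2u1 D1u2 D2u2; ring.
  by apply: (mpowD pP); apply: mpowSM => //; exact: mE.
have Em i g : mpow i.+1 g -> mpow i.+2 (E g - i.+1%:R * g).
  elim: i g => [|i IH] g; first by move/(mpow1 pP)/Em1; rewrite mul1r.
  elim/mpowS_ind => [|g1 g2 h1 h2|a b ma hb].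
  - by rewrite E0 mulr0 subr0; exact: mpow0.
  - by rewrite ED mulrDr opprD addrACA; exact: (mpowD pP).
  rewrite (_ : _ - _ = a * (E b - i.+1%:R * b) + (E a - a) * b); last first.
    by rewrite EM -[i.+2%:R]natr1; ring.
  apply: (mpowD pP); first by apply: mpowSM => //; exact: IH.
  exact: (mpowM pP (i := 2)) (Em1 _ ma) hb.
move=> mf h1 h2; suff : forall i, (i <= k)%N -> mpow i.+1 f by apply.
(* Bootstrapping: f in m^(i+1) puts E f - (i+1) f in m^(i+2); the hypotheses on the derivatives put
   E f there, hence also (i+1) f. *)
elim=> [|i IH] ik; first exact/(mpow1 pP).
have Wk g j : (j <= k)%N -> mpow k g -> mpow j g.
  by move=> /subnK <-; elim: (k - j)%N => // n IHn; rewrite addSn => /(mpowW pP).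
have hE : mpow i.+2 (E f) by apply: (mpowD pP); apply: mpowSM => //; exact: Wk.
have := mpowB pP hE (Em _ _ (IH (ltnW ik))); rewrite subKr => h.
rewrite -[f](mulKf (iota_char0 i)) rmorph_nat.
apply: mpowMl => //; rewrite -(rmorph_nat iota) -fmorphV.
exact: loc_cst.
Qed.

Lemma mpow_monomials k f : mpow k f <->
  loc f /\ forall i j, (i + j < k)%N -> mx (iter i D1 (iter j D2 f)).
Proof.
have iterC i g : iter i D1 (D2 g) = D2 (iter i D1 g).
  by elim: i => //= i ->.
elim: k f => [|k IH] f; first by split=> [|[]].
split=> [h|[lf h]].
  split=> [|i j]; first exact: (mpow_loc pP h).
  case: j => [|j] /=.
    rewrite addn0; case: i => [_|i ik] /=.
      by apply/(mpow1 pP); elim: (k) h => // n IHn /(mpowW pP).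
    rewrite -iterS iterSr; apply: (((IH (D1 f)).1 _).2 i 0%N); last by rewrite addn0.
    exact: (derivation_mpow pP d1).
  rewrite -iterS iterSr addnS ltnS => ijk; apply: (((IH (D2 f)).1 _).2 i j) => //.
  exact: (derivation_mpow pP d2).
apply: mpow_derivations; first exact: (h 0%N 0%N).
  apply/IH; split=> [|i j ij]; first exact: lD1.
  have -> : iter i D1 (iter j D2 (D1 f)) = iter i.+1 D1 (iter j D2 f).
    by rewrite iterSr; congr iter; elim: j {ij} => //= j ->; rewrite c12.
  exact: h.
apply/IH; split=> [|i j ij]; first exact: lD2.
by rewrite -iterSr; apply: h; rewrite addnS.
Qed.

End Multiplicity.

Lemma relation_rmorphism (A B : comNzRingType) (Rel : A -> B -> Prop) :
  (forall a, exists b, Rel a b) -> (forall a b c, Rel a b -> Rel a c -> b = c) ->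
  Rel 1 1 -> (forall a b a' b', Rel a b -> Rel a' b' -> Rel (a - a') (b - b')) ->
  (forall a b a' b', Rel a b -> Rel a' b' -> Rel (a * a') (b * b')) ->
  exists g : {rmorphism A -> B}, forall a, Rel a (g a).
Proof.
move=> /choice[g hg] inj R1 RB RM.
have gB : {morph g : a b / a - b} by move=> a b; apply: inj (hg _) _; apply: RB.
have gM : monoid_morphism g.
  by split=> [|a b]; [exact: inj (hg _) R1|apply: inj (hg _) _; apply: RM].
by exists (HB.pack_for {rmorphism A -> B} g (GRing.isZmodMorphism.Build _ _ g gB)
  (GRing.isMonoidMorphism.Build _ _ g gM)).
Qed.

Section OpenSets.
Variables (C : numClosedFieldType) (K : fieldType) (iota : {rmorphism C -> K}).
Variables (N : nat) (x : 'I_N.+1 -> K).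
Hypotheses (gx : generic_point iota x) (smooth : smooth_surface iota x).

Lemma regular_form (s : seq K) : exists d (B : {mpoly C[N.+1]}),
  [/\ B \is d.-homog, mmap iota x B != 0 & forall P, point iota x P -> B.@[P 0] != 0 ->
    forall f, f \in s -> local_ring iota x P f].
Proof.
elim: s => [|f s [d [B [Bh Bx hB]]]].
  by exists 0%N, 1; rewrite dhomog1 rmorph1 oner_eq0; split.
have [d' [F [G [Fh Gh Gx fE]]]] := gx.2 f.
exists (d + d')%N, (B * G); split=> [||P pP]; first exact: dhomogM.
  by rewrite rmorphM mulf_neq0.
rewrite mevalM mulf_eq0 negb_or => /andP[B0 G0] g; rewrite inE => /orP[/eqP->|]; last exact: hB.
by exists d', F, G.
Qed.

(** Off the zeros of [B] the transcendence basis and the derivatives of the coordinate ratios are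
    regular. The ratios generate the local rings up to localization, so the derivations preserve
    these rings and detect multiplicities. *)
Lemma chart : exists d (B : {mpoly C[N.+1]}) (D1 D2 : K -> K),
  [/\ B \is d.-homog /\ mmap iota x B != 0, derivation iota D1 /\ derivation iota D2,
      forall f, D1 (D2 f) = D2 (D1 f),
      forall P, point iota x P -> B.@[P 0] != 0 ->
        forall f, local_ring iota x P f ->
          local_ring iota x P (D1 f) /\ local_ring iota x P (D2 f) &
      forall P, point iota x P -> B.@[P 0] != 0 ->
        forall k f, max_ideal_pow iota x P k f <-> local_ring iota x P f /\
          forall i j, (i + j < k)%N -> max_ideal iota x P (iter i D1 (iter j D2 f))].
Proof.
have [tr gens] := smooth; have [y [D [dD cD Dy]]] := dual_derivations tr.
have [[i0 xi0] _] := gx.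
pose D1 := D ord0; pose D2 := D (lift ord0 ord0).
have [d [B [Bh Bx hB]]] := regular_form
  ([:: y ord0; y (lift ord0 ord0)] ++ [seq D1 (x i / x i0) | i <- enum 'I_N.+1]
    ++ [seq D2 (x i / x i0) | i <- enum 'I_N.+1]).
exists (d + 1)%N, (B * 'X_i0), D1, D2.
have dl : forall P, point iota x P -> (B * 'X_i0).@[P 0] != 0 ->
    forall f, local_ring iota x P f -> local_ring iota x P (D1 f) /\ local_ring iota x P (D2 f).
  move=> P pP; rewrite mevalM mevalXU mulf_eq0 negb_or => /andP[BP Pi0] f lf.
  split; apply: (derivation_local pP (dD _) xi0 Pi0) => // i; apply: hB => //;
    rewrite !mem_cat; apply/orP; right; apply/orP; [left|right];
    by apply: map_f; rewrite mem_enum.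
split=> //.
- by rewrite dhomogM ?dhomogX /= ?mdeg1 // rmorphM /= mmapX mmap1U mulf_neq0.
- by split; apply: dD.
- by move=> f; apply: cD.
move=> P pP BP; 
  have [lD1 lD2] := (fun f lf => (dl P pP BP f lf).1, fun f lf => (dl P pP BP f lf).2).
move: BP; rewrite mevalM mevalXU mulf_eq0 negb_or => /andP[BP _] k f.
apply: (mpow_monomials pP (D1 := D1) (D2 := D2) (y1 := y ord0) (y2 := y (lift ord0 ord0))) => //.
all: try exact: dD.
all: try (by rewrite /D1 /D2 Dy).
all: try (by move=> *; apply: cD).
all: try (by apply: hB => //; rewrite !inE eqxx ?orbT).
exact: gens.
Qed.

Section Ring.
Variables (d : nat) (B : {mpoly C[N.+1]}).
Hypotheses (Bh : B \is d.-homog) (Bx : mmap iota x B != 0).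

Definition open_set := {P : 'rV[C]_N.+1 | point iota x P /\ B.@[P 0] != 0}.

(** Provides the abstract data [R], [ev], [cst] of the interpolation argument: functions regular
    wherever [B] is nonzero, with their values and constants. *)
Lemma regular_ring : exists (R : comNzRingType) (j : {rmorphism R -> K})
    (ev : open_set -> {rmorphism R -> C}) (cst : {rmorphism C -> R}),
  [/\ injective j,
      forall a, (forall P : open_set, local_ring iota x (sval P) a) <-> exists z, a = j z,
      forall c, j (cst c) = iota c &
      forall P z, value iota x (sval P) (j z) (ev P z)].
Proof.
have [|a b la lb P|a b la lb P|R [j [jinj jP]]] :=
    @subring_type K (fun a => forall P : open_set, local_ring iota x (sval P) a).
- by move=> P; rewrite -(rmorph1 iota); exact: loc_cst.
- exact: (locB (svalP P).1).
- exact: locM.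
have lj z (P : open_set) : local_ring iota x (sval P) (j z) by apply: ((jP _).2 _ P); exists z.
have /choice[ev hev] : forall P : open_set, exists g : {rmorphism R -> C},
    forall z, value iota x (sval P) (j z) (g z).
  move=> P; have pP := (svalP P).1.
  apply: (@relation_rmorphism R C (fun z => value iota x (sval P) (j z))) => [z|z b c||a b a' b'|a b a' b'].
  - exact/localP/lj.
  - exact: (value_inj pP).
  - by rewrite rmorph1 -(rmorph1 iota); exact: value_cst.
  - by rewrite rmorphB; exact: (valueB pP).
  - by rewrite rmorphM; exact: valueM.
have [|c z z' h h'||c z c' z' h h'|c z c' z' h h'|cst hcst] :=
    @relation_rmorphism C R (fun c z => iota c = j z).
- by move=> c; apply/jP => P; exact: loc_cst.
- by apply: jinj; rewrite -h.
- by rewrite !rmorph1.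
- by rewrite !rmorphB h h'.
- by rewrite !rmorphM h h'.
by exists R, j, ev, cst; split.
Qed.

End Ring.
End OpenSets.

(** * Linear systems *)

(** Multihomogeneity speaks of values only, so [F] is the component of the right degree, and scaling
    by t shows that it has the same values. *)
Lemma homog_of_multihomogeneous (C : numClosedFieldType) N (G : {mpoly C[1 * N.+1]}) :
  multihomogeneous G -> exists e (F : {mpoly C[N.+1]}), F \is e.-homog /\
    forall v : 'rV_N.+1, F.@[v 0] = G.@[mxvec v 0].
Proof.
move=> [e hG]; pose h := mxvec (\row_j 'X_j : 'rV[{mpoly C[N.+1]}]_N.+1) 0.
pose g := mmap (@mpolyC N.+1 C) h G.
have gE (v : 'rV_N.+1) : g.@[v 0] = G.@[mxvec v 0].
  apply: (@rmorph_mmap _ _ _ _ (@mpolyC N.+1 C) h (meval (v 0)) idfun) => [a|k].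
    exact: mevalC.
  by case/mxvec_indexP: k => i j; rewrite /h !mxvecE !mxE /= mevalXU ord1.
exists (e ord0), (pihomog mdeg (e ord0) g); split=> [|v]; first exact: pihomogP.
rewrite -gE; pose k := maxn (msize g) (e ord0).+1.
have ek : (e ord0 < k)%N by rewrite leq_max leqnn orbT.
(* This is g(t v) as a polynomial in t, its coefficients being the values of the graded
   components. *)
pose p := \poly_(l < k) (pihomog mdeg l g).@[v 0].
suff : p - g.@[v 0] *: 'X^(e ord0) = 0.
  move/polyP/(_ (e ord0)); rewrite coefB coefZ coefXn eqxx mulr1 coef_poly ek coef0.
  by move/eqP; rewrite subr_eq0 => /eqP.
apply/eqP; apply: contraT => /exists_nonroot[t]; rewrite hornerD hornerN hornerZ hornerXn.
rewrite (_ : p.[t] = g.@[(t *: v) 0]); last first.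
  rewrite [in RHS](@pihomog_partitionE _ _ mdeg k g) ?leq_maxl // raddf_sum horner_poly /=.
  apply: eq_bigr => l _; rewrite mulrC -(meval_homog _ _ (pihomogP mdeg l g)).
  by apply: meval_eq => i; rewrite mxE.
rewrite !gE.
have := hG (fun=> t) v; rewrite big_ord1 => hv.
rewrite (_ : t *: v = \matrix_(i, j) (t * v i j)); last by apply/matrixP => i j; rewrite !mxE.
by rewrite hv mulrC subrr eqxx.
Qed.

Section Dimension.
Variables (C : numClosedFieldType) (K : fieldType) (iota : {rmorphism C -> K}).

Lemma dim_eq_leq V r r' : dim_eq iota V r -> dim_eq iota V r' -> (r' <= r)%N.
Proof.
move=> [b [bV bi]] [b' [bV' bi']].
have /choice[A hA] : forall i, exists c : 'I_r -> C, b' i = \sum_(l < r) iota (c l) * b l.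
  move=> i; apply/bV/bV'; exists (fun l => (l == i)%:R).
  rewrite (bigD1 i) //= eqxx rmorph1 mul1r big1 ?addr0 // => l /negPf ->.
  by rewrite rmorph0 mul0r.
pose M := \matrix_(i, l) A i l.
suff /eqP <- : row_free M by apply: rank_leq_col.
rewrite -kermx_eq0; apply/eqP/row_matrixP => k; rewrite row0.
have kM : row k (kermx M) *m M = 0 by apply/sub_kermxP; exact: row_sub.
apply/rowP => i; rewrite mxE [RHS]mxE.
have := bi' (fun i => kermx M k i) _ i; apply.
transitivity (\sum_l iota ((row k (kermx M) *m M) 0 l) * b l); last first.
  by rewrite kM big1 // => l _; rewrite mxE rmorph0 mul0r.
under eq_bigr do rewrite hA mulr_sumr.
rewrite exchange_big; apply: eq_bigr => l _; rewrite mxE rmorph_sum mulr_suml.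
by apply: eq_bigr => i' _; rewrite !mxE rmorphM mulrA.
Qed.

Lemma dim_eq_uniq V r r' : dim_eq iota V r -> dim_eq iota V r' -> r = r'.
Proof. by move=> h h'; apply/eqP; rewrite eqn_leq !(dim_eq_leq (V := V)). Qed.

Lemma dim_eq_kernel r (b : 'I_r -> K) p (M : 'M[C]_(p, r)) :
  (forall c : 'I_r -> C, \sum_(i < r) iota (c i) * b i = 0 -> forall i, c i = 0) ->
  dim_eq iota (fun f => exists c : 'cV_r,
    f = \sum_i iota (c i 0) * b i /\ M *m c = 0) (r - \rank M).
Proof.
move=> bi; rewrite -mxrank_tr -mxrank_ker; set W := kermx M^T.
pose B := row_base W.
have sumB (c : 'rV_(\rank W)) : \sum_i iota (c 0 i) * (\sum_l iota (B i l) * b l)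
    = \sum_l iota ((c *m B) 0 l) * b l.
  under eq_bigr do rewrite mulr_sumr.
  rewrite exchange_big; apply: eq_bigr => l _; rewrite mxE rmorph_sum mulr_suml.
  by apply: eq_bigr => i' _; rewrite !mxE rmorphM mulrA.
exists (fun i => \sum_l iota (B i l) * b l); split=> [f|c c0].
  split=> [[c [-> Mc]]|[c ->]].
    have : (c^T <= B)%MS.
      by rewrite eq_row_base; apply/sub_kermxP; rewrite -trmx_mul Mc trmx0.
    case/submxP => a ac; exists (a 0); rewrite sumB -ac.
    by apply: eq_bigr => l _; rewrite mxE.
  exists ((\row_i c i) *m B)^T; split.
    rewrite (eq_bigr (fun l => iota (((\row_i c i) *m B) 0 l) * b l)).
      by rewrite -sumB; apply: eq_bigr => i _; rewrite mxE.
    by move=> l _; rewrite mxE.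
  apply: trmx_inj; rewrite trmx_mul trmxK trmx0; apply/sub_kermxP.
  by rewrite (submx_trans (submxMl _ _)) // eq_row_base.
have : (\row_i c i) *m B = 0.
  apply/rowP => l; rewrite [RHS]mxE; apply: (bi (fun l => ((\row_i c i) *m B) 0 l)).
  by rewrite -sumB -[RHS]c0; apply: eq_bigr => i _; rewrite mxE.
move/eqP; rewrite mulmx_free_eq0 ?row_base_free // => /eqP/rowP h i.
by have := h i; rewrite !mxE.
Qed.

End Dimension.

Section Jets.
Variables (C : numClosedFieldType) (K : fieldType) (iota : {rmorphism C -> K}).
Variables (N : nat) (x : 'I_N.+1 -> K).

Lemma local_unit_exp P a n : point iota x P -> local_unit iota x P a ->
  local_unit iota x P (a ^+ n).
Proof.
move=> pP [a0 la lV]; split; first exact: expf_neq0.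
  by elim: n => [|n IH]; [rewrite expr0 -(rmorph1 iota); exact: loc_cst|rewrite exprS; exact: locM].
rewrite -exprVn; elim: n => [|n IH]; first by rewrite expr0 -(rmorph1 iota); exact: loc_cst.
by rewrite exprS; exact: locM.
Qed.

Lemma mpow_unit P k a f : local_unit iota x P a ->
  max_ideal_pow iota x P k (f * a) <-> max_ideal_pow iota x P k f.
Proof.
move=> [a0 la lV]; split=> h; last by rewrite mulrC; exact: mpowMl.
by rewrite -(mulfK a0 f) mulrC; exact: mpowMl.
Qed.

Lemma jet_sum (R : comNzRingType) (cst : {rmorphism C -> R}) D1 D2 a r (c : 'I_r -> C) f :
  is_der cst D1 -> is_der cst D2 ->
  mon D1 D2 a (\sum_l cst (c l) * f l) = \sum_l cst (c l) * mon D1 D2 a (f l).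
Proof.
move=> d1 d2.
have it D n g : is_der cst D ->
    iter n D (\sum_l cst (c l) * g l) = \sum_l cst (c l) * iter n D (g l).
  move=> dD; have it0 : iter n D 0 = 0 by elim: n => //= n ->; exact: der0 dD.
  rewrite (big_morph (iter n D) (fun u v => iter_add n u v dD) it0).
  by apply: eq_bigr => l _; rewrite (iter_cstM _ _ _ dD).
by rewrite /mon !it.
Qed.

(** The bridge to the abstract setting: near one point [P0] a single local equation of dH
    trivializes the line bundle, the sections become elements [f] of a ring of regular functions,
    and multiplicity m becomes linear equations on jets. *)
Lemma sections_jets H d r (b : 'I_r -> K) :
  generic_point iota x -> smooth_surface iota x -> cartier iota x H ->
  (forall l, global_section iota x (div_mul d%:Z H) (b l)) ->
  exists e (B : {mpoly C[N.+1]}) (R : comNzRingType)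
    (ev : open_set iota x B -> {rmorphism R -> C}) (cst : {rmorphism C -> R})
    (D1 D2 : R -> R) (f : 'I_r -> R) (j : R -> K),
  [/\ B \is e.-homog /\ mmap iota x B != 0,
      [/\ forall P c, ev P (cst c) = c, is_der cst D1, is_der cst D2 & commuting D1 D2],
      forall g h, g != 0 -> h != 0 -> exists P, ev P g != 0 /\ ev P h != 0,
      forall P z, value iota x (sval P) (j z) (ev P z) &
      forall P m (c : 'cV_r),
        max_ideal_pow iota x (sval P) m
          ((\sum_l iota (c l 0) * b l) * div_mul d%:Z H (sval P)) <->
        map_mx (ev P) (jet_mx f D1 D2 (tri m)) *m c = 0].
Proof.
move=> gx smooth cH gb; pose E := div_mul d%:Z H; have tr := smooth.1.
have [dB [B1 [D1 [D2 [[Bh Bx] [d1 d2] c12 lD mult]]]]] := chart gx smooth.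
have [P0 [pP0 _]] : exists P : 'rV[C]_N.+1, point iota x P /\ (1 : {mpoly C[N.+1]}).@[P 0] != 0.
  by apply: (exists_point tr (dhomog1 _ _) _ gx.1); rewrite rmorph1 oner_eq0.
have [HP0 [dG [G [Gh G0 hG]]]] := cH _ pP0.
pose B := B1 * G; have Bhom : B \is (dB + dG).-homog by exact: dhomogM.
have BGx : mmap iota x B != 0 by rewrite rmorphM mulf_neq0 // (form_neq0 pP0 Gh).
have [R [j [ev [cst [jinj jP jc jv]]]]] := @regular_ring _ _ iota _ x B.
have UB (P : open_set iota x B) : B1.@[sval P 0] != 0 /\ G.@[sval P 0] != 0.
  by have [_] := svalP P; rewrite mevalM mulf_eq0 negb_or => /andP[].
have pU (P : open_set iota x B) := (svalP P).1.
have E0 : E P0 != 0 by rewrite /E /div_mul expfz_neq0.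
have uE (P : open_set iota x B) : local_unit iota x (sval P) (E (sval P) / E P0).
  rewrite /E /div_mul -!exprnP -expr_div_n; apply: local_unit_exp => //.
  by apply: hG => //; exact: (UB P).2.
have uEV (P : open_set iota x B) : local_unit iota x (sval P) (E P0 / E (sval P)).
  by rewrite -invf_div; have [u0 u1 u2] := uE P; split; rewrite ?invr_eq0 ?invrK.
have En0 (P : open_set iota x B) : E (sval P) != 0.
  by have [+ _ _] := uE P; rewrite mulf_eq0 negb_or => /andP[].
have lj z (P : open_set iota x B) : local_ring iota x (sval P) (j z).
  by apply: ((jP _).2 _ P); exists z.
have /choice[D1' hD1] : forall z, exists z', D1 (j z) = j z'.
  move=> z; apply/jP => P; exact: (lD _ (pU P) (UB P).1 _ (lj z P)).1.
have /choice[D2' hD2] : forall z, exists z', D2 (j z) = j z'.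
  move=> z; apply/jP => P; exact: (lD _ (pU P) (UB P).1 _ (lj z P)).2.
have /choice[f hf] : forall l, exists z, b l * E P0 = j z.
  move=> l; apply/jP => P.
  rewrite (_ : b l * E P0 = b l * E (sval P) * (E P0 / E (sval P))).
    by apply: locM; [exact: gb|have [] := uEV P].
  by rewrite -mulrA [E (sval P) * _]mulrC divfK.
have is_d D D' : derivation iota D -> (forall z, D (j z) = j (D' z)) -> is_der cst D'.
  move=> [DD DM Dc] hD; split=> [z z'|z z'|c]; apply: jinj; rewrite -hD.
  - by rewrite !rmorphD DD !hD.
  - by rewrite rmorphD !rmorphM DM !hD.
  - by rewrite jc Dc rmorph0.
have dd1 := is_d _ _ d1 hD1; have dd2 := is_d _ _ d2 hD2.
exists (dB + dG)%N, B, R, ev, cst, D1', D2', f, j; split=> //.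
- split=> // [P c|z]; last by apply: jinj; rewrite -!hD1 -!hD2 -hD1 c12.
  by apply: (value_inj (pU P) (jv P _)); rewrite jc; exact: value_cst.
- move=> g h g0 h0.
  have jn0 z : z != 0 -> j z != 0.
    by move=> z0; apply: contraNneq z0 => jz; apply/eqP/jinj; rewrite jz rmorph0.
  have [dg [F [F' [Fh Fh' F'x gE]]]] := gx.2 (j g).
  have [dh [L [L' [Lh Lh' L'x hE]]]] := gx.2 (j h).
  have := jn0 _ g0; rewrite gE mulf_eq0 negb_or => /andP[Fx _].
  have := jn0 _ h0; rewrite hE mulf_eq0 negb_or => /andP[Lx _].
  (* Irreducibility: a product of forms nonzero at the generic point is nonzero at some closed
     point. *)
  have hom : F * F' * (L * L') * B \is (dg + dg + (dh + dh) + (dB + dG)).-homog.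
    by apply: dhomogM => //; apply: dhomogM; apply: dhomogM.
  have [|P [pP]] := exists_point tr hom _ gx.1; first
    by rewrite !rmorphM /= ?mulf_neq0 // (form_neq0 pP0 Gh).
  rewrite !mevalM !mulf_eq0 !negb_or -!andbA => /and5P[FP F'P LP L'P /andP[B1P GP]].
  have BP : B.@[P 0] != 0 by rewrite mevalM mulf_neq0.
  exists (exist _ P (conj pP BP)); split.
    have := value_inj pP (jv (exist _ P (conj pP BP)) g); rewrite gE.
    move=> /(_ _ (value_form iota x Fh Fh' F'P)) ->.
    by rewrite mulf_neq0 ?invr_eq0.
  have := value_inj pP (jv (exist _ P (conj pP BP)) h); rewrite hE.
  move=> /(_ _ (value_form iota x Lh Lh' L'P)) ->.
  by rewrite mulf_neq0 ?invr_eq0.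
move=> P m c; pose s := \sum_l cst (c l 0) * f l.
have sE : (\sum_l iota (c l 0) * b l) * div_mul d%:Z H (sval P) = j s * (E (sval P) / E P0).
  have -> : j s = (\sum_l iota (c l 0) * b l) * E P0.
    rewrite rmorph_sum mulr_suml; apply: eq_bigr => l _.
    by rewrite rmorphM /= jc -hf mulrA.
  by rewrite -mulrA [E P0 * _]mulrC divfK.
rewrite sE; apply: (iff_trans (mpow_unit _ _ (uE P))).
apply: (iff_trans (mult _ (pU P) (UB P).1 _ _)).
have ji D D' z k : (forall z, D (j z) = j (D' z)) -> iter k D (j z) = j (iter k D' z).
  by move=> hD; elim: k => //= k ->.
have mE a : max_ideal iota x (sval P) (iter a.1 D1 (iter a.2 D2 (j s))) <->
    \sum_l ev P (mon D1' D2' a (f l)) * c l 0 = 0.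
  rewrite (ji _ _ _ _ hD2) (ji _ _ _ _ hD1) -/(mon D1' D2' a s) (jet_sum _ _ _ dd1 dd2).
  set z := \sum_l _; have -> : \sum_l ev P (mon D1' D2' a (f l)) * c l 0 = ev P z.
    rewrite rmorph_sum; apply: eq_bigr => l _; rewrite rmorphM mulrC; congr (_ * _).
    by apply: (value_inj (pU P) (value_cst _ _ _ _)); rewrite -jc.
  split=> [/max_idealP h|h]; first exact: (value_inj (pU P)) (jv P z) h.
  by apply/max_idealP; have := jv P z; rewrite h.
split=> [[_ h]|h].
  apply/matrixP => i k; rewrite [k]ord1 !mxE.
  have [a aE] : exists a, a = nth (0, 0)%N (tri m) i by eexists.
  have am : a \in tri m by rewrite aE mem_nth.
  transitivity (\sum_l ev P (mon D1' D2' a (f l)) * c l 0).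
    by apply: eq_bigr => l _; rewrite !mxE aE.
  by apply/mE/h; rewrite -mem_tri -surjective_pairing.
split=> [|i k ik]; first exact: lj.
apply: (mE (i, k)).2; have am : ((i, k) \in tri m) by rewrite mem_tri.
have := am; rewrite -index_mem => im.
have := congr1 (fun M : 'cV_(size (tri m)) => M (Ordinal im) 0) h.
rewrite !mxE => jh; rewrite -[RHS]jh.
by apply: eq_bigr => l _; rewrite !mxE nth_index.
Qed.

End Jets.

Section Slots.
Variables (C : numClosedFieldType) (n N : nat).

Definition slot (i : 'I_n) (F : {mpoly C[N.+1]}) : {mpoly C[n * N.+1]} :=
  mmap (@mpolyC _ C) (fun j => 'X_(mxvec_index i j)) F.

Lemma slotE i F (A : 'M_(n, N.+1)) : (slot i F).@[mxvec A 0] = F.@[(row i A) 0].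
Proof.
apply: (@rmorph_mmap _ _ _ _ (@mpolyC _ C) _ (meval (mxvec A 0)) idfun) => [a|j].
  exact: mevalC.
by rewrite /= mevalXU mxvecE mxE.
Qed.

Lemma slot_homog e i F (t : 'I_n -> C) (A : 'M_(n, N.+1)) : F \is e.-homog ->
  (slot i F).@[mxvec (\matrix_(i, j) (t i * A i j)) 0] = t i ^+ e * (slot i F).@[mxvec A 0].
Proof.
move=> Fh; rewrite !slotE -(meval_homog _ _ Fh).
by apply: meval_eq => j; rewrite !mxE.
Qed.

End Slots.

(** * Dimension of the linear systems and general position *)

Section MainTheorem.
Variables (C : numClosedFieldType) (K : fieldType) (iota : {rmorphism C -> K}).
Variables (N : nat) (x : 'I_N.+1 -> K).

Lemma common_denominator P (s : seq K) : (forall f, f \in s -> local_ring iota x P f) ->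
  point iota x P ->
  exists e (G : {mpoly C[N.+1]}), [/\ G \is e.-homog, G.@[P 0] != 0 &
    forall f, f \in s -> exists F, F \is e.-homog /\ f = mmap iota x F / mmap iota x G].
Proof.
move=> + pP; elim: s => [|f s IH] ls; first by exists 0%N, 1; rewrite dhomog1 meval1 oner_eq0.
have [|e [G [Gh G0 hG]]] := IH; first by move=> g gs; apply: ls; rewrite inE gs orbT.
have [e' [F [G' [Fh Gh' G0' fE]]]] := ls f (mem_head _ _).
exists (e + e')%N, (G * G'); split; rewrite ?dhomogM ?mevalM ?mulf_neq0 // => g.
have Gx := form_neq0 pP Gh G0; have Gx' := form_neq0 pP Gh' G0'.
rewrite inE => /orP[/eqP->|/hG[L [Lh ->]]].
  exists (G * F); rewrite dhomogM // !rmorphM /= fE; split=> //.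
  by field; rewrite Gx Gx'.
exists (L * G'); rewrite dhomogM // !rmorphM /=; split=> //.
by field; rewrite Gx Gx'.
Qed.

Lemma dim_eq_ext (V W : K -> Prop) r : (forall f, V f <-> W f) ->
  dim_eq iota V r -> dim_eq iota W r.
Proof. by move=> VW [b [bV bi]]; exists b; split=> // f; rewrite -VW. Qed.

Section Linear.
Variables (H : 'rV[C]_N.+1 -> K) (d r : nat) (b : 'I_r -> K).
Hypothesis bV : forall f, global_section iota x (div_mul d%:Z H) f <->
  exists c : 'I_r -> C, f = \sum_i iota (c i) * b i.
Hypothesis bi : forall c : 'I_r -> C,
  \sum_(i < r) iota (c i) * b i = 0 -> forall i, c i = 0.
Variables (B : {mpoly C[N.+1]}) (R : comNzRingType).
Variables (ev : open_set iota x B -> {rmorphism R -> C}) (D1 D2 : R -> R) (f : 'I_r -> R).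
Hypothesis jets : forall P m (c : 'cV_r), max_ideal_pow iota x (sval P) m
    ((\sum_l iota (c l 0) * b l) * div_mul d%:Z H (sval P)) <->
  map_mx (ev P) (jet_mx f D1 D2 (tri m)) *m c = 0.

Definition stack m n (o : 'I_n -> open_set iota x B) :
    'M[C]_(#|{: 'I_n * 'I_(size (tri m))}|, r) :=
  \matrix_(k, l) map_mx (ev (o (enum_val k).1)) (jet_mx f D1 D2 (tri m)) (enum_val k).2 l.

Lemma row_stack m n (o : 'I_n -> open_set iota x B) i a :
  row (enum_rank (i, a)) (stack m o) = row a (map_mx (ev (o i)) (jet_mx f D1 D2 (tri m))).
Proof. by apply/rowP => l; rewrite !mxE enum_rankK. Qed.

Lemma rank_stack m n (o : 'I_n -> open_set iota x B) :
  \rank (stack m o) = \rank (fat_span ev D1 D2 f m [seq o i | i <- enum 'I_n]).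
Proof.
rewrite /fat_span big_map enumT -/(index_enum _).
apply/eqP; rewrite eqn_leq; apply/andP; split; apply: mxrankS.
  apply/row_subP => k; rewrite -(enum_valK k); case: (enum_val k) => i a; rewrite row_stack.
  apply: (submx_trans (row_sub _ _)); apply: (sumsmx_sup i) => //.
  by rewrite genmxE.
apply/sumsmx_subP => i _; rewrite genmxE; apply/row_subP => a.
by rewrite -row_stack row_sub.
Qed.

Lemma dim_linear_system m n (Q : 'M_(n, N.+1)) (o : 'I_n -> open_set iota x B) :
  (forall i, sval (o i) = row i Q) ->
  dim_eq iota (linear_system iota x (div_mul d%:Z H) Q (fun=> m)) (r - \rank (stack m o)).
Proof.
move=> oQ; apply: dim_eq_ext (dim_eq_kernel (stack m o) bi) => g.
have stP (c : 'cV_r) : stack m o *m c = 0 <->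
    forall i, map_mx (ev (o i)) (jet_mx f D1 D2 (tri m)) *m c = 0.
  split=> [h i|h]; apply/row_matrixP => k.
    by rewrite row_mul -row_stack -row_mul h !row0.
  rewrite -(enum_valK k); case: (enum_val k) => i a.
  by rewrite row_mul row_stack -row_mul h !row0.
split=> [[c [-> /stP h]]|[/bV[c ->] h]].
  split=> [|i]; first by apply/bV; exists (fun i => c i 0).
  by rewrite -oQ; apply/jets.
exists (\col_i c i); split; first by apply: eq_bigr => l _; rewrite mxE.
apply/stP => i; apply/jets; rewrite oQ; under eq_bigr do rewrite mxE.
exact: h.
Qed.

End Linear.

Lemma non_special_4_9 H gamma d :
  generic_point iota x -> smooth_surface iota x -> cartier iota x H ->
  (forall mu : nat, non_special iota x H gamma d (fun _ : 'I_1 => mu)) ->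
  forall m u w : nat,
    non_special iota x H gamma d (fun _ : 'I_(4 ^ u * 9 ^ w)%N => m).
Proof.
move=> gx smooth cH Hmu m u w; have tr := smooth.1.
pose A := (gamma * d%:Z ^+ 2 %/ 2)%Z.
have expE n k : expected_dim gamma d (fun _ : 'I_n => k) =
    Order.max (A + 1 - (n * size (tri k))%N%:Z) (- 1).
  by rewrite /expected_dim /virtual_dim sum_nat_const card_ord size_tri.
(* Multiplicity 0 imposes no condition, so this case of the hypothesis yields the number [r] of
   sections. *)
have [r [[b [bV bi]] rE]] : exists r, dim_eq iota (global_section iota x (div_mul d%:Z H)) r /\
    r%:Z - 1 = Order.max (A + 1) (- 1).
  have [G [_ [Q [pQ GQ]] /(_ Q pQ GQ)[r [dr rE]]]] := Hmu 0%N; exists r.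
  rewrite rE expE muln0 subr0; split=> //; apply: dim_eq_ext dr => g.
  by split=> [[]//|gg]; split=> // i; apply: gg.
have gb l : global_section iota x (div_mul d%:Z H) (b l).
  apply/bV; exists (fun i => (i == l)%:R).
  rewrite (bigD1 l) //= eqxx rmorph1 mul1r big1 ?addr0 // => i /negPf ->.
  by rewrite rmorph0 mul0r.
have [e [B [R [ev [cst [D1 [D2 [f [j [[Bh Bx] [ev_cst d1 d2 c12] irr jv jets]]]]]]]]]] :=
  sections_jets gx smooth cH gb.
have dimE := dim_linear_system bV bi jets.
(* Some point is both general for the hypothesis and in the chart; there the dimension forces the
   rank. *)
have ind1 : independent ev D1 D2 f 1.
  move=> k; have [G [Gm [Q0 [pQ0 GQ0]] hG]] := Hmu k.
  have [e' [F [Fh FE]]] := homog_of_multihomogeneous Gm.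
  have Fx : mmap iota x F != 0.
    apply: (form_neq0 (pQ0 0) Fh); rewrite FE.
    by rewrite (_ : row 0 Q0 = Q0) //; apply/rowP => i; rewrite mxE.
  have [|P [pP]] := exists_point tr (dhomogM Fh Bh) _ gx.1.
    by rewrite rmorphM mulf_neq0.
  rewrite mevalM mulf_eq0 negb_or => /andP[FP BP].
  pose o (i : 'I_1) : open_set iota x B := exist _ P (conj pP BP).
  have rowP' (i : 'I_1) : row i P = P by apply/rowP => l; rewrite mxE ord1.
  have oP (i : 'I_1) : sval (o i) = row i P by rewrite rowP'.
  have [||r' [dr' r'E]] := hG P; first by move=> i; rewrite rowP'.
    by rewrite -FE.
  have re := dim_eq_uniq dr' (dimE k _ _ _ oP).
  exists [seq o i | i <- enum 'I_1]; first by rewrite size_map size_enum_ord.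
  rewrite -rank_stack; have := rank_leq_col (stack ev D1 D2 f k o).
  move: r'E; rewrite expE re mul1n => r'E rk.
  have := r'E; have := rE; lia.
have [Qs sQs rQs] := independent_4_9 ev_cst irr d1 d2 c12 u w ind1 m.
move: sQs rQs; set n := (4 ^ u * 9 ^ w)%N => sQs rQs.
pose q := minn r (n * size (tri m)).
have [o0 ro0] : exists o : 'I_n -> open_set iota x B, (q <= \rank (stack ev D1 D2 f m o))%N.
  pose t : n.-tuple (open_set iota x B) := Tuple (introT eqP sQs).
  exists (tnth t); rewrite rank_stack map_tnth_enum; exact: rQs.
have [Pm [J dPJ]] := rank_minor ro0.
have /choice[g /choice[GG hGG]] : forall i : 'I_n, exists g (G : {mpoly C[N.+1]}),
    [/\ G \is g.-homog, G.@[sval (o0 i) 0] != 0 &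
     forall a l, exists F, F \is g.-homog /\
       j (jet_mx f D1 D2 (tri m) a l) = mmap iota x F / mmap iota x G].
  move=> i; have [|g [G [Gh G0 hG]]] := @common_denominator (sval (o0 i))
      [seq j (jet_mx f D1 D2 (tri m) al.1 al.2) |
        al <- enum {: 'I_(size (tri m)) * 'I_r}] _ (svalP (o0 i)).1.
    by move=> _ /mapP[al _ ->]; apply/localP; eexists; exact: jv.
  exists g, G; split=> // a l; apply: hG.
  by apply/mapP; exists (a, l); rewrite ?mem_enum.
have /choice[FF hFF] : forall ial : 'I_n * 'I_(size (tri m)) * 'I_r, exists F,
    F \is (g ial.1.1).-homog /\
    j (jet_mx f D1 D2 (tri m) ial.1.2 ial.2) = mmap iota x F / mmap iota x (GG ial.1.1).
  by move=> [[i a] l]; have [_ _ h] := hGG i; apply: h.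
(* The conditions cleared of denominators: every row is multiplied by the product of the [GG i] over
   all points, so that [M] specializes to a scalar multiple of [stack]. *)
pose M : 'M[{mpoly C[n * N.+1]}]_(#|{: 'I_n * 'I_(size (tri m))}|, r) :=
  \matrix_(k, l) (slot (enum_val k).1 (FF (enum_val k, l)) *
    \prod_(i | i != (enum_val k).1) slot i (GG i)).
pose ME (X : 'M[C]_(n, N.+1)) := map_mx (meval (mxvec X 0)) M.
pose cm p p' (X : 'M[C]_(p, p')) := map_mx (@mpolyC (n * N.+1) C) X.
(* The minor bounds the rank; the other factors keep every point in the chart and off the zeros of
   the denominators. *)
pose G := \det (cm _ _ Pm *m M *m cm _ _ J) * \prod_i slot i (GG i * B).
have detE X : (\det (cm _ _ Pm *m M *m cm _ _ J)).@[mxvec X 0] = \det (Pm *m ME X *m J).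
  rewrite -det_map_mx !map_mxM /=; congr (\det (_ *m _ *m _));
    by apply/matrixP => a c; rewrite !mxE mevalC.
have GE X : G.@[mxvec X 0] = \det (Pm *m ME X *m J) *
    \prod_i ((GG i).@[(row i X) 0] * B.@[(row i X) 0]).
  rewrite mevalM detE rmorph_prod; congr (_ * _).
  by apply: eq_bigr => i _; rewrite /= slotE mevalM.
have MEo (X : 'M[C]_(n, N.+1)) (o : 'I_n -> open_set iota x B) :
    (forall i, sval (o i) = row i X) -> (forall i, (GG i).@[(row i X) 0] != 0) ->
    ME X = (\prod_i (GG i).@[(row i X) 0]) *: stack ev D1 D2 f m o.
  move=> oX GX; apply/matrixP => k l; rewrite !mxE /= mevalM rmorph_prod slotE /=.
  set i := (enum_val k).1; rewrite [X in _ = X * _](bigD1 i) //= -mulrA [RHS]mulrCA mulrC.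
  have [Fh jE] := hFF (enum_val k, l); have [Gh _ _] := hGG i.
  congr (_ * _); first by apply: eq_bigr => i' _; rewrite slotE.
  have := jv (o i) (jet_mx f D1 D2 (tri m) (enum_val k).2 l); rewrite mxE in jE.
  rewrite mxE jE oX => v.
  rewrite (value_inj _ v (value_form iota x Fh Gh (GX i))); last first.
    by rewrite -oX; case: (svalP (o i)).
  by rewrite mulrC divfK.
have eGB (X : 'M[C]_(n, N.+1)) : \prod_i ((GG i).@[(row i X) 0] * B.@[(row i X) 0]) != 0 ->
    forall i, (GG i).@[(row i X) 0] != 0 /\ B.@[(row i X) 0] != 0.
  move=> /prodf_neq0 h i; apply/andP; rewrite -negb_or -mulf_eq0; exact: h.
exists G; split.
(* Scaling the i-th point multiplies all of [M] by t_i^(g i), hence the q by q minor by its q-th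
   power; g i + e is the degree of [GG i * B]. *)
- exists (fun i => g i * q + (g i + e))%N => t X.
  have -> : \prod_i t i ^+ (g i * q + (g i + e)) =
      (\prod_i t i ^+ g i) ^+ q * \prod_i t i ^+ (g i + e).
    rewrite -prodrXl -big_split; apply: eq_bigr => i _.
    by rewrite exprD exprM.
  rewrite /G !mevalM mulrACA; congr (_ * _).
    rewrite !detE (_ : ME _ = (\prod_i t i ^+ g i) *: ME X).
      by rewrite -scalemxAr -scalemxAl detZ.
    apply/matrixP => k l; rewrite !mxE !mevalM !rmorph_prod /=; set i := (enum_val k).1.
    have [Fh _] := hFF (enum_val k, l).
    rewrite (slot_homog _ t X Fh) [X in _ = X * _](bigD1 i) //= mulrACA; congr (_ * _).
    rewrite -big_split; apply: eq_bigr => i' _.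
    by apply: slot_homog; case: (hGG i').
  rewrite !rmorph_prod -big_split /=; apply: eq_bigr => i _.
  by apply: slot_homog; rewrite dhomogM //; case: (hGG i).
- pose X := \matrix_(i, l) sval (o0 i) 0 l.
  have oX i : sval (o0 i) = row i X by apply/rowP => l; rewrite !mxE.
  exists X; split=> [i|]; first by rewrite -oX; case: (svalP (o0 i)).
  have GX i : (GG i).@[(row i X) 0] != 0 by rewrite -oX; case: (hGG i).
  rewrite GE (MEo X o0) // -scalemxAr -scalemxAl detZ !mulf_neq0 ?expf_neq0 //.
    by apply/prodf_neq0.
  by apply/prodf_neq0 => i _; rewrite mulf_neq0 // -oX; case: (svalP (o0 i)).
move=> Q pQ; rewrite GE mulf_eq0 negb_or => /andP[dQ /eGB GB].
pose o i : open_set iota x B := exist _ (row i Q) (conj (pQ i) (GB i).2).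
have GQ i := (GB i).1.
exists (r - \rank (stack ev D1 D2 f m o))%N; split; first exact: dimE.
rewrite expE; have := rank_leq_col (stack ev D1 D2 f m o).
have : (\rank (stack ev D1 D2 f m o) <= n * size (tri m))%N.
  by apply: leq_trans (rank_leq_row _) _; rewrite card_prod !card_ord.
have : (q <= \rank (stack ev D1 D2 f m o))%N.
  move: dQ; rewrite (MEo Q o) // => /minor_rank; rewrite mxrank_scale_nz //.
  by apply/prodf_neq0.
by rewrite /q; have := rE; lia.
Qed.

End MainTheorem.

Theorem theorem4p1 (R : realType) (K : fieldType)
    (iota : {rmorphism R[i] -> K}) (N : nat) (x : 'I_N.+1 -> K)
    (H : 'rV[R[i]]_N.+1 -> K) (gamma : int) (d : nat)
    (HS : generic_K3 iota x H)
    (Hgamma : self_intersection iota x H gamma)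
    (Hd : (0 < d)%N)
    (Hmu : forall mu : nat,
       non_special iota x H gamma d (fun _ : 'I_1 => mu)) :
  forall m u w : nat, (0 < m)%N -> (0 < u)%N -> (0 < w)%N ->
    non_special iota x H gamma d (fun _ : 'I_(4 ^ u * 9 ^ w)%N => m).
Proof.
have [[gx sm _ _] [cH _ _] _] := HS.
move=> m u w _ _ _; exact: (non_special_4_9 gx sm cH Hmu).
Qed.
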